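(* Let $\mu\ge0$ and $\lambda\in\mathbb{R}$, and let $f(z)$ be an entire function with the representation $$f(z)=\int_0^1\cos(\lambda zt)\,g(t)\,dt,$$ where the function $g$ is non-negative and non-decreasing. Then $f(D)$ maps $\overline{\mathcal{S}}_\mu(\mathbb{R})$ into $\overline{\mathcal{S}}_\delta(\mathbb{R})$, where $\delta=\sqrt{\max\{\mu^2-\lambda^2/4,0\}}$.
   Context: $D=d/dz$; for $f(z)=\sum c_kz^k$, $f(D)\varphi=\sum c_k\varphi^{(k)}$ (locally uniformly convergent in the present situation). $\mathcal{S}_\mu$ is the set of complex polynomials whose zeros all lie in $|\operatorname{Im}z|\le\mu$, $\overline{\mathcal{S}}_\mu$ is its closure under uniform limits on compact subsets of $\mathbb{C}$ (it contains $0$), and $\overline{\mathcal{S}}_\mu(\mathbb{R})$ is the set of real entire functions (real on the real axis) in $\overline{\mathcal{S}}_\mu$. *)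

(* Defs.v *)
From HB Require Import structures.
From mathcomp Require Import all_boot all_order all_algebra.
From mathcomp Require Import complex.
From mathcomp Require Import all_classical all_reals all_analysis.

Set Implicit Arguments.
Unset Strict Implicit.
Unset Printing Implicit Defensive.

Import Order.TTheory GRing.Theory Num.Theory.
Import numFieldNormedType.Exports.

Local Open Scope classical_set_scope.
Local Open Scope ring_scope.
Local Open Scope complex_scope.

Section Defs.
Variable R : realType.

(* [R[i]^o] is the field of complex numbers as a normed space over itself, so
   [derivable] and [derive1n] are the complex ones on this type. *)
Local Notation C := (R[i]^o).

Definition cexp (z : C) : C :=
  (expR (complex.Re z) * cos (complex.Im z)) +i*
  (expR (complex.Re z) * sin (complex.Im z)).

Definition ccos (z : C) : C := (cexp ('i * z) + cexp (- ('i * z))) / 2.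

Definition cintegral (D : set R) (h : R -> C) : C :=
  (\int[lebesgue_measure]_(t in D) complex.Re (h t)) +i*
  (\int[lebesgue_measure]_(t in D) complex.Im (h t)).

Definition entire (phi : C -> C) : Prop := forall z : C, derivable phi z 1.

Definition real_on_reals (phi : C -> C) : Prop :=
  forall x : R, complex.Im (phi x%:C) = 0.

(* The zero polynomial has every complex number as a root, so it is not in
   [strip_poly mu]; the zero function does belong to [strip_closure mu]. *)
Definition strip_poly (mu : R) : set {poly R[i]} :=
  [set p | forall z : R[i], root p z -> `|complex.Im z| <= mu].

Definition strip_closure (mu : R) : set (C -> C) :=
  [set phi : C -> C | exists2 p : nat -> {poly R[i]},
    (forall n, strip_poly mu (p n)) &
    {family compact, (fun n => horner (p n) : C -> C) @ \oo --> phi}].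

Definition real_strip_closure (mu : R) : set (C -> C) :=
  [set phi : C -> C | [/\ entire phi, real_on_reals phi & strip_closure mu phi]].

Definition taylor_coef (f : C -> C) (k : nat) : C :=
  derive1n k f 0 / (k`!)%:R.

Definition diffop_partial (f phi : C -> C) (n : nat) (z : C) : C :=
  \sum_(0 <= k < n) taylor_coef f k * derive1n k phi z.

(* [lim] is total: the value at [z] is meaningful only when the partial sums
   converge there. *)
Definition diffop (f phi : C -> C) (z : C) : C :=
  lim ((fun n => diffop_partial f phi n z) @ \oo).

End Defs.

(* Main.v *)
(* On real polynomials [f(D)] is a limit of cosine sums
   [sum_k e_k (p (z + i k h) + p (z - i k h))] with nonnegative nondecreasing
   weights, the zeros of [sum_k e_k w ^ k] being in the unit disc by
   Eneström-Kakeya.  De Bruijn's inequality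
   [|p (z - i lambda / 2)| < |p (z + i lambda / 2)|] holds for [Im z > delta],
   and each factor [w - w_j] of the weight polynomial turns a pair (A, B) with
   [|B| < |A|] above the line [Im z = delta] into another such pair, so the two
   halves of the cosine sum cannot cancel there.

   The approximating polynomials of [phi] need not be real, whereas conjugate
   pairs of zeros are essential for de Bruijn's inequality.  One divides the zeros
   of [phi] in a large square out of [phi]; the remaining factor is, by Weierstrass
   canonical factors and the boundedness of [sum_j |z0 - x_j| ^ -2], close to
   [beta e ^ (b z - a z ^ 2 / 2)] with [a >= 0] and [a], [b], [beta] real, hence
   to a polynomial with real zeros. *)
Require Import Defs.
From HB Require Import structures.
From mathcomp Require Import all_boot all_order all_algebra.
From mathcomp Require Import complex.
From mathcomp Require Import all_classical all_reals all_analysis.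
From mathcomp Require Import measurable_realfun.
From mathcomp Require cyclic separable cyclotomic.
From mathcomp Require Import ring lra.

Set Implicit Arguments.
Unset Strict Implicit.
Unset Printing Implicit Defensive.

Import Order.TTheory GRing.Theory Num.Theory.
Import numFieldNormedType.Exports.

Local Open Scope classical_set_scope.
Local Open Scope ring_scope.
Local Open Scope complex_scope.

(** * Complex norm and locally uniform convergence *)

(** Every entire function that occurs is a locally uniform limit of polynomials, so Cauchy estimates
    are proved for polynomials by averaging over roots of unity, with constants that survive the
    limit.

    Eneström-Kakeya only yields the closed disc, whereas the step on pairs needs [|w_j| < 1] and a
    positive last weight. Three perturbations supply this: weights [W k + eta], an extra factor
    [(1 + eta) ^ k], and a step built on [|lambda| + eta], positive even when [lambda = 0]; [eta]
    then tends to 0. The cosine sum reaches the height [h n = |lambda| + eta], and centring its two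
    halves shifts each by [h n / 2]: this is the origin of [lambda ^ 2 / 4].

    Zeros of limits are handled without the argument principle. At a base point [z0] at least 1
    above the strip, all terms of [Im (p' / p)] have one sign, so a bound on [p' / p] bounds
    [sum_j |z0 - x_j| ^ -2] uniformly along the approximants. That single bound gives a quantitative
    Hurwitz theorem, the finiteness of the number of zeros in a square and the smallness of the
    Weierstrass remainder. *)

Section ComplexNorm.
Variable R : realType.
Local Notation C := R[i].
Implicit Types (x y z w : C) (r e : R).

Local Notation N := (@Normc.normc R).

Lemma normcE2 z : N z = Num.sqrt (complex.Re z ^+ 2 + complex.Im z ^+ 2).
Proof. by case: z. Qed.

Lemma norm_normc z : `|z| = (N z)%:C.
Proof. by rewrite normc_def normcE2. Qed.

Lemma normc_ge0 z : 0 <= N z.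
Proof. by rewrite normcE2 sqrtr_ge0. Qed.

Lemma sqr_normcE z : N z ^+ 2 = complex.Re z ^+ 2 + complex.Im z ^+ 2.
Proof. by rewrite normcE2 sqr_sqrtr // addr_ge0 ?sqr_ge0. Qed.

Lemma normcD z w : N (z + w) <= N z + N w.
Proof. by rewrite -lecR rmorphD /= -!norm_normc ler_normD. Qed.

Lemma normc_opp z : N (- z) = N z.
Proof. by apply: (@complexI R); rewrite -!norm_normc normrN. Qed.

Lemma normcB z w : N (z - w) <= N z + N w.
Proof. by rewrite -(normc_opp w) normcD. Qed.

Lemma normc_dist z w : N (z - w) = N (w - z).
Proof. by rewrite -normc_opp opprB. Qed.

Lemma normc_dist_trans y z w : N (z - w) <= N (z - y) + N (y - w).
Proof. by rewrite (le_trans _ (normcD _ _)) // addrA subrK. Qed.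

Lemma normc_sub_ge z w : N z - N w <= N (z - w).
Proof. by rewrite lerBlDr -{1}(subrK w z) normcD. Qed.

Lemma normcX z n : N (z ^+ n) = N z ^+ n.
Proof. by apply: (@complexI R); rewrite rmorphXn /= -!norm_normc normrX. Qed.

Lemma normc_eq0 z : (N z == 0) = (z == 0).
Proof.
apply/eqP/eqP => [|->]; last exact: Normc.normc0.
exact: Normc.eq0_normc.
Qed.

Lemma normc_gt0 z : (0 < N z) = (z != 0).
Proof. by rewrite lt_neqAle normc_ge0 andbT eq_sym normc_eq0. Qed.

Lemma normc_real r : N r%:C = `|r|.
Proof. by rewrite /= expr0n addr0 sqrtr_sqr. Qed.

Lemma normc_nat n : N n%:R = n%:R.
Proof. by rewrite -[n%:R]/(1 *+ n) -(rmorph_nat (real_complex R)) normc_real normr_nat. Qed.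

Lemma normc_i : N 'i = 1.
Proof. by rewrite /= expr0n add0r expr1n sqrtr1. Qed.

Lemma normc_conj z : N z^* = N z.
Proof. by case: z => a b; rewrite !normcE2 /= sqrrN. Qed.

Lemma normc_div z w : N (z / w) = N z / N w.
Proof. by rewrite Normc.normcM Normc.normcV. Qed.

Lemma normc_sum (I : Type) (s : seq I) (P : pred I) (F : I -> C) :
  N (\sum_(i <- s | P i) F i) <= \sum_(i <- s | P i) N (F i).
Proof.
elim/big_ind2 : _ => //; first by rewrite Normc.normc0.
by move=> x1 x2 y1 y2 h1 h2; rewrite (le_trans (normcD _ _)) // lerD.
Qed.

Lemma normc_prod (I : Type) (s : seq I) (P : pred I) (F : I -> C) :
  N (\prod_(i <- s | P i) F i) = \prod_(i <- s | P i) N (F i).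
Proof.
elim/big_ind2 : _ => //; first by rewrite Normc.normc1.
by move=> x1 x2 y1 y2 <- <-; rewrite Normc.normcM.
Qed.

Lemma normc_Re z : `|complex.Re z| <= N z.
Proof. by rewrite normcE2 -sqrtr_sqr ler_wsqrtr // lerDl sqr_ge0. Qed.

Lemma normc_Im z : `|complex.Im z| <= N z.
Proof. by rewrite normcE2 -sqrtr_sqr ler_wsqrtr // lerDr sqr_ge0. Qed.

Lemma normc_le_ReIm z : N z <= `|complex.Re z| + `|complex.Im z|.
Proof.
rewrite {1}(complexE z) (le_trans (normcD _ _)) // Normc.normcM normc_i mul1r.
by rewrite !normc_real.
Qed.

Lemma divr2_gt0 e : 0 < e -> 0 < e / 2.
Proof. by move=> ?; rewrite divr_gt0. Qed.

Lemma nbhs_normcP (z : C^o) (A : set C^o) :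
  nbhs z A <-> exists2 e, 0 < e & forall w : C, N (w - z) < e -> A w.
Proof.
split=> [/nbhs_ballP[/= e e0]|[e e0 sub]].
  rewrite -ball_normE => sub.
  have eE : e = (complex.Re e)%:C by rewrite RRe_real // gtr0_real.
  exists (complex.Re e); first by rewrite -ltcR -eE.
  by move=> w wz; apply: sub => /=; rewrite eE distrC norm_normc ltcR.
apply/nbhs_ballP; exists e%:C => /=; first by rewrite ltcR.
by move=> w; rewrite -ball_normE /=; rewrite distrC norm_normc ltcR; exact: sub.
Qed.

Lemma cvg_normcP T (F : set_system T) {FF : Filter F} (u : T -> C^o) (l : C^o) :
  u @ F --> l <-> forall e, 0 < e -> \forall x \near F, N (u x - l) < e.
Proof.
split=> [ul e e0|ul A /nbhs_normcP[e e0 sub]].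
  by apply: (ul [set w : C | N (w - l) < e]); apply/nbhs_normcP; exists e.
by apply: filterS (ul _ e0) => x /sub.
Qed.

Lemma continuous_normc : continuous (N : C^o -> R).
Proof.
move=> z; apply/(@cvgrPdist_lt _ _ _ (nbhs z) (nbhs_filter z)) => e e0.
apply/nbhs_normcP; exists e => // w wz.
apply: le_lt_trans wz; rewrite ler_norml.
by rewrite lerNl opprB normc_sub_ge normc_dist normc_sub_ge.
Qed.

Lemma compact_normc_bounded (A : set C^o) :
  compact A -> exists L : R, forall z, A z -> N z <= L.
Proof.
move=> cA; have : compact (N @` A).
  by apply: continuous_compact cA; apply: continuous_subspaceT => z; exact: continuous_normc.
move=> /compact_bounded[M [_ HM]]; exists (M + 1) => z Az.
have := HM (M + 1); rewrite ltrDl ltr01 => /(_ isT (N z)) /=.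
by move=> H; apply: le_trans (H _); [exact: ler_norm|exists z].
Qed.

(** Compactness comes from the product of two segments, which is why squares, not discs, serve as
    the compact sets below. *)
Lemma square_compact L : compact ([set z : C^o | `|complex.Re z| <= L /\ `|complex.Im z| <= L]).
Proof.
pose h (p : R * R) : C^o := p.1 +i* p.2.
have -> : [set z : C^o | `|complex.Re z| <= L /\ `|complex.Im z| <= L] =
    h @` (`[-L, L] `*` `[-L, L]).
  apply/seteqP; split => [[a b] /= [ha hb]|_ [[a b]] /= [ha hb] <-] /=.
    by exists (a, b) => //=; rewrite !in_itv /= -!ler_norml.
  by move: ha hb; rewrite !in_itv /= -!ler_norml.
apply: continuous_compact; last by apply: compact_setX; exact: segment_compact.
apply: continuous_subspaceT => -[a b]; apply/cvg_normcP => e e0.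
have e20 := divr2_gt0 e0.
near=> p; have -> : h p - h (a, b) = (p.1 - a) +i* (p.2 - b) by [].
apply: le_lt_trans (normc_le_ReIm _) _ => /=; rewrite [e]splitr ltrD //.
  by near: p; move: (e / 2) e20; apply/cvgrPdistC_lt; exact: cvg_fst.
by near: p; move: (e / 2) e20; apply/cvgrPdistC_lt; exact: cvg_snd.
Unshelve. all: by end_near. Qed.

Definition loc_unif (u : nat -> C -> C) (phi : C -> C) :=
  forall L e, 0 < e -> exists n0, forall n, (n0 <= n)%N ->
    forall z, N z <= L -> N (u n z - phi z) <= e.

Lemma family_compact_loc_unif (u : nat -> C^o -> C^o) (phi : C^o -> C^o) :
  {family compact, u @ \oo --> phi} <-> loc_unif u phi.
Proof.
split=> [/fam_cvgP cu L e e0|lu].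
  have := cu _ (@square_compact L); pose E := [set xy : C^o * C^o | N (xy.2 - xy.1) < e].
  move=> /(_ [set h | forall y : C^o, `|complex.Re y| <= L /\ `|complex.Im y| <= L ->
     E (phi y, h y)]) [].
    apply/uniform_nbhs; exists E; split => //.
    rewrite -entourage_ballE; exists e%:C => /=; first by rewrite ltcR.
    by move=> [x y] /=; rewrite -ball_normE /= distrC norm_normc ltcR.
  move=> n0 _ H; exists n0 => n n0n z zL; apply/ltW/(H n n0n).
  by split; apply: le_trans zL; rewrite ?normc_Re ?normc_Im.
apply/fam_cvgP => A /compact_normc_bounded[L AL] P /uniform_nbhs[E [entE]].
move: entE; rewrite -entourage_ballE => -[/= e e0 subE] subP.
have eE : e = (complex.Re e)%:C by rewrite RRe_real // gtr0_real.
have re0 : 0 < complex.Re e by rewrite -ltcR -eE.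
have [n0 H] := lu L _ (divr2_gt0 re0).
exists n0 => // n n0n; apply: subP => y Ay; apply: subE => /=.
rewrite -ball_normE /= eE distrC norm_normc ltcR.
apply: le_lt_trans (H n n0n y (AL _ Ay)) _.
by rewrite gtr_pMr // invf_lt1 // ltr1n.
Qed.

Lemma loc_unif_cvg u phi (z : C) : loc_unif u phi -> (u n z : C^o) @[n --> \oo] --> (phi z : C^o).
Proof.
move=> lu; apply/cvg_normcP => e e0; have [n0 H] := lu (N z) _ (divr2_gt0 e0).
exists n0 => // n n0n; apply: le_lt_trans (H n n0n z (lexx _)) _.
by rewrite gtr_pMr // invf_lt1 // ltr1n.
Qed.

Lemma loc_unif_unique u phi psi : loc_unif u phi -> loc_unif u psi -> phi = psi.
Proof.
move=> h1 h2; apply/funext => z.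
have := cvg_unique (@norm_hausdorff _ C^o) (@loc_unif_cvg _ _ z h1) (@loc_unif_cvg _ _ z h2).
exact.
Qed.

Definition loc_unif_cauchy (u : nat -> C -> C) :=
  forall L e, 0 < e -> exists n0, forall n m, (n0 <= n)%N -> (n0 <= m)%N ->
    forall z, N z <= L -> N (u n z - u m z) <= e.

Lemma normc_cauchy_cvg (v : nat -> C) :
  (forall e, 0 < e -> exists n0, forall n m, (n0 <= n)%N -> (n0 <= m)%N ->
     N (v n - v m) <= e) ->
  exists l, forall e, 0 < e -> exists n0, forall n, (n0 <= n)%N -> N (v n - l) <= e.
Proof.
move=> cv.
have key (f : C -> R) : (forall z w, `|f z - f w| <= N (z - w)) ->
    exists a : R, (f (v n)) @[n --> \oo] --> a.
  move=> hf; suff h : cvg (f (v n) @[n --> \oo]) by exists (lim (f (v n) @[n --> \oo])).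
  apply/cauchy_cvgP/cauchy_ballP => e e0.
  have [n0 H] := cv _ (divr2_gt0 e0).
  pose A := [set a | exists2 n, (n0 <= n)%N & a = f (v n)].
  exists (A, A); first by split; exists n0 => // n /= hn; exists n.
  move=> [_ _] /= [[n hn ->] [m hm ->]].
  rewrite -ball_normE /=.
  apply: le_lt_trans (hf _ _) _; apply: le_lt_trans (H _ _ hn hm) _.
  by rewrite gtr_pMr // invf_lt1 // ltr1n.
have [|a ha] := key (@complex.Re R).
  by move=> [x1 x2] [y1 y2]; exact: (normc_Re ((x1 +i* x2) - (y1 +i* y2))).
have [|b hb] := key (@complex.Im R).
  by move=> [x1 x2] [y1 y2]; exact: (normc_Im ((x1 +i* x2) - (y1 +i* y2))).
exists (a +i* b) => e e0; have e20 := divr2_gt0 e0.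
have [n1 _ h1] := (cvgrPdistC_le _ _).1 ha _ e20.
have [n2 _ h2] := (cvgrPdistC_le _ _).1 hb _ e20.
exists (maxn n1 n2) => n; rewrite geq_max => /andP[hn1 hn2].
apply: le_trans (normc_le_ReIm _) _; rewrite [e]splitr lerD //.
  by move: (h1 n hn1) => /=; case: (v n).
by move: (h2 n hn2) => /=; case: (v n).
Qed.

Lemma loc_unif_cauchy_cvg u : loc_unif_cauchy u -> exists phi, loc_unif u phi.
Proof.
move=> cu.
have /choice[phi hphi] : forall z, exists l, forall e, 0 < e ->
    exists n0, forall n, (n0 <= n)%N -> N (u n z - l) <= e.
  move=> z; apply: normc_cauchy_cvg => e e0.
  have [n0 H] := cu (N z) e e0; exists n0 => n m hn hm.
  exact: H hn hm z (lexx _).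
exists phi => L e e0; have e20 := divr2_gt0 e0.
have [n0 H] := cu L _ e20; exists n0 => n hn z zL.
have [n1 H1] := hphi z _ e20.
apply: le_trans (normc_dist_trans (u (maxn n0 n1) z) _ _) _.
by rewrite [e]splitr lerD ?H ?H1 ?leq_maxl ?leq_maxr.
Qed.

End ComplexNorm.

(** * Cauchy estimates for polynomials *)

Section CauchyEstimates.
Variable R : realType.
Local Notation C := R[i].
Implicit Types (x y z w : C) (r e : R) (p q : {poly C}).

Local Notation N := (@Normc.normc R).

Lemma prim_root_exists_complex n : (0 < n)%N -> exists w : C, n.-primitive_root w.
Proof.
move=> n_gt0; pose p : {poly C} := 'X^n - 1.
have [r Dp] := closed_field_poly_normal p.
rewrite (monicP _) ?monicXnsubC // scale1r in Dp.
have rn1 : all n.-unity_root r by apply/allP => z; rewrite -root_prod_XsubC -Dp.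
have sz_r : (n < (size r).+1)%N.
  by rewrite -(size_prod_XsubC r id) -Dp size_XnsubC.
have [|z] := hasP (cyclic.has_prim_root n_gt0 rn1 _ sz_r); last by exists z.
by rewrite -separable.separable_prod_XsubC -Dp cyclotomic.separable_Xn_sub_1 // pnatr_eq0 -lt0n.
Qed.

(** Orthogonality of the powers of [w]: the discrete substitute for integrating over a circle. *)
Lemma sum_prim_root_expr n (w : C) m : n.-primitive_root w ->
  \sum_(j < n) w ^+ (m * j) = if (n %| m)%N then n%:R else 0.
Proof.
move=> pw; case: ifPn => nm.
  transitivity (\sum_(j < n) (1 : C)).
    apply: eq_bigr => j _; apply/eqP.
    by rewrite -(prim_order_dvd pw) dvdn_mulr.
  by rewrite sumr_const card_ord.
have wm1 : w ^+ m - 1 != 0 by rewrite subr_eq0 -(prim_order_dvd pw).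
apply: (mulfI wm1); rewrite mulr0.
under eq_bigr do rewrite exprM.
by rewrite -subrX1 -exprM mulnC exprM (prim_expr_order pw) expr1n subrr.
Qed.

Lemma normc_prim_root n (w : C) : n.-primitive_root w -> N w = 1.
Proof.
move=> pw; have n0 := prim_order_gt0 pw.
apply/eqP.
by rewrite -(eqrXn2 n0) ?normc_ge0 ?ler01 // -normcX (prim_expr_order pw) Normc.normc1 expr1n.
Qed.

(** Averaging [p] over [n] equally spaced points of the circle against [w ^ (- k j)] isolates the
    [k]-th Taylor term exactly once [n] exceeds both [k] and the degree; the exponent [n - k] stands
    for [- k]. *)
Lemma cauchy_estimate p z r M k : 0 <= r ->
  (forall w, N (w - z) = r -> N p.[w] <= M) ->
  N p^`N(k).[z] * r ^+ k <= M.
Proof.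
move=> r0 pM; pose n := (maxn (size p) k.+1).
have kn : (k < n)%N by rewrite leq_max leqnn orbT.
have n0 : (0 < n)%N by apply: leq_ltn_trans kn.
have [w pw] := prim_root_exists_complex n0.
have avg : \sum_(j < n) p.[z + r%:C * w ^+ j] * w ^+ ((n - k) * j) =
    n%:R * (p^`N(k).[z] * r%:C ^+ k).
  transitivity (\sum_(j < n) \sum_(i < n)
     (p^`N(i).[z] * r%:C ^+ i) * w ^+ ((i + (n - k)) * j)).
    apply: eq_bigr => j _; rewrite (@nderiv_taylor_wide _ n) ?leq_maxl //; last first.
      exact: mulrC.
    rewrite mulr_suml; apply: eq_bigr => i _.
    by rewrite exprMn -!mulrA -exprM -exprD mulnDl [(i * j)%N]mulnC.
  rewrite exchange_big /= (bigD1 (Ordinal kn)) //= [X in _ + X]big1 ?addr0.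
    rewrite -mulr_sumr sum_prim_root_expr // subnKC 1?ltnW // dvdnn.
    by rewrite mulrC.
  move=> i ik; rewrite -mulr_sumr sum_prim_root_expr //.
  rewrite ifN ?mulr0 //; apply: contra ik => /dvdnP[q].
  (* [i + (n - k)] lies strictly between 0 and [2 n], so the only multiple of [n] it can be is [n],
     that is [i = k]. *)
  have := ltn_ord i; move: kn; case: q => [|[|q]].
  - by move=> h1 h2; rewrite mul0n => /eqP; rewrite addn_eq0 subn_eq0 leqNgt h1 andbF.
  - move=> h1 h2; rewrite mul1n => h3; apply/eqP/val_inj => /=.
    by apply/eqP; rewrite -(eqn_add2r (n - k)) h3 subnKC // ltnW.
  - move=> h1 h2 h3; have : (i + (n - k) < n + n)%N.
      by rewrite -addSn leq_add // leq_subr.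
    by rewrite h3 !mulSn addnA -{2}[(n + n)%N]addn0 ltn_add2l.
have := congr1 N avg; rewrite !Normc.normcM normcX normc_real normc_nat (ger0_norm r0) => avgN.
have n0R : 0 < n%:R :> R by rewrite ltr0n.
rewrite -(ler_pM2l n0R) -avgN (le_trans (normc_sum _ _ _)) //.
rewrite -[n in leRHS]card_ord -sumr_const mulr_suml ler_sum // => j _.
rewrite mul1r Normc.normcM normcX (normc_prim_root pw) expr1n mulr1 pM //.
by rewrite addrC addKr Normc.normcM normcX (normc_prim_root pw) expr1n mulr1
  normc_real ger0_norm.
Qed.

Lemma geo_tail (q : R) m n : 0 <= q <= 1 / 2 ->
  \sum_(m <= i < n) q ^+ i <= 2 * q ^+ m.
Proof.
move=> /andP[q0 q1]; have [nm|mn] := leqP n m.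
  by rewrite big_geq // mulr_ge0 ?exprn_ge0.
rewrite -(subnKC (ltnW mn)) -{1}[m]add0n big_addn addKn.
under eq_bigr do rewrite exprD.
rewrite -mulr_suml ler_wpM2r ?exprn_ge0 //.
elim: (n - m)%N => [|k IH]; first by rewrite big_geq.
rewrite big_nat_recl // expr0.
under eq_bigr do rewrite exprS.
by rewrite -mulr_sumr; nra.
Qed.

(** By the Cauchy estimates the [i]-th term is at most [M (|h| / r) ^ i], and [|h| <= r / 2] makes
    the tail at most twice its first bound. Only values on one circle enter, so the estimate
    survives limits of polynomials. *)
Lemma taylor_remainder p z r M m h : 0 < r ->
  (forall w, N (w - z) = r -> N p.[w] <= M) -> N h <= r / 2 ->
  N (p.[z + h] - \sum_(0 <= i < m) p^`N(i).[z] * h ^+ i) <= 2 * M * (N h / r) ^+ m.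
Proof.
move=> r0 pM hr; pose n := maxn (size p) m.
have M0 : 0 <= M.
  apply: le_trans (normc_ge0 _) (pM (z + r%:C) _).
  by rewrite addrC addKr normc_real gtr0_norm.
rewrite (@nderiv_taylor_wide _ n) ?leq_maxl //; last exact: mulrC.
rewrite -(big_mkord xpredT (fun i => p^`N(i).[z] * h ^+ i)).
rewrite (big_cat_nat (n := m)) ?leq_maxr //= addrAC subrr add0r.
apply: le_trans (normc_sum _ _ _) _.
apply: (@le_trans _ _ (\sum_(m <= i < n) M * (N h / r) ^+ i)).
  apply: ler_sum => i _; rewrite Normc.normcM normcX expr_div_n mulrA.
  rewrite ler_pdivlMr ?exprn_gt0 // mulrAC ler_wpM2r ?exprn_ge0 ?normc_ge0 //.
  by rewrite cauchy_estimate // ltW.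
rewrite -mulr_sumr [2 * M]mulrC -mulrA ler_wpM2l // geo_tail //.
by rewrite divr_ge0 ?normc_ge0 ?(ltW r0) //= ler_pdivrMr // div1r mulrC.
Qed.

End CauchyEstimates.

(** * Locally uniform limits of polynomials *)

Section LocUnif.
Variable R : realType.
Local Notation C := R[i].
Implicit Types (x y z w h : C) (r e : R) (p q : {poly C}) (P : nat -> {poly C}).
Implicit Types (u v : nat -> C -> C) (phi psi : C -> C).

Local Notation N := (@Normc.normc R).

Definition loc_bounded phi := forall L, exists2 M, 0 <= M & forall z, N z <= L -> N (phi z) <= M.

Lemma loc_bounded_cst c : loc_bounded (fun=> c).
Proof. by move=> L; exists (N c) => //; exact: normc_ge0. Qed.

Lemma loc_bounded_poly p : loc_bounded (horner p).
Proof.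
move=> L; exists (\sum_(i < size p) N p`_i * `|L| ^+ i).
  by apply: sumr_ge0 => i _; rewrite mulr_ge0 ?normc_ge0 ?exprn_ge0.
move=> z zL; rewrite horner_coef (le_trans (normc_sum _ _ _)) // ler_sum // => i _.
rewrite Normc.normcM normcX ler_wpM2l ?normc_ge0 // lerXn2r ?nnegrE ?normc_ge0 //.
by rewrite (le_trans zL) ?ler_norm.
Qed.

Lemma loc_unif_bounded u phi : (forall n, loc_bounded (u n)) ->
  loc_unif u phi -> loc_bounded phi.
Proof.
move=> bu lu L; have [n0 H] := lu L 1 ltr01.
have [M M0 HM] := bu n0 L; exists (M + 1) => [|z zL]; first by rewrite addr_ge0.
rewrite -(subrK (u n0 z) (phi z)) (le_trans (normcD _ _)) // addrC lerD ?HM //.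
by rewrite normc_dist H.
Qed.

Lemma loc_unif_le u phi z B : loc_unif u phi -> 
  (forall n, N (u n z) <= B) -> N (phi z) <= B.
Proof.
move=> lu uB; apply/ler_addgt0Pr => e e0; have [n0 H] := lu (N z) e e0.
rewrite -(subrK (u n0 z) (phi z)) (le_trans (normcD _ _)) // addrC lerD ?uB //.
by rewrite normc_dist H.
Qed.

Lemma loc_unif_eq u v phi : (forall n z, u n z = v n z) -> loc_unif u phi -> loc_unif v phi.
Proof. by move=> uv lu L e e0; have [n0 H] := lu L e e0; exists n0 => n hn z zL; rewrite -uv H. Qed.

Lemma loc_unif_shiftn u phi k : loc_unif u phi -> loc_unif (fun n => u (n + k)%N) phi.
Proof.
move=> lu L e e0; have [n0 H] := lu L e e0; exists n0 => n hn z zL.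
by apply: H => //; exact: leq_trans (leq_addr _ _).
Qed.

Lemma loc_unif_cst phi : loc_unif (fun=> phi) phi.
Proof. by move=> L e e0; exists 0%N => n _ z _; rewrite subrr Normc.normc0 ltW. Qed.

Lemma loc_unif_at u phi z : loc_unif u phi -> loc_unif (fun n _ => u n z) (fun=> phi z).
Proof.
move=> lu L e e0; have [n0 H] := lu (N z) e e0.
by exists n0 => n hn _ _; exact: H.
Qed.

Lemma loc_unif_add u v phi psi : loc_unif u phi -> loc_unif v psi ->
  loc_unif (fun n z => u n z + v n z) (fun z => phi z + psi z).
Proof.
move=> lu lv L e e0; have e20 := divr2_gt0 e0.
have [n1 H1] := lu L _ e20; have [n2 H2] := lv L _ e20.
exists (maxn n1 n2) => n; rewrite geq_max => /andP[h1 h2] z zL.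
by rewrite opprD addrACA (le_trans (normcD _ _)) // [e]splitr lerD ?H1 ?H2.
Qed.

Lemma loc_unif_sum (I : Type) (s : seq I) (u : I -> nat -> C -> C) (phi : I -> C -> C) :
  (forall i, loc_unif (u i) (phi i)) ->
  loc_unif (fun n z => \sum_(i <- s) u i n z) (fun z => \sum_(i <- s) phi i z).
Proof.
move=> lu; elim: s => [|i s IH].
  rewrite (_ : (fun z : C => _) = fun=> 0); last by apply/funext => z; rewrite big_nil.
  by apply: loc_unif_eq (@loc_unif_cst (fun=> 0)) => n z; rewrite big_nil.
rewrite (_ : (fun z : C => _) = fun z => phi i z + \sum_(j <- s) phi j z); last first.
  by apply/funext => z; rewrite big_cons.
by apply: loc_unif_eq (loc_unif_add (lu i) IH) => n z; rewrite big_cons.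
Qed.

Lemma loc_unif_mul u v phi psi : loc_bounded phi -> loc_bounded psi ->
  loc_unif u phi -> loc_unif v psi ->
  loc_unif (fun n z => u n z * v n z) (fun z => phi z * psi z).
Proof.
move=> bphi bpsi lu lv L e e0.
have [M1 M10 HM1] := bphi L; have [M2 M20 HM2] := bpsi L.
pose K := M1 + M2 + 1; have K0 : 0 < K by rewrite ltr_pwDr // addr_ge0.
pose e' := Num.min 1 (e / K); have e'0 : 0 < e' by rewrite lt_min ltr01 divr_gt0.
have e'1 : e' <= 1 by rewrite ge_min lexx.
have e'K : e' * K <= e by rewrite -ler_pdivlMr // ge_min lexx orbT.
have [n1 H1] := lu L _ e'0; have [n2 H2] := lv L _ e'0.
exists (maxn n1 n2) => n; rewrite geq_max => /andP[h1 h2] z zL.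
have -> : u n z * v n z - phi z * psi z =
  (u n z - phi z) * (v n z - psi z) + (u n z - phi z) * psi z + phi z * (v n z - psi z).
  by ring.
apply: le_trans (normcD _ _) _; apply: le_trans (lerD (normcD _ _) (lexx _)) _.
rewrite !Normc.normcM.
have := H1 n h1 z zL; have := H2 n h2 z zL.
have := HM1 _ zL; have := HM2 _ zL.
have := normc_ge0 (u n z - phi z); have := normc_ge0 (v n z - psi z).
have := normc_ge0 (phi z); have := normc_ge0 (psi z).
set a := N (u n z - phi z); set b := N (v n z - psi z); set c := N (phi z).
set d := N (psi z) => d0 c0 b0 a0 dM cM be ae; apply: le_trans e'K; rewrite /K.
have : a * b <= e' * 1 by rewrite ler_pM // (le_trans be).
have : a * d <= e' * M2 by rewrite ler_pM.
have : c * b <= M1 * e' by rewrite ler_pM.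
by lra.
Qed.

Lemma loc_unif_cmul u psi phi : loc_bounded psi -> loc_unif u phi -> 
  loc_unif (fun n z => psi z * u n z) (fun z => psi z * phi z).
Proof.
move=> bpsi lu L e e0; have [M M0 HM] := bpsi L.
have M10 : 0 < M + 1 by rewrite ltr_wpDl.
have [n1 H1] := lu L (e / (M + 1)) (divr_gt0 e0 M10).
exists n1 => n h1 z zL; rewrite -mulrBr Normc.normcM.
apply: le_trans (_ : (M + 1) * (e / (M + 1)) <= e); last by rewrite mulrCA divff ?mulr1 ?gt_eqF.
by rewrite ler_pM ?normc_ge0 ?H1 // (le_trans (HM _ zL)) // lerDl.
Qed.

Lemma loc_unif_comp_add u phi a : loc_unif u phi ->
  loc_unif (fun n z => u n (z + a)) (fun z => phi (z + a)).
Proof.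
move=> lu L e e0; have [n1 H1] := lu (L + N a) e e0.
by exists n1 => n h1 z zL; apply: H1 => //; rewrite (le_trans (normcD _ _)) // lerD.
Qed.

Lemma loc_unif_opp u phi : loc_unif u phi ->
  loc_unif (fun n z => - u n z) (fun z => - phi z).
Proof.
move=> lu L e e0; have [n1 H1] := lu L e e0.
by exists n1 => n h1 z zL; rewrite -opprD normc_opp H1.
Qed.

Lemma loc_unif_nderivn_cauchy P phi k : loc_unif (fun n => horner (P n)) phi ->
  loc_unif_cauchy (fun n => horner (P n)^`N(k)).
Proof.
move=> lP L e e0; have [n0 H] := lP (L + 1) _ (divr2_gt0 e0).
exists n0 => n m hn hm z zL; rewrite -hornerN -hornerD -nderivnB.
rewrite -[leLHS]mulr1 -(expr1n _ k); apply: cauchy_estimate => // w wz.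
have wL : N w <= L + 1.
  by rewrite -(subrK z w) (le_trans (normcD _ _)) // wz addrC lerD.
rewrite hornerD hornerN (le_trans (normc_dist_trans (phi w) _ _)) //.
by rewrite [e]splitr lerD ?H // normc_dist H.
Qed.

Lemma derive1_of_littleo phi (c z : C) :
  (forall e, 0 < e -> exists2 r, 0 < r & forall h, N h <= r ->
     N (phi (z + h) - phi z - h * c) <= e * N h) ->
  derivable (phi : C^o -> C^o) z 1 /\ (phi : C^o -> C^o)^`()%classic z = c.
Proof.
move=> H.
have cv : (fun h : C^o => h^-1 *: ((phi (h + z) : C^o) - phi z)) @ 0^' --> (c : C^o).
  apply/cvg_normcP => e e0; rewrite /dnbhs /within /=.
  have [r r0 Hr] := H _ (divr2_gt0 e0); apply/nbhs_normcP; exists r => // h.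
  rewrite subr0 => hr h0; have Nh0 : 0 < N h by rewrite normc_gt0.
  rewrite -[_ *: _]/(h^-1 * _).
  have -> : h^-1 * (phi (h + z) - phi z) - c = h^-1 * (phi (z + h) - phi z - h * c).
    by rewrite [h + z]addrC [RHS]mulrBr mulKf.
  rewrite Normc.normcM Normc.normcV mulrC ltr_pdivrMr //.
  apply: le_lt_trans (Hr _ (ltW hr)) _; rewrite ltr_pM2r //.
  by rewrite gtr_pMr // invf_lt1 // ltr1n.
split.
  apply: (cvgP (c : C^o)); rewrite (_ : (fun h => _) = (fun h : C^o => h^-1 *: ((phi (h + z) : C^o) - phi z))) //.
  by apply/funext => h /=; rewrite -[_ *: 1]/(h * 1) mulr1.
by rewrite /derive1; apply: cvg_lim cv; exact: norm_hausdorff.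
Qed.

(** Weierstrass's theorem: the derivatives form a Cauchy sequence by the estimate on unit circles,
    and the second-order Taylor bound, whose constant does not depend on [n], passes to the limit
    and identifies their limit as the derivative. *)
Lemma loc_unif_derive1 P phi : loc_unif (fun n => horner (P n)) phi ->
  entire (phi : C^o -> C^o) /\
  loc_unif (fun n => horner (P n)^`()) ((phi : C^o -> C^o)^`()%classic).
Proof.
move=> lP; have [psi lpsi] := loc_unif_cauchy_cvg (@loc_unif_nderivn_cauchy _ _ 1 lP).
have bphi : loc_bounded phi by apply: loc_unif_bounded lP => n; exact: loc_bounded_poly.
have key z : derivable (phi : C^o -> C^o) z 1 /\ (phi : C^o -> C^o)^`()%classic z = psi z.
  have [M M0 HM] := bphi (N z + 1).
  suff Q h : N h <= 1 / 2 ->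
      N (phi (z + h) - phi z - h * psi z) <= 2 * (M + 1) * N h ^+ 2.
    apply: derive1_of_littleo => e e0.
    have M10 : 0 < 2 * (M + 1) by rewrite mulr_gt0 // ltr_wpDl.
    exists (Num.min (1 / 2) (e / (2 * (M + 1)))); first by rewrite lt_min !divr_gt0.
    move=> h; rewrite le_min => /andP[/Q hq h2]; apply: le_trans hq _.
    by rewrite expr2 mulrA ler_wpM2r ?normc_ge0 // mulrC -ler_pdivlMr.
  move=> h1.
  have [n0 H0] := lP (N z + 1) 1 ltr01.
  have lu : loc_unif (fun n h => ((P (n + n0)%N).[h + z] - (P (n + n0)%N).[z]) 
       - h * (P (n + n0)%N)^`N(1).[z]) (fun h => (phi (h + z) - phi z) - h * psi z).
    apply: loc_unif_add.
      apply: loc_unif_add; first exact: (loc_unif_comp_add _ (loc_unif_shiftn n0 lP)).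
      exact: (loc_unif_opp (loc_unif_at _ (loc_unif_shiftn n0 lP))).
    apply: (@loc_unif_opp (fun n h => h * (P (n + n0)%N)^`N(1).[z]) (fun h => h * psi z)).
    apply: (@loc_unif_cmul (fun n h => (P (n + n0)%N)^`N(1).[z]) id (fun h => psi z)).
      by move=> L; exists `|L| => // w wL; rewrite (le_trans wL) ?ler_norm.
    exact: (loc_unif_at _ (loc_unif_shiftn n0 lpsi)).
  rewrite [z + h]addrC; apply: (loc_unif_le lu) => n.
  have := @taylor_remainder _ (P (n + n0)%N) z 1 (M + 1) 2 h ltr01.
  rewrite big_nat_recr //= big_nat1 expr0 mulr1 expr1 nderivn0 divr1 opprD addrA.
  rewrite [z + h]addrC [h * _]mulrC; apply => // w wz.
  have wL : N w <= N z + 1 by rewrite -(subrK z w) (le_trans (normcD _ _)) // wz addrC.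
  rewrite -(subrK (phi w) _.[w]) (le_trans (normcD _ _)) // addrC lerD ?HM //.
  by rewrite H0 // leq_addl.
split=> [z|]; first by case: (key z).
have -> : (phi : C^o -> C^o)^`()%classic = psi by apply/funext => z; case: (key z).
by apply: loc_unif_eq lpsi => n z; rewrite nderivn1.
Qed.

Lemma loc_unif_derive1n P phi k : loc_unif (fun n => horner (P n)) phi ->
  loc_unif (fun n => horner (P n)^`(k)) (derive1n k (phi : C^o -> C^o)).
Proof.
move=> lP; elim: k => [|k IH]; first exact: lP.
have [_] := loc_unif_derive1 IH.
by apply: loc_unif_eq => n z; rewrite derivnS.
Qed.

Lemma loc_unif_nderivn P phi k : loc_unif (fun n => horner (P n)) phi ->
  loc_unif (fun n => horner (P n)^`N(k)) (fun z => derive1n k (phi : C^o -> C^o) z / (k`!)%:R).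
Proof.
move=> lP.
rewrite (_ : (fun z : C => _) = fun z : C => (k`!)%:R^-1 * derive1n k (phi : C^o -> C^o) z); last first.
  by apply/funext => z; rewrite mulrC.
apply: loc_unif_eq (loc_unif_cmul (@loc_bounded_cst (k`!)%:R^-1) (loc_unif_derive1n k lP)).
by move=> n z; rewrite nderivn_def hornerMn -[X in _ * X]mulr_natl mulKf // pnatr_eq0 -lt0n fact_gt0.
Qed.

Lemma loc_unif_taylor P phi z r M m h : loc_unif (fun n => horner (P n)) phi ->
  0 < r -> (forall w, N (w - z) = r -> N (phi w) <= M) -> N h <= r / 2 ->
  N (phi (z + h) - \sum_(0 <= i < m) derive1n i (phi : C^o -> C^o) z / (i`!)%:R * h ^+ i)
    <= 2 * M * (N h / r) ^+ m.
Proof.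
move=> lP r0 HM hr; set K := (N h / r) ^+ m.
have K0 : 0 <= K by rewrite exprn_ge0 // divr_ge0 ?normc_ge0 // ltW.
apply/ler_addgt0Pr => e e0.
pose e' := e / (2 * K + 1).
have K20 : 0 < 2 * K + 1 by rewrite ltr_wpDl // mulr_ge0.
have e'0 : 0 < e' by rewrite divr_gt0.
have [n0 H0] := lP (N z + r) _ e'0.
have lu : loc_unif (fun n h => (P (n + n0)%N).[h + z] - 
    \sum_(0 <= i < m) h ^+ i * (P (n + n0)%N)^`N(i).[z])
    (fun h => phi (h + z) - \sum_(0 <= i < m) h ^+ i * (derive1n i (phi : C^o -> C^o) z / (i`!)%:R)).
  apply: loc_unif_add; first exact: (loc_unif_comp_add _ (loc_unif_shiftn n0 lP)).
  apply: (@loc_unif_opp (fun n h => \sum_(0 <= i < m) h ^+ i * (P (n + n0)%N)^`N(i).[z])).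
  apply: (@loc_unif_sum _ _ (fun i n h => h ^+ i * (P (n + n0)%N)^`N(i).[z])) => i.
  apply: (@loc_unif_cmul (fun n h => (P (n + n0)%N)^`N(i).[z]) (fun h => h ^+ i) 
     (fun h => derive1n i (phi : C^o -> C^o) z / (i`!)%:R)).
    move=> L; exists (`|L| ^+ i); first by rewrite exprn_ge0.
    move=> w wL; rewrite normcX lerXn2r ?nnegrE ?normc_ge0 //.
    by rewrite (le_trans wL) ?ler_norm.
  exact: (loc_unif_at _ (loc_unif_shiftn n0 (loc_unif_nderivn i lP))).
under eq_bigr do rewrite mulrC.
rewrite [z + h]addrC; apply: (loc_unif_le lu) => n.
apply: (@le_trans _ _ (2 * (M + e') * K)).
  have := @taylor_remainder _ (P (n + n0)%N) z r (M + e') m h r0.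
  under eq_bigr do rewrite mulrC.
  rewrite [z + h]addrC; apply => // w wz.
  have wL : N w <= N z + r by rewrite -(subrK z w) (le_trans (normcD _ _)) // wz addrC.
  rewrite -(subrK (phi w) _.[w]) (le_trans (normcD _ _)) // addrC lerD ?HM //.
  by rewrite H0 // leq_addl.
have : e' * (2 * K + 1) = e by rewrite divfK // gt_eqF.
by nra.
Qed.

End LocUnif.

#[local] Arguments Normc.normc {R} x : simpl never.

(** * The complex exponential *)

Section ComplexExp.
Variable R : realType.
Local Notation C := R[i].
Implicit Types (z w : C) (r e : R).

Local Notation N := (@Normc.normc R).

Lemma cexpD z w : cexp (z + w) = cexp z * cexp w.
Proof.
case: z w => [a b] [c d]; rewrite /cexp /= expRD cosD sinD.
by apply/eqP; rewrite eq_complex /=; apply/andP; split; apply/eqP; ring.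
Qed.

Lemma cexp0 : cexp 0 = 1 :> C.
Proof. by rewrite /cexp /= expR0 cos0 sin0 mulr1 mulr0. Qed.

Lemma normc_cexp z : N (cexp z) = expR (complex.Re z).
Proof.
rewrite normcE2 /cexp /= !exprMn -mulrDr cos2Dsin2 mulr1.
by rewrite sqrtr_sqr ger0_norm // expR_ge0.
Qed.

Lemma normc_cexp_le z : N (cexp z) <= expR (N z).
Proof. by rewrite normc_cexp ler_expR (le_trans (ler_norm _)) ?normc_Re. Qed.

Lemma cexp_neq0 z : cexp z != 0.
Proof. by rewrite -normc_gt0 normc_cexp expR_gt0. Qed.

Lemma cexp_sum (I : Type) (s : seq I) (F : I -> C) :
  cexp (\sum_(i <- s) F i) = \prod_(i <- s) cexp (F i).
Proof.
elim: s => [|i s IH]; first by rewrite !big_nil cexp0.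
by rewrite !big_cons cexpD IH.
Qed.

Lemma cexpMn z n : cexp (z *+ n) = cexp z ^+ n.
Proof.
elim: n => [|n IH]; first by rewrite mulr0n cexp0.
by rewrite mulrS cexpD IH exprS.
Qed.

Lemma is_derive_littleo (f : R -> R) (c : R) : is_derive (0 : R) 1 f c ->
  forall e, 0 < e -> exists2 r : R, 0 < r & forall x : R, `|x| <= r -> `|f x - f 0 - c * x| <= e * `|x|.
Proof.
move=> [df fc] e e0.
have cv : (fun h => h^-1 *: (f (h + 0) - f 0)) @ 0^' --> c.
  rewrite -fc; move: df; rewrite /derivable /derive.
  rewrite (_ : (fun h : R => h^-1 *: ((f \o shift 0) (h *: 1) - f 0)) =
    (fun h : R => h^-1 *: (f (h + 0) - f 0))) //.
  by apply/funext => h /=; rewrite -[_ *: 1]/(h * 1) mulr1.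
have [r /= r0 H] := (nbhs_ballP _ _).1 ((cvgrPdistC_le _ _).1 cv _ e0).
exists (r / 2); first exact: divr_gt0.
move=> x xr; have [->|x0] := eqVneq x 0; first by rewrite mulr0 subr0 subrr normr0 mulr0.
have := H x; rewrite -ball_normE /= sub0r normrN addr0 => /(_ _ x0) h.
rewrite -ler_pdivrMr ?normr_gt0 // -normrV ?unitfE // -normrM.
rewrite mulrC mulrBr [c * x]mulrC mulKf //; apply: h.
by apply: le_lt_trans xr _; rewrite gtr_pMr // invf_lt1 // ltr1n.
Qed.

Lemma cexp_littleo e : 0 < e -> exists2 r, 0 < r &
  forall w, N w <= r -> N (cexp w - 1 - w) <= e * N w.
Proof.
(* The four error terms below have coefficients 1, 3, 3 and 2 in [e' * n]; the 3 bounds [expR x]. *)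
move=> e0; pose e' := Num.min 1 (e / 9).
have e'0 : 0 < e' by rewrite lt_min ltr01 divr_gt0.
have e'1 : e' <= 1 by rewrite ge_min lexx.
have e'9 : e' * 9 <= e by rewrite -ler_pdivlMr // ge_min lexx orbT.
clearbody e'.
have [r1 r10 H1] := is_derive_littleo (is_derive_expR 0) e'0.
have [r2 r20 H2] := is_derive_littleo (is_derive_cos 0) e'0.
have [r3 r30 H3] := is_derive_littleo (is_derive_sin 0) e'0.
exists (Num.min (Num.min e' r1) (Num.min r2 r3)); first by rewrite !lt_min e'0 r10 r20 r30.
move=> [x y]; rewrite !le_min => /andP[/andP[we w1] /andP[w2 w3]].
have xN : `|x| <= N (x +i* y) := normc_Re (x +i* y).
have yN : `|y| <= N (x +i* y) := normc_Im (x +i* y).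
have /= h1 := H1 x (le_trans xN w1).
have /= h2 := H2 y (le_trans yN w2).
have /= h3 := H3 y (le_trans yN w3).
move: h1 h2 h3; rewrite expR0 cos0 sin0 oppr0 mul0r !mul1r !subr0 addr0 => h1 h2 h3.
set n := N (x +i* y) in xN yN we w1 w2 w3 *.
have ex3 : 0 <= expR x <= 3.
  rewrite expR_ge0 /=; move: h1; rewrite ler_norml => /andP[_ h1].
  have xx := ler_norm x; nra.
apply: le_trans (normc_le_ReIm _) _.
have -> : complex.Re (cexp (x +i* y) - 1 - (x +i* y)) = (expR x - 1 - x) + expR x * (cos y - 1).
  by rewrite /cexp /=; ring.
have -> : complex.Im (cexp (x +i* y) - 1 - (x +i* y)) = expR x * (sin y - y) + (expR x - 1) * y.
  by rewrite /cexp /=; ring.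
have q1 : `|expR x - 1| <= 2 * e'.
  rewrite -(subrK x (expR x - 1)) (le_trans (ler_normD _ _)) //.
  have := normr_ge0 x; nra.
have q2 : `|expR x * (cos y - 1)| <= 3 * (e' * n).
  case/andP: ex3 => ex0 ex3.
  rewrite normrM (ger0_norm ex0) ler_pM // (le_trans h2) // ler_wpM2l // ltW //.
have q3 : `|expR x * (sin y - y)| <= 3 * (e' * n).
  case/andP: ex3 => ex0 ex3.
  rewrite normrM (ger0_norm ex0) ler_pM // (le_trans h3) // ler_wpM2l // ltW //.
have q4 : `|(expR x - 1) * y| <= 2 * e' * n by rewrite normrM ler_pM.
have q5 : `|expR x - 1 - x| <= e' * n by rewrite (le_trans h1) // ler_wpM2l // ltW.
have n0 : 0 <= n by apply: normc_ge0.
have t1 := ler_normD (expR x - 1 - x) (expR x * (cos y - 1)).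
have t2 := ler_normD (expR x * (sin y - y)) ((expR x - 1) * y).
have : e' * n * 9 <= e * n by rewrite mulrAC ler_wpM2r.
by lra.
Qed.

Lemma normc_subX (a b : C) K n : 1 <= K -> N a <= K -> N b <= K ->
  N (a ^+ n - b ^+ n) <= n%:R * N (a - b) * K ^+ n.
Proof.
move=> K1 aK bK; have K0 : 0 <= K by apply: le_trans K1.
elim: n => [|n IH]; first by rewrite !expr0 subrr Normc.normc0 !mul0r.
have -> : a ^+ n.+1 - b ^+ n.+1 = a * (a ^+ n - b ^+ n) + (a - b) * b ^+ n.
  by rewrite !exprS; ring.
apply: le_trans (normcD _ _) _; rewrite !Normc.normcM normcX.
have h1 : N a * N (a ^+ n - b ^+ n) <= K * (n%:R * N (a - b) * K ^+ n).
  by rewrite ler_pM ?normc_ge0.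
have h2 : N (a - b) * N b ^+ n <= N (a - b) * K ^+ n.+1.
  rewrite ler_wpM2l ?normc_ge0 // exprS.
  have h3 : N b ^+ n <= K ^+ n by rewrite lerXn2r ?nnegrE ?normc_ge0.
  by rewrite (le_trans h3) // ler_peMl // exprn_ge0.
apply: le_trans (lerD h1 h2) _; rewrite exprS -natr1.
by rewrite le_eqVlt; apply/orP; left; apply/eqP; ring.
Qed.

(** Chosen rather than the Taylor polynomial because its only zero is real, which is what the final
    approximants need. *)
Definition exp_poly n : {poly C} := (1 + (n.+1%:R^-1)%:P * 'X) ^+ n.+1.

(** With [w = z / (n + 1)], both [1 + w] and [cexp w] are bounded by [expR |w|], whose power [n + 1]
    is [expR |z|]; their difference is [o(|w|)], so the loss of a factor [n + 1] is harmless. *)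
Lemma loc_unif_cexp : loc_unif (fun n => horner (exp_poly n)) (@cexp R).
Proof.
move=> L e e0; pose L' := `|L| + 1.
have L'0 : 0 < L' by rewrite ltr_wpDl.
have K0 : 0 < L' * expR L' by rewrite mulr_gt0 // expR_gt0.
have [r r0 Hr] := cexp_littleo (divr_gt0 e0 K0).
have [n0 Hn0] : exists n0 : nat, L' / r <= n0%:R.
  exists (Num.bound (L' / r)); have := archi_boundP (ltW (divr_gt0 L'0 r0)).
  exact: ltW.
exists n0 => n n0n z zL.
have zL' : N z <= L' by rewrite (le_trans zL) // (le_trans (ler_norm L)) // lerDl.
pose M := n.+1%:R : R; have M0 : 0 < M by rewrite ltr0n.
pose w : C := n.+1%:R^-1 * z.
have Nw : N w = N z / M by rewrite Normc.normcM Normc.normcV normc_nat mulrC.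
have wr : N w <= r.
  rewrite Nw ler_pdivrMr // mulrC -ler_pdivrMr //.
  apply: (@le_trans _ _ (L' / r)); first by rewrite ler_wpM2r // invr_ge0 ltW.
  by rewrite (le_trans Hn0) // ler_nat (leq_trans n0n).
rewrite /exp_poly !hornerE -/w.
have -> : cexp z = cexp w ^+ n.+1.
  by rewrite -cexpMn -mulr_natl mulrA divff ?mul1r // pnatr_eq0.
pose K := expR (N w).
have h := @normc_subX (1 + w) (cexp w) K n.+1.
apply: le_trans (h _ _ _) _.
- by rewrite (le_trans _ (expR_ge1Dx _)) // lerDl normc_ge0.
- by rewrite (le_trans (normcD _ _)) // Normc.normc1 expR_ge1Dx.
- exact: normc_cexp_le.
rewrite /K -expRM_natl -/M Nw mulrCA divff ?gt_eqF // mulr1.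
have hw := Hr _ wr.
have -> : N (1 + w - cexp w) = N (cexp w - 1 - w).
  by rewrite normc_dist opprD addrA.
apply: (@le_trans _ _ (M * (e / (L' * expR L') * (L' / M)) * expR L')).
  rewrite ler_pM ?mulr_ge0 ?normc_ge0 ?(ltW M0) ?expR_ge0 ?ler_expR //.
  rewrite ler_wpM2l ?(ltW M0) // (le_trans hw) // Nw ler_wpM2l ?(ltW (divr_gt0 e0 K0)) //.
  by rewrite ler_wpM2r // invr_ge0 ltW.
rewrite le_eqVlt; apply/orP; left; apply/eqP.
by field; rewrite !gt_eqF // expR_gt0.
Qed.

Lemma derive1_cexp : (@cexp R : C^o -> C^o)^`()%classic = (@cexp R : C^o -> C^o).
Proof.
apply/funext => z; apply: (proj2 (derive1_of_littleo _)) => e e0.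
have k0 : 0 < N (cexp z) by rewrite normc_gt0 cexp_neq0.
have [r r0 H] := cexp_littleo (divr_gt0 e0 k0).
exists r => // h /H hh.
have -> : cexp (z + h) - cexp z - h * cexp z = cexp z * (cexp h - 1 - h).
  by rewrite cexpD; ring.
rewrite Normc.normcM mulrC -ler_pdivlMr //.
by rewrite (le_trans hh) // mulrAC.
Qed.

Lemma derive1n_cexp k : derive1n k (@cexp R : C^o -> C^o) = (@cexp R : C^o -> C^o).
Proof. by elim: k => [//|k IH]; rewrite /= -/(derive1n k _) IH derive1_cexp. Qed.

Lemma cexp_taylor z r m : 0 < r -> N z <= r / 2 ->
  N (cexp z - \sum_(0 <= k < m) z ^+ k / (k`!)%:R) <= 2 * expR r * (N z / r) ^+ m.
Proof.
move=> r0 zr.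
have := @loc_unif_taylor _ _ _ 0 r (expR r) m z loc_unif_cexp r0.
rewrite add0r => /(_ _ zr).
under eq_bigr do rewrite derive1n_cexp cexp0 mulrC mul1r.
by apply=> w; rewrite subr0 => <-; exact: normc_cexp_le.
Qed.

(** The Taylor coefficients of the cosine, kept as a symmetric sum because [p (z + a) + p (z - a)]
    with [a] imaginary expands in the same way; those of odd index vanish. *)
Definition ccos_coef k : C := ('i ^+ k + (- 'i) ^+ k) / 2 / (k`!)%:R.

Lemma ccos_taylor z r m : 0 < r -> N z <= r / 2 ->
  N (ccos z - \sum_(0 <= k < m) ccos_coef k * z ^+ k) <= 2 * expR r * (N z / r) ^+ m.
Proof.
move=> r0 zr.
have Ni : N ('i * z) = N z by rewrite Normc.normcM normc_i mul1r.
have := @cexp_taylor ('i * z) r m r0; rewrite Ni => /(_ zr) h1.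
have := @cexp_taylor (- ('i * z)) r m r0; rewrite normc_opp Ni => /(_ zr) h2.
set B := 2 * _ * _ in h1 h2 *.
set S1 := \sum_(0 <= k < m) _ in h1; set S2 := \sum_(0 <= k < m) _ in h2.
have -> : \sum_(0 <= k < m) ccos_coef k * z ^+ k = (S1 + S2) / 2.
  rewrite -big_split /= mulr_suml; apply: eq_bigr => k _.
  rewrite /ccos_coef -mulNr !exprMn; ring.
rewrite /ccos -mulrBl opprD addrACA Normc.normcM Normc.normcV normc_nat.
rewrite ler_pdivrMr // (le_trans (normcD _ _)) // mulr_natr mulr2n lerD //.
Qed.

End ComplexExp.

(** * Hermite-Biehler pairs *)

Section HermiteBiehler.
Variable R : realType.
Local Notation C := R[i].
Implicit Types (z w : C) (r e h delta : R) (p q : {poly C}).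

Local Notation N := (@Normc.normc R).

(* Put [alpha = |a|^2 - |b'|^2], [beta = |a'|^2 - |b|^2], [gamma = |a' a^* - b^* b'|]
   and [r = |w|]: the conclusion follows from [alpha + r^2 beta > 2 r gamma],
   which for [r < 1] follows from [alpha > beta] and [alpha + beta >= 2 gamma]. *)
Lemma hermite_biehler_algebra (a a' b b' w : C) :
  (forall u, N u = 1 -> N (a' + u * b') <= N (a + u * b)) ->
  N a' ^+ 2 + N b' ^+ 2 < N a ^+ 2 + N b ^+ 2 -> N b < N a -> N w < 1 ->
  N (b' - w^* * b) < N (a - w * a').
Proof.
move=> H1 H2 H3 w1.
pose Z := a^* * b - a'^* * b'; pose G := a' * a^* - b^* * b'.
have expand (c d u : C) : N u = 1 -> 
    N (c + u * d) ^+ 2 = N c ^+ 2 + N d ^+ 2 + 2 * complex.Re (u * (c^* * d)).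
  move=> u1; have : N u ^+ 2 = 1 by rewrite u1 expr1n.
  rewrite !sqr_normcE; case: c d u {u1} => [c1 c2] [d1 d2] [u1 u2] /= u1E.
  have -> : d1 ^+ 2 + d2 ^+ 2 = (d1 ^+ 2 + d2 ^+ 2) * (u1 ^+ 2 + u2 ^+ 2) by rewrite u1E mulr1.
  by ring.
have ReM (u c d : C) : complex.Re (u * (c - d)) = complex.Re (u * c) - complex.Re (u * d).
  by case: u c d => [? ?] [? ?] [? ?] /=; ring.
have hZ : 2 * N Z <= N a ^+ 2 - N a' ^+ 2 + (N b ^+ 2 - N b' ^+ 2).
  have [Z0|Z0] := eqVneq Z 0.
    by rewrite Z0 Normc.normc0; lra.
  have NZ : 0 < N Z by rewrite normc_gt0.
  (* This [u] turns [u * Z] into [- |Z|], the worst case of the hypothesis on the circle. *)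
  pose u := - (Z^* / (N Z)%:C).
  have u1 : N u = 1.
    by rewrite normc_opp normc_div normc_conj normc_real ger0_norm ?normc_ge0 // divff ?gt_eqF.
  have : N (a' + u * b') ^+ 2 <= N (a + u * b) ^+ 2.
    by rewrite lerXn2r ?nnegrE ?normc_ge0 // H1.
  rewrite !expand //.
  have : complex.Re (u * Z) = - N Z.
    have -> : u * Z = - (N Z)%:C.
      rewrite /u mulNr; congr (- _); apply: (@mulIf _ (N Z)%:C).
        by rewrite -normc_eq0 normc_real normr_eq0 gt_eqF.
      rewrite mulrAC divfK; last by rewrite -normc_eq0 normc_real normr_eq0 gt_eqF.
      rewrite -rmorphM -expr2 sqr_normcE mulrC; case: (Z) => z1 z2 /=.
      by apply/eqP; rewrite eq_complex /=; apply/andP; split; apply/eqP; ring.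
    by [].
  rewrite {1}/Z ReM; lra.
have hpq : 0 <= N a ^+ 2 - N b ^+ 2 + (N a' ^+ 2 - N b' ^+ 2).
  have a0 : 0 < N a by apply: le_lt_trans H3; exact: normc_ge0.
  have [b0|b0] := eqVneq b 0.
    have := normc_ge0 a'; move: H2; rewrite b0 Normc.normc0 expr0n /=.
    have := sqr_ge0 (N a'); lra.
  have Nb : 0 < N b by rewrite normc_gt0.
  (* [u * b] is opposite to [a], so [|a + u b| = |a| - |b|] and [|a - u b| = |a| + |b|]; the product
     of the two hypotheses bounds [|a' ^ 2 - (u b') ^ 2|] by [|a| ^ 2 - |b| ^ 2]. *)
  pose u := - (a / (N a)%:C / (b / (N b)%:C)).
  have u1 : N u = 1.
    rewrite normc_opp !normc_div !normc_real !ger0_norm ?normc_ge0 //.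
    by rewrite !divff ?divr1 ?gt_eqF ?ltr01.
  have ub : u * b = - (a * (N b / N a)%:C).
    rewrite /u rmorphM /= fmorphV /=.
    by field; rewrite b0 /= -!normc_eq0 !normc_real !ger0_norm ?normc_ge0 // !gt_eqF.
  have h1 : N (a' + u * b') <= N a - N b.
    apply: le_trans (H1 _ u1) _; rewrite ub.
    have -> : a - a * (N b / N a)%:C = a * (1 - N b / N a)%:C by rewrite rmorphB /= mulrBr mulr1.
    rewrite Normc.normcM normc_real ger0_norm; last by rewrite subr_ge0 ler_pdivrMr // mul1r ltW.
    by rewrite mulrBr mulr1 mulrCA divff ?mulr1 ?gt_eqF.
  have h2 : N (a' + (- u) * b') <= N a + N b.
    apply: le_trans (H1 _ _) _; first by rewrite normc_opp.
    rewrite mulNr ub opprK.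
    have -> : a + a * (N b / N a)%:C = a * (1 + N b / N a)%:C by rewrite rmorphD /= mulrDr mulr1.
    rewrite Normc.normcM normc_real ger0_norm; last by rewrite addr_ge0 // divr_ge0 // ltW.
    by rewrite mulrDr mulr1 mulrCA divff ?mulr1 ?gt_eqF.
  have h3 : N b' ^+ 2 - N a' ^+ 2 <= N (a' + u * b') * N (a' + (- u) * b').
    rewrite -Normc.normcM.
    have -> : (a' + u * b') * (a' + - u * b') = a' ^+ 2 - (u * b') ^+ 2 by ring.
    have := normc_sub_ge ((u * b') ^+ 2) (a' ^+ 2).
    by rewrite normc_dist !normcX Normc.normcM u1 mul1r.
  have h4 : N (a' + u * b') * N (a' + (- u) * b') <= (N a - N b) * (N a + N b).
    by rewrite ler_pM ?normc_ge0.
  have : (N a - N b) * (N a + N b) = N a ^+ 2 - N b ^+ 2 by ring.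
  by lra.
(* The identity [(alpha + beta) ^ 2 - 4 gamma ^ 2 = (|a| ^ 2 - |a'| ^ 2 + |b| ^ 2 - |b'| ^ 2) ^ 2 -
   4 |Z| ^ 2] reduces this to [hZ], with [hpq] giving the sign. *)
have hG : 2 * N G <= N a ^+ 2 - N b ^+ 2 + (N a' ^+ 2 - N b' ^+ 2).
  rewrite -(@ler_pXn2r _ 2) ?nnegrE ?mulr_ge0 ?normc_ge0 //.
  have : (2 * N Z) ^+ 2 <= (N a ^+ 2 - N a' ^+ 2 + (N b ^+ 2 - N b' ^+ 2)) ^+ 2.
    rewrite ler_pXn2r ?nnegrE ?mulr_ge0 ?normc_ge0 //.
    by apply: le_trans hZ; rewrite mulr_ge0 ?normc_ge0.
  rewrite -subr_ge0 => hh; rewrite -subr_ge0; move: hh; rewrite !exprMn !sqr_normcE /Z /G.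
  case: a a' b b' {H1 H2 H3 Z G expand hZ hpq} => [a1 a2] [c1 c2] [b1 b2] [d1 d2] /=.
  by move=> hh; apply: le_trans hh _; rewrite le_eqVlt; apply/orP; left; apply/eqP; ring.
rewrite -(@ltr_pXn2r _ 2) ?nnegrE ?normc_ge0 // -subr_gt0.
have -> : N (a - w * a') ^+ 2 - N (b' - w^* * b) ^+ 2 =
    (N a ^+ 2 - N b' ^+ 2) + N w ^+ 2 * (N a' ^+ 2 - N b ^+ 2) - 2 * complex.Re (w * G).
  rewrite !sqr_normcE /G; case: a a' b b' w {H1 H2 H3 Z G expand hZ hpq hG w1} =>
    [a1 a2] [c1 c2] [b1 b2] [d1 d2] [w1 w2] /=.
  by ring.
have hRe : complex.Re (w * G) <= N w * N G.
  by rewrite (le_trans (ler_norm _)) // (le_trans (normc_Re _)) // Normc.normcM.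
have w0 := normc_ge0 w; have G0 := normc_ge0 G.
move: H2 hpq hG w1 hRe w0 G0; move: (complex.Re _) (N w) (N G) => t r g.
set al := N a ^+ 2 - N b' ^+ 2; set be := N a' ^+ 2 - N b ^+ 2 => H2 hpq hG r1 tg r0 g0.
have h1 : be < al by rewrite /al /be; lra.
have h2 : 2 * g <= al + be by rewrite /al /be; lra.
have h3 : 0 <= al + be by rewrite /al /be; lra.
have h4 : r * (2 * g) <= r * (al + be) by rewrite ler_wpM2l.
(* [alpha + r ^ 2 beta - r (alpha + beta)] factors as [(1 - r) (alpha - r beta)]. *)
have h5 : 0 < (1 - r) * (al - r * be).
  apply: mulr_gt0; first by rewrite subr_gt0.
  have [be0|be0] := lerP be 0.
    have : r * be <= 0 by rewrite mulr_ge0_le0.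
    by lra.
  have : r * be <= 1 * be by rewrite ler_wpM2r ?ltW.
  by lra.
nra.
Qed.

Lemma normc_horner_roots p : exists2 rs : seq C,
  (forall z, N p.[z] = N (lead_coef p) * \prod_(x <- rs) N (z - x)) &
  (p != 0 -> (size rs).+1 = size p /\ forall z, root p z = (z \in rs)).
Proof.
have [rs Dp] := closed_field_poly_normal p; exists rs.
  move=> z; rewrite {1}Dp hornerZ Normc.normcM horner_prod normc_prod.
  by congr (_ * _); apply: eq_bigr => x _; rewrite !hornerE.
move=> p0; have lc0 : lead_coef p != 0 by rewrite lead_coef_eq0.
split; first by rewrite Dp size_scale // size_prod_XsubC.
by move=> z; rewrite Dp rootZ // root_prod_XsubC.
Qed.

Lemma normc_shift_le (x z : C) d h : complex.Im x <= d -> d < complex.Im z -> 0 < h ->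
  N (z - (0 +i* h) - x) < N (z + (0 +i* h) - x).
Proof.
move=> xd dz h0; rewrite -(@ltr_pXn2r _ 2) ?nnegrE ?normc_ge0 // !sqr_normcE.
by case: x z xd dz => [x1 x2] [z1 z2] /= xd dz; nra.
Qed.

Lemma ltr_prod_seq (I : eqType) (s : seq I) (F G : I -> R) : s != [::] ->
  (forall i, i \in s -> 0 <= F i < G i) -> \prod_(i <- s) F i < \prod_(i <- s) G i.
Proof.
case: s => // i s _; elim: s i => [|j s IH] i H.
  by rewrite !big_seq1; have /andP[] := H i (mem_head _ _).
rewrite big_cons [ltRHS]big_cons; have /andP[F0 FG] := H i (mem_head _ _).
apply: ltr_pM => //.
  rewrite big_seq; apply: prodr_ge0 => k ks.
  have ks' : k \in [:: i, j & s] by rewrite inE ks orbT.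
  by have /andP[] := H k ks'.
by apply: IH => k ks; apply: H; rewrite inE ks orbT.
Qed.

Lemma upper_shift_lt p d h z : (1 < size p)%N ->
  (forall x, root p x -> complex.Im x <= d) -> d < complex.Im z -> 0 < h ->
  N p.[z - (0 +i* h)] < N p.[z + (0 +i* h)].
Proof.
move=> sp rp dz h0; have [rs Np Hrs] := normc_horner_roots p.
have p0 : p != 0 by rewrite -size_poly_gt0 ltnW.
have [srs mrs] := Hrs p0.
rewrite !Np ltr_pM2l ?normc_gt0 ?lead_coef_eq0 //.
apply: ltr_prod_seq; first by rewrite -size_eq0 -lt0n -ltnS srs.
by move=> x xrs; rewrite normc_ge0 (@normc_shift_le _ _ d) // rp // mrs.
Qed.

Lemma upper_shift_le p d h z : 
  (forall x, root p x -> complex.Im x <= d) -> d < complex.Im z -> 0 < h ->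
  N p.[z - (0 +i* h)] <= N p.[z + (0 +i* h)].
Proof.
move=> rp dz h0; have [sp|sp] := ltnP 1 (size p).
  exact/ltW/(@upper_shift_lt _ d).
by rewrite (size1_polyC sp) !hornerC.
Qed.

Definition shift_poly (a : C) p := p \Po ('X + a%:P).

Lemma shift_polyE a p z : (shift_poly a p).[z] = p.[z + a].
Proof. by rewrite horner_comp !hornerE. Qed.

Lemma size_shift_poly a p : size (shift_poly a p) = size p.
Proof. by rewrite size_comp_poly2 // size_XaddC. Qed.

Lemma lead_coef_shift_poly a p : lead_coef (shift_poly a p) = lead_coef p.
Proof.
rewrite lead_coef_comp ?size_XaddC // lead_coefXaddC expr1n mulr1 //.
Qed.

(** For [|u| <= 1] the polynomial [A + u B] has no zero above the line, so [upper_shift_le] provides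
    the hypothesis of the algebraic lemma on the circle. Its strict hypothesis comes from the
    parallelogram law with [u = 1] and [u = -1]: since [A] is nonconstant, so is [A + B] or [A - B].
    The degree does not drop because the leading coefficient is multiplied by [1 - w]. *)
Lemma hermite_biehler_step (A B : {poly C}) d h w : (1 < size A)%N -> 0 < h -> N w < 1 ->
  (forall z, d < complex.Im z -> N B.[z] < N A.[z]) ->
  let A1 := shift_poly (0 +i* h) A - w *: shift_poly (- (0 +i* h)) A in
  let B1 := shift_poly (- (0 +i* h)) B - w^* *: shift_poly (0 +i* h) B in
  (1 < size A1)%N /\ (forall z, d < complex.Im z -> N B1.[z] < N A1.[z]).
Proof.
move=> sA h0 w1 HAB A1 B1; split.
  rewrite ltnNge; apply/negP => sA1.
  have A0 : A != 0 by rewrite -size_poly_gt0 ltnW.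
  have : A1`_(size A).-1 = 0 by rewrite nth_default // (leq_trans sA1) // -ltnS prednK // ltnW.
  rewrite coefB coefZ -{1}(size_shift_poly (0 +i* h) A) -(size_shift_poly (- (0 +i* h)) A).
  rewrite -!/(lead_coef _) !lead_coef_shift_poly -{1}[lead_coef A]mul1r -mulrBl => /eqP.
  rewrite mulf_eq0 lead_coef_eq0 (negPf A0) orbF subr_eq0 => /eqP w1'.
  by move: w1; rewrite -w1' Normc.normc1 ltxx.
move=> z dz; rewrite !hornerE !shift_polyE.
have rootu u : N u <= 1 -> forall x, root (A + u *: B) x -> complex.Im x <= d.
  move=> u1 x; rewrite /root !hornerE addr_eq0 => /eqP Ax; rewrite leNgt; apply/negP => dx.
  have := HAB x dx; rewrite Ax normc_opp Normc.normcM ltNge.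
  by rewrite ler_piMl ?normc_ge0.
have dzh : d < complex.Im (z + (0 +i* h)) by case: (z) dz => z1 z2 /=; lra.
apply: hermite_biehler_algebra => //; last exact: HAB.
  move=> u u1; have := @upper_shift_le (A + u *: B) d h z (rootu u _) dz h0.
  by rewrite !hornerE; apply; rewrite u1.
have par (x y : C) : N x ^+ 2 + N y ^+ 2 = (N (x + y) ^+ 2 + N (x - y) ^+ 2) / 2.
  by rewrite !sqr_normcE; case: x y => [x1 x2] [y1 y2] /=; field.
rewrite (par A.[z - (0 +i* h)]) (par A.[z + (0 +i* h)]) ltr_pM2r ?invr_gt0 //.
have N1 : N (-1) = 1 by rewrite normc_opp Normc.normc1.
have leP (u : C) : N u <= 1 -> N (A + u *: B).[z - (0 +i* h)] ^+ 2 <= N (A + u *: B).[z + (0 +i* h)] ^+ 2.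
  move=> u1; rewrite lerXn2r ?nnegrE ?normc_ge0 //.
  exact: (upper_shift_le (rootu u u1)).
have ltP (u : C) : N u <= 1 -> (1 < size (A + u *: B)%R)%N -> 
    N (A + u *: B).[z - (0 +i* h)] ^+ 2 < N (A + u *: B).[z + (0 +i* h)] ^+ 2.
  move=> u1 su; rewrite ltr_pXn2r ?nnegrE ?normc_ge0 //.
  exact: (upper_shift_lt su (rootu u u1)).
have Ep : A + B = A + 1 *: B by rewrite scale1r.
have Em : A - B = A + (-1) *: B by rewrite scaleN1r.
rewrite -!hornerD -!hornerN -!hornerD Em Ep.
have [sp|sp] := ltnP 1 (size (A + 1 *: B)).
  by rewrite ltr_leD ?ltP ?leP ?N1 ?Normc.normc1.
have [sm|sm] := ltnP 1 (size (A + (-1) *: B)).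
  by rewrite ler_ltD ?ltP ?leP ?N1 ?Normc.normc1.
have : (size ((A + 1 *: B) + (A + (-1) *: B))%R <= 1)%N.
  by rewrite (leq_trans (size_polyD _ _)) // geq_max sp sm.
rewrite scale1r scaleN1r addrACA subrr addr0 -mulr2n -scaler_nat size_scale ?pnatr_eq0 //.
by rewrite leqNgt sA.
Qed.

End HermiteBiehler.

(** * Zeros of cosine sums of a real polynomial *)

Section CosineSums.
Variable R : realType.
Local Notation C := R[i].
Implicit Types (z w : C) (r h d mu tau : R) (p q : {poly C}).

Local Notation N := (@Normc.normc R).

(* [prod_j (T - w_j T^-1) A], with [T] the shift by [c]: shifting symmetrically
   keeps the half-plane on which a pair is controlled unchanged. *)
Fixpoint hb_poly (c : C) (ws : seq C) (A : {poly C}) : {poly C} :=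
  if ws is w :: ws' then hb_poly c ws' (shift_poly c A - w *: shift_poly (- c) A) else A.

Lemma sum_coef_mulXsubC (Q : {poly C}) w n (F : nat -> C) : (size Q <= n.+1)%N ->
  \sum_(k < n.+2) (('X - w%:P) * Q)`_k * F k = \sum_(k < n.+1) Q`_k * (F k.+1 - w * F k).
Proof.
move=> sQ; have Qn : Q`_n.+1 = 0 by rewrite nth_default.
under eq_bigr do rewrite mulrBl coefB coefXM coefCM mulrBl.
rewrite sumrB [X in X - _]big_ord_recl /= mul0r add0r.
rewrite [X in _ - X]big_ord_recr /= Qn mulr0 mul0r addr0 -sumrB.
by apply: eq_bigr => k _; rewrite mulrBr mulrA [Q`_k * w]mulrC.
Qed.

(** Since [T - w T ^ -1 = T ^ -1 (T ^ 2 - w)], the product is [T ^ (- n)] times the polynomial with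
    roots [ws] evaluated at [T ^ 2]: whence the doubled shifts and the evaluation point moved by
    [n c]. *)
Lemma hb_polyE c ws A z : (hb_poly c ws A).[z + c *+ size ws] =
  \sum_(k < (size ws).+1) (\prod_(w <- ws) ('X - w%:P))`_k * A.[z + c *+ k.*2].
Proof.
elim: ws A z => [|w ws IH] A z /=.
  by rewrite big_ord1 big_nil coef1 mul1r mulr0n.
rewrite mulrS addrA IH big_cons.
rewrite (@sum_coef_mulXsubC _ w (size ws) (fun k => A.[z + c *+ k.*2])) ?size_prod_XsubC //.
apply: eq_bigr => k _; rewrite hornerD hornerN hornerZ !shift_polyE; cbv beta.
have -> : z + c *+ k.+1.*2 = z + c + c *+ k.*2 + c by rewrite doubleS !mulrS; ring.
by rewrite (_ : z + c + c *+ k.*2 - c = z + c *+ k.*2) //; ring.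
Qed.

Lemma hb_poly_lt ws (A B : {poly C}) d h : 0 < h -> (forall w, w \in ws -> N w < 1) ->
  (1 < size A)%N -> (forall z, d < complex.Im z -> N B.[z] < N A.[z]) ->
  forall z, d < complex.Im z ->
    N (hb_poly (- (0 +i* h)) (map (@conjc R) ws) B).[z] < N (hb_poly (0 +i* h) ws A).[z].
Proof.
move=> h0; elim: ws A B => [|w ws IH] A B Hws sA HAB //=.
have [sA1 HAB1] := hermite_biehler_step sA h0 (Hws w (mem_head _ _)) HAB.
by rewrite opprK; apply: IH => // u uws; apply: Hws; rewrite inE uws orbT.
Qed.

(** Multiplying by [1 - v] telescopes: up to the last term it gives
    [e 0 + sum_k (e k - e (k - 1)) v ^ k], whose coefficients are nonnegative of sum [e m], hence a
    modulus at most [e m * |v| ^ m] when [|v| > 1]. A zero would give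
    [e n * |v| ^ (n + 1) <= e n * |v| ^ n]. *)
Lemma enestrom_kakeya (e : nat -> R) n : (forall k, (k <= n)%N -> 0 <= e k) ->
  (forall k, (k < n)%N -> e k <= e k.+1) -> 0 < e n ->
  forall v : C, \sum_(k < n.+1) (e k)%:C * v ^+ k = 0 -> N v <= 1.
Proof.
move=> e0 eS en v v0; rewrite leNgt; apply/negP => v1.
suff H m : (m <= n)%N -> N ((e m)%:C * v ^+ m.+1 + (1 - v) * \sum_(k < m.+1) (e k)%:C * v ^+ k)
    <= e m * N v ^+ m.
  have := H n (leqnn n); rewrite v0 mulr0 addr0 Normc.normcM normc_real normcX.
  rewrite ger0_norm ?(ltW en) // ler_pM2l // exprS -subr_ge0 -{1}[N v ^+ n]mul1r -mulrBl.
  rewrite pmulr_lge0 ?exprn_gt0 ?(lt_trans ltr01) // subr_ge0 leNgt v1 //.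
elim: m => [_|m IH mn].
  rewrite big_ord1 !expr0 !mulr1 expr1.
  have -> : (e 0)%:C * v + (1 - v) * (e 0)%:C = (e 0)%:C by ring.
  by rewrite normc_real ger0_norm ?e0.
have em : e m <= e m.+1 by exact: eS.
rewrite big_ord_recr /=.
set S := \sum_(k < _) _ in IH *.
have -> : (e m.+1)%:C * v ^+ m.+2 + (1 - v) * (S + (e m.+1)%:C * v ^+ m.+1) =
   ((e m)%:C * v ^+ m.+1 + (1 - v) * S) + (e m.+1 - e m)%:C * v ^+ m.+1.
  by rewrite rmorphB /= !exprS; ring.
apply: le_trans (normcD _ _) _; apply: le_trans (lerD (IH (ltnW mn)) (lexx _)) _.
rewrite Normc.normcM normc_real normcX ger0_norm ?subr_ge0 //.
have : N v ^+ m <= N v ^+ m.+1 by rewrite ler_eXn2l.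
have em0 : 0 <= e m by apply/e0/ltnW.
by move: (N v ^+ m) (N v ^+ m.+1) => x y xy; nra.
Qed.

Definition real_poly p := map_poly (@conjc R) p = p.

Definition real_strip_poly mu : set {poly C} := [set p | strip_poly mu p /\ real_poly p].

Lemma real_poly_normc p z : real_poly p -> N p.[z^*] = N p.[z].
Proof. by move=> rp; rewrite -{1}rp horner_map normc_conj. Qed.

Lemma strip_poly_neq0 mu p : strip_poly mu p -> p != 0.
Proof.
move=> sp; apply/eqP => p0; have := sp (0 +i* (`|mu| + 1)).
rewrite p0 root0 => /(_ isT) /=; rewrite ger0_norm ?addr_ge0 //.
by have := ler_norm mu; lra.
Qed.

(* For a real polynomial [|p z|^2 = |p z| |p z^*|], which pairs each zero with
   its conjugate; this is where [mu ^+ 2 - tau ^+ 2] comes from. *)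
Lemma de_bruijn_lt p mu tau z : real_strip_poly mu p -> (1 < size p)%N -> 0 < tau ->
  Num.sqrt (Num.max (mu ^+ 2 - tau ^+ 2) 0) < complex.Im z ->
  N p.[z - (0 +i* tau)] < N p.[z + (0 +i* tau)].
Proof.
move=> [sp rp] szp t0 dz.
have z0 : 0 < complex.Im z by apply: le_lt_trans dz; exact: sqrtr_ge0.
have {}dz : mu ^+ 2 - tau ^+ 2 < complex.Im z ^+ 2.
  rewrite -(@ltr_pXn2r _ 2) ?nnegrE ?sqrtr_ge0 ?ltW // in dz.
  rewrite sqr_sqrtr ?le_max ?lexx ?orbT // gt_max in dz.
  by case/andP: dz.
have [rs Np Hrs] := normc_horner_roots p.
have [srs mrs] := Hrs (strip_poly_neq0 sp).
rewrite -(@ltr_pXn2r _ 2) ?nnegrE ?normc_ge0 //.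
have sq u : N p.[u] ^+ 2 = N p.[u] * N p.[u^*] by rewrite real_poly_normc // expr2.
rewrite !sq.
rewrite !Np [ltLHS]mulrACA [ltRHS]mulrACA -!big_split /=.
rewrite ltr_pM2l ?mulr_gt0 ?normc_gt0 ?lead_coef_eq0 ?(strip_poly_neq0 sp) //.
apply: ltr_prod_seq; first by rewrite -size_eq0 -lt0n -ltnS srs.
move=> x; rewrite -mrs => /sp xmu; rewrite mulr_ge0 ?normc_ge0 //=.
have {}xmu : complex.Im x ^+ 2 <= mu ^+ 2.
  have m0 : 0 <= mu := le_trans (normr_ge0 _) xmu.
  by rewrite -real_normK ?num_real // lerXn2r ?nnegrE.
rewrite -(@ltr_pXn2r _ 2) ?nnegrE ?mulr_ge0 ?normc_ge0 // !exprMn !sqr_normcE.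
case: x z xmu z0 dz => [x1 x2] [z1 z2] /= xmu z0 dz.
rewrite -subr_gt0.
(* The exact difference of the two sides; its last factor is positive because
   [x2 ^ 2 <= mu ^ 2 < z2 ^ 2 + tau ^ 2]. *)
have E : 0 < 8 * z2 * tau * ((z1 - x1) ^+ 2 + z2 ^+ 2 + tau ^+ 2 - x2 ^+ 2).
  rewrite mulr_gt0 ?mulr_gt0 //; have := sqr_ge0 (z1 - x1); lra.
apply: lt_le_trans E _; rewrite le_eqVlt; apply/orP; left; apply/eqP; ring.
Qed.

Lemma map_conjc_shift a p : map_poly (@conjc R) (shift_poly a p) =
  shift_poly a^* (map_poly (@conjc R) p).
Proof.
by rewrite /shift_poly map_comp_poly rmorphD /= map_polyX map_polyC.
Qed.

(** This is [2 * sum_k e_k cos (k h D)] applied to [p], a Riemann sum for [2 f(D) p] when the [e_k]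
    are masses of [g]. *)
Definition cos_sum (e : nat -> R) n h p : {poly C} :=
  \sum_(k < n.+1) (e k)%:C *: (shift_poly ((0 +i* h) *+ k) p + shift_poly (- ((0 +i* h) *+ k)) p).

Lemma cos_sum_real e n h p : real_poly p -> real_poly (cos_sum e n h p).
Proof.
move=> rp; rewrite /real_poly /cos_sum rmorph_sum /=; apply: eq_bigr => k _.
rewrite map_polyZ -[X in X *: _]/((e k)%:C^*) conjc_real rmorphD /= !map_conjc_shift rp.
have E : ((0 +i* h) *+ k)^* = - ((0 +i* h) *+ k) :> C.
  by rewrite rmorphMn -mulNrn; congr (_ *+ _); apply/eqP; rewrite eq_complex /= oppr0 !eqxx.
by rewrite rmorphN /= E opprK addrC.
Qed.

Lemma imMn (x : R) n : (0 +i* x) *+ n = 0 +i* (x *+ n) :> C.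
Proof.
elim: n => [//|n IH]; rewrite !mulrS IH.
by apply/eqP; rewrite eq_complex /= addr0 !eqxx.
Qed.

(** The factor [s ^ k] scales the zeros of the weight polynomial by [1 / s], from the closed disc of
    Eneström-Kakeya into the open one. The two halves of the sum are, up to a positive scalar, the
    two components of the iterated pair started from [p (z + i tau)] and [p (z - i tau)], with
    [tau = h n / 2]. *)
Lemma cos_sum_strip (e : nat -> R) n s h mu p : real_strip_poly mu p -> (0 < n)%N -> 0 < h ->
  (forall k, (k <= n)%N -> 0 <= e k) -> (forall k, (k < n)%N -> e k <= e k.+1) ->
  0 < e n -> 1 < s ->
  real_strip_poly (Num.sqrt (Num.max (mu ^+ 2 - (h *+ n / 2) ^+ 2) 0))
    (cos_sum (fun k => e k * s ^+ k) n h p).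
Proof.
move=> [sp rp] n0 h0 e0 eS en s1; split; last exact: cos_sum_real.
have s0 : 0 < s by apply: lt_trans s1.
set delta := Num.sqrt _; pose G := cos_sum (fun k => e k * s ^+ k) n h p.
pose E k := e k * s ^+ k.
have E0 k : (k <= n)%N -> 0 <= E k by move=> kn; rewrite mulr_ge0 ?e0 ?exprn_ge0 // ltW.
have En : 0 < E n by rewrite mulr_gt0 // exprn_gt0.
(* The cosine sum is real, so its zeros below the strip are conjugate to zeros above it. *)
suff upper z : delta < complex.Im z -> ~~ root G z.
  move=> z Gz; rewrite ler_norml; apply/andP; split.
    rewrite lerNl leNgt; apply/negP => zd.
    have zc : delta < complex.Im z^* by case: (z) zd.
    by have := upper _ zc; rewrite -complex_root_conj (cos_sum_real _ _ _ rp) Gz.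
  by rewrite leNgt; apply/negP => /upper; rewrite Gz.
move=> dz; pose tau := h *+ n / 2.
have GE : G.[z] = \sum_(k < n.+1) (E k)%:C * p.[z + (0 +i* h) *+ k] +
    \sum_(k < n.+1) (E k)%:C * p.[z - (0 +i* h) *+ k].
  rewrite /G /cos_sum horner_sum -big_split /=; apply: eq_bigr => k _.
  by rewrite hornerZ hornerD !shift_polyE mulrDr.
(* For constant [p] the strict de Bruijn inequality fails, but the sum is a positive multiple of
   [p]. *)
have [sp1|sp1] := leqP (size p) 1.
  have [c c0 pE] : exists2 c : C, c != 0 & p = c%:P.
    exists p`_0; last exact: size1_polyC.
    by apply: contra (strip_poly_neq0 sp) => /eqP p00; rewrite (size1_polyC sp1) p00.
  rewrite /root GE pE; under eq_bigr do rewrite hornerC.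
  rewrite [X in _ + X](eq_bigr (fun k : 'I_n.+1 => (E k)%:C * c)); last by move=> k _; rewrite hornerC.
  rewrite -mulr_suml -mulr2n -mulr_natr !mulf_eq0 (negPf c0) pnatr_eq0 !orbF.
  rewrite -rmorph_sum /= -normc_eq0 normc_real normr_eq0 gt_eqF //.
  rewrite big_ord_recr /= ltr_wpDl //; apply: sumr_ge0 => k _.
  by apply: E0; rewrite ltnW.
pose Q : {poly C} := \poly_(k < n.+1) (E k)%:C.
have En0 : (E n)%:C != 0 by rewrite -normc_eq0 normc_real normr_eq0 gt_eqF.
have sQ : size Q = n.+1 by rewrite size_poly_eq.
have [ws QE] := closed_field_poly_normal Q.
have lQ : lead_coef Q = (E n)%:C by rewrite lead_coefE sQ /= coef_poly ltnSn.
have sws : size ws = n.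
  by apply/eqP; rewrite -eqSS -(size_prod_XsubC ws id) -sQ QE size_scale ?lQ.
have Qk k : (k < n.+1)%N -> (\prod_(w <- ws) ('X - w%:P))`_k = (E k / E n)%:C.
  move=> kn; apply: (mulfI En0); rewrite -lQ -coefZ -QE coef_poly kn lQ -rmorphM /=.
  by rewrite mulrCA divff ?mulr1 // gt_eqF.
have wsQ w : w \in ws -> N w < 1.
  move=> wws; have : root Q w by rewrite QE rootZ ?lQ // root_prod_XsubC.
  rewrite /root horner_poly => /eqP Qw.
  have := @enestrom_kakeya e n e0 eS en (s%:C * w).
  under eq_bigr do rewrite exprMn mulrA -rmorphXn -rmorphM.
  move=> /(_ Qw); rewrite Normc.normcM normc_real gtr0_norm // => sw.
  by rewrite -(ltr_pM2l s0) mulr1 (le_lt_trans sw).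
(* Half the step, because the expansion of the iterated pair shifts by even multiples of [c]. *)
pose c : C := 0 +i* (h / 2).
have cn : c *+ n = 0 +i* tau by rewrite imMn /tau mulrnAl.
have ck k : c *+ k.*2 = (0 +i* h) *+ k.
  rewrite -addnn mulrnDr -mulrnDl; congr (_ *+ _); apply/eqP.
  by rewrite eq_complex /= addr0 -splitr !eqxx.
have tau0 : 0 < tau by rewrite divr_gt0 // pmulrn_lgt0.
pose A := shift_poly (c *+ n) p; pose B := shift_poly (- (c *+ n)) p.
have sA : (1 < size A)%N by rewrite size_shift_poly.
have HAB u : delta < complex.Im u -> N B.[u] < N A.[u].
  by move=> du; rewrite !shift_polyE cn (de_bruijn_lt (conj sp rp)).
have h20 : 0 < h / 2 by rewrite divr_gt0.
have := hb_poly_lt h20 wsQ sA HAB dz; rewrite -/c.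
(* Expanding about [z - c n] undoes the initial shift of [A], so that the terms are [p (z + i k h)];
   symmetrically for [B]. *)
have := hb_polyE c ws A (z - c *+ n); rewrite {1}sws subrK sws => ->.
have := hb_polyE (- c) (map (@conjc R) ws) B (z + c *+ n).
rewrite size_map {1}sws mulNrn addrK sws => ->.
have -> : \prod_(w <- map (@conjc R) ws) ('X - w%:P) = map_poly (@conjc R) (\prod_(w <- ws) ('X - w%:P)).
  by rewrite big_map rmorph_prod /=; apply: eq_bigr => w _; rewrite rmorphB /= map_polyX map_polyC.
move=> lt; apply/negP => /eqP G0; move: lt.
have Qk' k : (k < n.+1)%N -> (map_poly (@conjc R) (\prod_(w <- ws) ('X - w%:P)))`_k = (E k / E n)%:C.
  by move=> kn; rewrite coef_map Qk //= oppr0.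
have -> : \sum_(k < n.+1) (map_poly (@conjc R) (\prod_(w <- ws) ('X - w%:P)))`_k * 
    B.[z + c *+ n + - c *+ k.*2] = \sum_(k < n.+1) (E k / E n)%:C * p.[z - (0 +i* h) *+ k].
  apply: eq_bigr => k _; rewrite Qk' // shift_polyE mulNrn ck; congr (_ * p.[_]).
  by rewrite addrAC addrK.
have -> : \sum_(k < n.+1) (\prod_(w <- ws) ('X - w%:P))`_k * 
    A.[z - c *+ n + c *+ k.*2] = \sum_(k < n.+1) (E k / E n)%:C * p.[z + (0 +i* h) *+ k].
  apply: eq_bigr => k _; rewrite Qk // shift_polyE ck; congr (_ * p.[_]).
  by rewrite addrAC subrK.
move: G0; rewrite GE => /eqP; rewrite addr_eq0 => /eqP GE0.
have K (F : nat -> C) : \sum_(k < n.+1) (E k / E n)%:C * F k = (E n)^-1%:C * \sum_(k < n.+1) (E k)%:C * F k.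
  rewrite mulr_sumr; apply: eq_bigr => k _; rewrite mulrA -rmorphM /=.
  by rewrite [_^-1 * _]mulrC.
rewrite (K (fun k => p.[z - (0 +i* h) *+ k])) (K (fun k => p.[z + (0 +i* h) *+ k])) GE0.
by rewrite mulrN normc_opp ltxx.
Qed.

End CosineSums.

(** * Integrals against the density *)

Section Weights.
Variables (R : realType) (g : R -> R).
Hypothesis g_ge0 : forall t : R, t \in `]0, 1[ -> 0 <= g t.
Hypothesis g_ndecr : forall s t : R, s \in `]0, 1[ -> t \in `]0, 1[ -> s <= t -> g s <= g t.
Hypothesis g_int : lebesgue_measure.-integrable `[0, 1] (EFin \o g).

Local Notation mu := (@lebesgue_measure R).
Local Notation U := (`[0, 1]%classic : set (measurableTypeR R)).

Definition abs_mass := \int[mu]_(t in U) `|g t|.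

Lemma integrable_abs_g : mu.-integrable U (EFin \o (fun t => `|g t|)).
Proof. by have := integrable_abse g_int; apply: eq_integrable => // t _. Qed.

Lemma abs_mass_ge0 : 0 <= abs_mass.
Proof. by apply: Rintegral_ge0. Qed.

Lemma integrable_mulg (h : R -> R) B : measurable_fun U h -> 
  (forall t, t \in `[0, 1] -> `|h t| <= B) -> mu.-integrable U (EFin \o (fun t => h t * g t)).
Proof.
move=> mh hB; have : mu.-integrable U ((EFin \o h) \* (EFin \o g))%E.
  apply: integrableMr => //; exists B; split; first exact: num_real.
  by move=> x Bx t /= tU; apply: le_trans (hB _ _) (ltW Bx).
by apply: eq_integrable => // t _; rewrite /= EFinM.
Qed.

(** The bound [B] on the whole interval gives integrability, the bound [b] on [D] the estimate. *)
Lemma normr_integral_mulg (h : R -> R) B b (D : set (measurableTypeR R)) : measurable D -> D `<=` U ->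
  measurable_fun U h -> (forall t, t \in `[0, 1] -> `|h t| <= B) ->
  (forall t, D t -> `|h t| <= b) ->
  `|\int[mu]_(t in D) (h t * g t)| <= b * \int[mu]_(t in D) `|g t|.
Proof.
move=> mD DU mh hB hb.
have ihg : mu.-integrable D (EFin \o (fun t => h t * g t)).
  by apply: integrableS (integrable_mulg mh hB) => //.
have ig : mu.-integrable D (EFin \o (fun t => `|g t|)).
  by apply: integrableS integrable_abs_g => //.
apply: le_trans (le_normr_Rintegral mD ihg) _.
rewrite -RintegralZl //; apply: le_Rintegral => //.
- by have := integrable_abse ihg; apply: eq_integrable => // t _.
- have := integrableZl mD b ig; exact: eq_integrable.
- by move=> t Dt; rewrite normrM ler_wpM2r ?hb.
Qed.

Definition moment k := \int[mu]_(t in U) (t ^+ k * g t).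

Lemma measurable_exprn (D : set (measurableTypeR R)) k : measurable_fun D (fun t : R => t ^+ k).
Proof. by apply: measurable_funX; exact: measurable_id. Qed.

Lemma exprn_unit_le1 k (t : R) : t \in `[0, 1] -> `|t ^+ k| <= 1.
Proof. by rewrite in_itv /= => /andP[t0 t1]; rewrite ger0_norm ?exprn_ge0 // exprn_ile1. Qed.

Definition cell n j : set (measurableTypeR R) := `](j%:R / n%:R), (j.+1%:R / n%:R)]%classic.

Definition weight n j := \int[mu]_(t in cell n j) g t.

Lemma measurable_cell n j : measurable (cell n j).
Proof. exact: measurable_itv. Qed.

Lemma cell_sub n j : (j < n)%N -> cell n j `<=` U.
Proof.
move=> jn t; rewrite /cell /= !in_itv /= => /andP[t1 t2].
have n0 : 0 < n%:R :> R by rewrite ltr0n (leq_ltn_trans _ jn).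
apply/andP; split; first by rewrite ltW // (le_lt_trans _ t1) // divr_ge0.
by rewrite (le_trans t2) // ler_pdivrMr // mul1r ler_nat.
Qed.

Lemma sum_cells n (F : R -> R) : (0 < n)%N -> mu.-integrable U (EFin \o F) ->
  \int[mu]_(t in U) F t = \sum_(j < n) \int[mu]_(t in cell n j) F t.
Proof.
move=> n0 iF; have n0R : 0 < n%:R :> R by rewrite ltr0n.
suff H m : (m <= n)%N -> \int[mu]_(t in `[0, (m%:R / n%:R)]%classic) F t =
    \sum_(j < m) \int[mu]_(t in cell n j) F t.
  by rewrite -(H n) // divff // gt_eqF.
elim: m => [_|m IH mn]; first by rewrite mul0r set_itv1 Rintegral_set1 big_ord0.
rewrite big_ord_recr /= -IH ?(ltnW mn) //.
apply/eqP; rewrite addrC -subr_eq; apply/eqP; apply: Rintegral_itvB.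
- apply: integrableS iF => //; apply: subset_itvl.
  by rewrite bnd_simp ler_pdivrMr // mul1r ler_nat.
- by rewrite bnd_simp divr_ge0.
- by rewrite bnd_simp ler_wpM2r ?invr_ge0 ?(ltW n0R) // ler_nat.
Qed.

(** The last cell contains 1, where neither sign nor monotonicity of [g] is assumed; removing the
    right endpoint, a null set, leaves a subset of []0, 1[]. *)
Lemma weightE n j : (j < n)%N ->
  weight n j = \int[mu]_(t in `](j%:R / n%:R), (j.+1%:R / n%:R)[%classic) g t.
Proof.
move=> jn; rewrite Rintegral_itv_bndo_bndc //.
apply: integrableS g_int => //; apply: subset_trans (cell_sub jn).
by move=> t; rewrite /cell /= !in_itv /= => /andP[t1 t2]; rewrite t1 ltW.
Qed.

Lemma cell_open n j (t : R) : (j < n)%N -> t \in `](j%:R / n%:R), (j.+1%:R / n%:R)[ -> t \in `]0, 1[.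
Proof.
move=> jn; rewrite !in_itv /= => /andP[t1 t2].
have n0 : 0 < n%:R :> R by rewrite ltr0n (leq_ltn_trans _ jn).
apply/andP; split; first by rewrite (le_lt_trans _ t1) // divr_ge0.
by rewrite (lt_le_trans t2) // ler_pdivrMr // mul1r ler_nat.
Qed.

Lemma weight_ge0 n j : (j < n)%N -> 0 <= weight n j.
Proof.
move=> jn; rewrite weightE //; apply: Rintegral_ge0 => t tI.
by apply: g_ge0; exact: cell_open tI.
Qed.

Lemma integral_cst_itv (a b c : R) : a <= b ->
  \int[mu]_(t in `]a, b]%classic) cst c t = c * (b - a) /\
  \int[mu]_(t in `]a, b[%classic) cst c t = c * (b - a).
Proof.
move=> ab; rewrite !Rintegral_cst //.
have E (i : interval R) : i.1 = BRight a -> (i.2 = BLeft b \/ i.2 = BRight b) ->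
    fine (mu [set` i]) = b - a.
  move=> i1 i2; transitivity (fine (if i.1 < i.2 then (i.2 : \bar R) - i.1 else 0)%E).
    by congr fine; exact: lebesgue_measure_itv.
  rewrite i1; move: ab; rewrite le_eqVlt; case: i2 => -> /orP[/eqP ->|ab] /=.
  - by rewrite lte_fin ltxx subrr.
  - by rewrite lte_fin ab.
  - by rewrite lte_fin ltxx subrr.
  - by rewrite lte_fin ab.
by split; congr (_ * _); apply: E => //=; [right|left].
Qed.

Lemma integrable_cst_unit c : mu.-integrable U (EFin \o cst c).
Proof.
have muU : mu U = (1%:E - 0%:E)%E.
  by apply: (etrans (lebesgue_measure_itv _)); rewrite /= lte_fin ltr01.
have finU : (mu U < +oo)%E by rewrite muU -EFinB ltry.
apply: measurable_bounded_integrable => //.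
by exists `|c|; split; [exact: num_real|move=> x xs t _ /=; exact: ltW].
Qed.

(** The value of [g] at the common endpoint separates the two cells: times [1 / n], it bounds the
    left mass from above and the right mass from below. *)
Lemma weight_ndecr n j : (j.+1 < n)%N -> weight n j <= weight n j.+1.
Proof.
move=> jn; have n0 : 0 < n%:R :> R by rewrite ltr0n (leq_ltn_trans _ jn).
pose s : R := j.+1%:R / n%:R.
have s01 : s \in `]0, 1[.
  by rewrite in_itv /= divr_gt0 //= ltr_pdivrMr // mul1r ltr_nat.
have step i : i.+1%:R / n%:R - i%:R / n%:R = n%:R^-1 :> R.
  by rewrite -mulrBl -natr1 addrAC subrr add0r mul1r.
have le i : i%:R / n%:R <= i.+1%:R / n%:R :> R.
  by rewrite ler_wpM2r ?invr_ge0 ?(ltW n0) // ler_nat.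
apply: (@le_trans _ _ (g s * n%:R^-1)).
  rewrite -(step j) -(integral_cst_itv (g s) (le j)).1.
  apply: le_Rintegral => //.
  - exact: measurable_cell.
  - apply: integrableS g_int => //; [exact: measurable_cell|apply: cell_sub; exact: ltnW].
  - apply: integrableS (integrable_cst_unit _) => //; [exact: measurable_cell|].
    by apply: cell_sub; exact: ltnW.
  - move=> t; rewrite /cell /= in_itv /= => /andP[t1 t2]; apply: g_ndecr => //.
    rewrite in_itv /= (le_lt_trans _ t1) ?divr_ge0 //=.
    by move: s01; rewrite in_itv /= => /andP[_]; apply: le_lt_trans.
have E := (integral_cst_itv (g s) (le j.+1)).2; rewrite step in E; rewrite -E weightE //.
apply: le_Rintegral => //.
- apply: integrableS (integrable_cst_unit _) => //; apply: subset_trans (cell_sub jn).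
  by move=> t; rewrite /cell /= !in_itv /= => /andP[t1 t2]; rewrite t1 ltW.
- apply: integrableS g_int => //; apply: subset_trans (cell_sub jn).
  by move=> t; rewrite /cell /= !in_itv /= => /andP[t1 t2]; rewrite t1 ltW.
- move=> t tI; have t01 := cell_open jn tI; apply: g_ndecr => //.
  by move: tI; rewrite /= in_itv /= => /andP[/ltW].
Qed.

Lemma normr_subX_le (x y : R) k : 0 <= x <= 1 -> 0 <= y <= 1 -> 
  `|x ^+ k - y ^+ k| <= k%:R * `|x - y|.
Proof.
move=> /andP[x0 x1] /andP[y0 y1]; elim: k => [|k IH]; first by rewrite !expr0 subrr normr0 mul0r.
have -> : x ^+ k.+1 - y ^+ k.+1 = x * (x ^+ k - y ^+ k) + (x - y) * y ^+ k.
  by rewrite !exprS; ring.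
have -> : k.+1%:R * `|x - y| = k%:R * `|x - y| + `|x - y| by rewrite -natr1; ring.
rewrite (le_trans (ler_normD _ _)) // lerD // normrM.
  by rewrite (le_trans _ IH) // ger0_norm // ler_piMl.
by rewrite (ger0_norm (exprn_ge0 _ y0)) ler_piMr // exprn_ile1.
Qed.

(** On the [j]-th cell [t] differs from the right endpoint by at most [1 / n], and [t ^ k] is
    [k]-Lipschitz on [[0, 1]]. *)
Lemma moment_approx n k : (0 < n)%N ->
  `|\sum_(j < n) weight n j * (j.+1%:R / n%:R) ^+ k - moment k| <= k%:R / n%:R * abs_mass.
Proof.
move=> n0; have n0R : 0 < n%:R :> R by rewrite ltr0n.
rewrite /moment (sum_cells n0); last first.
  by apply: integrable_mulg (measurable_exprn _) _ => t; exact: exprn_unit_le1.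
rewrite /abs_mass (sum_cells n0) ?mulr_sumr; last exact: integrable_abs_g.
rewrite -sumrB (le_trans (ler_norm_sum _ _ _)) //; apply: ler_sum => j _.
have mc : measurable (cell n j) := measurable_cell _ _.
have cU := cell_sub (ltn_ord j).
pose s : R := j.+1%:R / n%:R.
have s01 : 0 <= s <= 1 by rewrite divr_ge0 //= ler_pdivrMr // mul1r ler_nat.
have -> : weight n j * s ^+ k - \int[mu]_(t in cell n j) (t ^+ k * g t) =
    \int[mu]_(t in cell n j) ((s ^+ k - t ^+ k) * g t).
  have igc : mu.-integrable (cell n j) (EFin \o g) by apply: integrableS g_int.
  rewrite mulrC /weight -RintegralZl //.
  rewrite -RintegralB //.
  - by apply: eq_Rintegral => t _; rewrite mulrBl.
  - have := integrableZl mc (s ^+ k) igc.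
    exact: eq_integrable.
  - apply: (@integrableS _ _ _ _ U) => //.
    by apply: integrable_mulg (measurable_exprn _) _ => t; exact: exprn_unit_le1.
apply: (@normr_integral_mulg _ 2) => //.
- by apply: measurable_funB => //; exact: measurable_exprn.
- move=> t tU; rewrite (le_trans (ler_normB _ _)) //.
  have := exprn_unit_le1 k tU; have : `|s ^+ k| <= 1 by apply: exprn_unit_le1; rewrite in_itv.
  by lra.
- move=> t ct; have := cU _ ct; rewrite /= in_itv /= => t01.
  apply: le_trans (normr_subX_le _ s01 t01) _; rewrite ler_wpM2l //.
  move: ct; rewrite /cell /= in_itv /= -/s => /andP[t1 t2].
  rewrite ger0_norm ?subr_ge0 // lerBlDr -lerBlDl (le_trans _ (ltW t1)) //.
  by rewrite /s -natr1 mulrDl mul1r addrK.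
Qed.

End Weights.

(** * Termwise integration of the cosine series *)

Section TaylorCoefficients.
Variables (R : realType) (g : R -> R).
Local Notation mu := (@lebesgue_measure R).
Local Notation U := (`[0, 1]%classic : set (measurableTypeR R)).
Local Notation C := R[i].
Local Notation N := (@Normc.normc R).
Hypothesis g_int : mu.-integrable U (EFin \o g).

Lemma geo_le_eps (K e : R) : 0 < e -> exists n0, forall n, (n0 <= n)%N -> K * (1 / 2) ^+ n <= e.
Proof.
move=> e0; exists (Num.bound (`|K| / e)) => n n0n.
have h1 : n%:R <= 2 ^+ n :> R by rewrite -natrX ler_nat ltnW // ltn_expl.
have h2 : `|K| / e <= n%:R.
  by rewrite (le_trans (ltW (archi_boundP _))) ?divr_ge0 ?(ltW e0) // ler_nat.
rewrite div1r exprVn ler_pdivrMr ?exprn_gt0 // (le_trans (ler_norm K)) //.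
by rewrite mulrC -ler_pdivrMr // (le_trans h2).
Qed.

Lemma cexp_line (w : C) (t : R) : cexp (w * t%:C) =
  (expR (complex.Re w * t) * cos (complex.Im w * t)) +i*
  (expR (complex.Re w * t) * sin (complex.Im w * t)).
Proof. by case: w => a b; rewrite /cexp /= !mulr0 subr0 add0r. Qed.

Lemma measurable_scale (a : R) : measurable_fun (setT : set (measurableTypeR R)) (fun t : R => a * t).
Proof. by apply: measurable_funM => //; exact: measurable_id. Qed.

Lemma measurable_cexp_Re (w : C) : 
  measurable_fun (setT : set (measurableTypeR R)) (fun t : R => complex.Re (cexp (w * t%:C))).
Proof.
under eq_fun do rewrite cexp_line /=.
apply: measurable_funM.
  by apply: measurableT_comp (measurable_scale _); apply: continuous_measurable_fun; exact: continuous_expR.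
by apply: measurableT_comp (measurable_scale _); apply: continuous_measurable_fun; exact: continuous_cos.
Qed.

Lemma measurable_cexp_Im (w : C) : 
  measurable_fun (setT : set (measurableTypeR R)) (fun t : R => complex.Im (cexp (w * t%:C))).
Proof.
under eq_fun do rewrite cexp_line /=.
apply: measurable_funM.
  by apply: measurableT_comp (measurable_scale _); apply: continuous_measurable_fun; exact: continuous_expR.
by apply: measurableT_comp (measurable_scale _); apply: continuous_measurable_fun; exact: continuous_sin.
Qed.

Section Component.
Variable pr : C -> R.
Hypotheses (prD : forall z w, pr (z + w) = pr z + pr w) (prZ : forall z r, pr (z * r%:C) = pr z * r)
  (prN : forall z, `|pr z| <= N z)
  (prm : forall w, measurable_fun (setT : set (measurableTypeR R)) (fun t : R => pr (cexp (w * t%:C)))).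

(** [pr] stands for the real or the imaginary part, so that the estimate is made once for real
    integrals. [h m] is [pr] of the Taylor remainder of the cosine along the segment, bounded
    uniformly in [t]; each further term of the expansion subtracts one moment from its integral
    against [g]. *)
Lemma component_integral (w : C) r m : 0 < r -> N w <= r / 2 ->
  `|\int[mu]_(t in U) pr (ccos (w * t%:C) * (g t)%:C) - 
    \sum_(0 <= k < m) pr (@ccos_coef R k * w ^+ k) * moment g k| 
  <= 2 * expR r * (N w / r) ^+ m * abs_mass g.
Proof.
move=> r0 wr; pose h m t := pr (ccos (w * t%:C)) - \sum_(0 <= k < m) pr (@ccos_coef R k * w ^+ k) * t ^+ k.
have pr0 : pr 0 = 0 by have := prD 0 0; rewrite addr0; lra.
have hE n t : h n t = pr (ccos (w * t%:C) - \sum_(0 <= k < n) @ccos_coef R k * (w * t%:C) ^+ k).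
  have prNg z : pr (- z) = - pr z by apply/eqP; rewrite -addr_eq0 -prD addNr pr0.
  rewrite prD prNg; congr (_ - _).
  elim: n => [|n IH]; first by rewrite !big_geq.
  by rewrite !big_nat_recr //= prD IH exprMn -rmorphXn mulrA prZ.
have hB n t : t \in `[0, 1] -> `|h n t| <= 2 * expR r * (N w / r) ^+ n.
  rewrite in_itv /= => /andP[t0 t1].
  have wtN : N (w * t%:C) <= N w.
    by rewrite Normc.normcM normc_real ger0_norm // ler_piMr ?normc_ge0.
  rewrite hE (le_trans (prN _)) // (le_trans (ccos_taylor _ r0 _)) ?(le_trans wtN) //.
  rewrite ler_wpM2l ?mulr_ge0 ?expR_ge0 // lerXn2r ?nnegrE ?divr_ge0 ?normc_ge0 ?(ltW r0) //.
  by rewrite ler_wpM2r // invr_ge0 ltW.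
have mh n : measurable_fun U (h n).
  elim: n => [|n IH].
    rewrite (_ : h 0%N = fun t => (pr (cexp ('i * w * t%:C)) + pr (cexp ((- 'i * w) * t%:C))) * 2^-1).
      apply: measurable_funTS; apply: measurable_funM; last exact: measurable_cst.
      by apply: measurable_funD; exact: prm.
    apply/funext => t; rewrite /h big_geq // subr0 /ccos -prD -prZ.
    by rewrite !mulNr mulrA fmorphV /= rmorph_nat.
  rewrite (_ : h n.+1 = fun t => h n t - pr (@ccos_coef R n * w ^+ n) * t ^+ n).
    apply: measurable_funB => //; apply: measurable_funM; first exact: measurable_cst.
    exact: measurable_exprn.
  by apply/funext => t; rewrite /h big_nat_recr //= opprD addrA.
have -> : \int[mu]_(t in U) pr (ccos (w * t%:C) * (g t)%:C) - 
    \sum_(0 <= k < m) pr (@ccos_coef R k * w ^+ k) * moment g k = \int[mu]_(t in U) (h m t * g t).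
  elim: m => [|m IH].
    rewrite big_geq // subr0; apply: eq_Rintegral => t _.
    by rewrite prZ /h big_geq // subr0.
  rewrite big_nat_recr //= opprD addrA IH /moment.
  have iX : mu.-integrable U (EFin \o (fun t : R => t ^+ m * g t)).
    exact: (integrable_mulg g_int (@measurable_exprn R _ _) (@exprn_unit_le1 R m)).
  rewrite -RintegralZl // -RintegralB //.
  - by apply: eq_Rintegral => t _; rewrite /h [in RHS]big_nat_recr //=; ring.
  - exact: (integrable_mulg g_int (mh m) (hB m)).
  - have mU : measurable U by [].
    have := integrableZl mU (pr (@ccos_coef R m * w ^+ m)) iX; exact: eq_integrable.
apply: (normr_integral_mulg g_int _ _ (mh m) (hB m)) => //.
by move=> t /= tU; exact: hB.
Qed.

End Component.

Variable lambda : R.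

Definition rep_coef k : C := ccos_coef R k * (lambda ^+ k * moment g k)%:C.

Lemma cintegral_loc_unif (f : C -> C) :
  (forall z : C, f z = cintegral `[0, 1] (fun t => ccos (lambda%:C * z * t%:C) * (g t)%:C)) ->
  loc_unif (fun n => horner (\poly_(k < n) rep_coef k)) f.
Proof.
move=> frep L e e0; pose L' := `|L| + 1.
have L'0 : 0 < L' by rewrite ltr_wpDl.
pose r := 2 * `|lambda| * L' + 1.
have r0 : 0 < r by rewrite ltr_wpDl // !mulr_ge0 // ltW.
have [n0 Hn0] := @geo_le_eps (4 * expR r * abs_mass g) e e0.
exists n0 => n n0n z zL; apply: le_trans (Hn0 n n0n).
have zL' : N z <= L' by rewrite (le_trans zL) // (le_trans (ler_norm L)) // lerDl.
pose w := lambda%:C * z.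
have wr : N w <= r / 2.
  rewrite Normc.normcM normc_real ler_pdivlMr // /r.
  have : `|lambda| * N z <= `|lambda| * L' by rewrite ler_wpM2l.
  by lra.
have G0 : 0 <= abs_mass g by exact: abs_mass_ge0.
have bound m : 2 * expR r * (N w / r) ^+ m * abs_mass g <= 2 * expR r * abs_mass g * (1 / 2) ^+ m.
  rewrite mulrAC ler_wpM2l ?mulr_ge0 ?expR_ge0 // lerXn2r ?nnegrE ?divr_ge0 ?normc_ge0 ?(ltW r0) //.
  by rewrite ler_pdivrMr // div1r mulrC.
have hRe := @component_integral (@complex.Re R) _ _ _ measurable_cexp_Re w r n r0 wr.
have hIm := @component_integral (@complex.Im R) _ _ _ measurable_cexp_Im w r n r0 wr.
rewrite horner_poly normc_dist (le_trans (normc_le_ReIm _)) //.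
have -> : 4 * expR r * abs_mass g * (1 / 2) ^+ n = 
   2 * expR r * abs_mass g * (1 / 2) ^+ n + 2 * expR r * abs_mass g * (1 / 2) ^+ n by ring.
have term k : rep_coef k * z ^+ k = ccos_coef R k * w ^+ k * (moment g k)%:C.
  by rewrite /rep_coef /w exprMn rmorphM rmorphXn /=; ring.
have sumpr (pr : C -> R) : (forall z w, pr (z + w) = pr z + pr w) -> 
    (forall z r, pr (z * r%:C) = pr z * r) -> pr 0 = 0 ->
    pr (\sum_(k < n) rep_coef k * z ^+ k) = \sum_(0 <= k < n) pr (ccos_coef R k * w ^+ k) * moment g k.
  move=> prD prZ pr0; rewrite big_mkord.
  rewrite (big_morph pr prD pr0); apply: eq_bigr => k _.
  by rewrite term prZ.
have sub (z1 z2 : C) : complex.Re (z1 - z2) = complex.Re z1 - complex.Re z2 /\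
   complex.Im (z1 - z2) = complex.Im z1 - complex.Im z2 by case: z1 z2 => [? ?] [? ?].
apply: lerD.
  rewrite (sub _ _).1 sumpr //; [|by case=> [? ?] [? ?]|by case=> [a b] c /=; ring].
  apply: le_trans (bound n); apply: le_trans (hRe _ _ _).
  - by rewrite frep.
  - by case=> [? ?] [? ?].
  - by case=> [a b] c /=; ring.
  - exact: normc_Re.
rewrite (sub _ _).2 sumpr //; [|by case=> [? ?] [? ?]|by case=> [a b] c /=; ring].
apply: le_trans (bound n); apply: le_trans (hIm _ _ _).
- by rewrite frep.
- by case=> [? ?] [? ?].
- by case=> [a b] c /=; ring.
- exact: normc_Im.
Qed.

Lemma taylor_coef_loc_unif (f : C -> C) (c : nat -> C) k :
  loc_unif (fun n => horner (\poly_(j < n) c j)) f -> taylor_coef (f : C^o -> C^o) k = c k.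
Proof.
move=> /(loc_unif_nderivn k) lf; rewrite /taylor_coef.
apply/eqP; rewrite -subr_eq0 -normc_eq0 eq_le normc_ge0 andbT.
apply/ler_addgt0Pr => e e0; rewrite add0r normc_dist.
have [n0 H] := lf 0 e e0; have := H (maxn n0 k.+1) (leq_maxl _ _) 0.
rewrite Normc.normc0 lexx => /(_ isT).
by rewrite horner_coef0 coef_nderivn addn0 binn mulr1n coef_poly leq_maxr.
Qed.

End TaylorCoefficients.

(** * Approximation by polynomials and the operator [f(D)] *)

Section Approximable.
Variable R : realType.
Local Notation C := R[i].
Local Notation N := (@Normc.normc R).
Implicit Types (z w : C) (S : set {poly C}) (phi : C -> C).

Definition approximable S phi :=
  exists2 P : nat -> {poly C}, (forall n, S (P n)) & loc_unif (fun n => horner (P n)) phi.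

Lemma approximable_eps S phi : (forall L e : R, 0 < e -> 
    exists2 p, S p & forall z, N z <= L -> N (p.[z] - phi z) <= e) -> approximable S phi.
Proof.
move=> H; have /choice[P HP] : forall n : nat, exists p, 
    S p /\ forall z, N z <= n%:R -> N (p.[z] - phi z) <= n.+1%:R^-1.
  by move=> n; have [|p Sp Hp] := H n%:R n.+1%:R^-1; [rewrite invr_gt0|exists p].
exists P => [n|L e e0]; first by case: (HP n).
exists (maxn (Num.bound `|L|) (Num.bound e^-1)) => n; rewrite geq_max => /andP[nL ne] z zL.
apply: le_trans ((HP n).2 z _) _.
  rewrite (le_trans zL) // (le_trans (ler_norm L)) //.
  by rewrite (le_trans (ltW (archi_boundP _))) // ler_nat.
rewrite -[e]invrK lef_pV2 ?posrE ?invr_gt0 //.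
by rewrite (le_trans (ltW (archi_boundP _))) ?invr_ge0 ?(ltW e0) // ler_nat (leq_trans ne).
Qed.

Lemma approximable_closed S u phi : (forall n, approximable S (u n)) -> loc_unif u phi ->
  approximable S phi.
Proof.
move=> Su lu; apply: approximable_eps => L e e0; have e20 := divr2_gt0 e0.
have [n0 H] := lu L _ e20; have [P SP lP] := Su n0.
have [m0 Hm] := lP L _ e20; exists (P m0) => // z zL.
by rewrite (le_trans (normc_dist_trans (u n0 z) _ _)) // [e]splitr lerD ?Hm ?H.
Qed.

End Approximable.

(** * Convergence of [f(D)] on limits of polynomials *)

Section DifferentialOperator.
Variables (R : realType) (c : nat -> R[i]) (G l : R).
Local Notation C := R[i].
Local Notation N := (@Normc.normc R).
Implicit Types (z w : C) (p q : {poly C}).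
Hypotheses (G_ge0 : 0 <= G) (l_ge0 : 0 <= l).
Hypothesis c_bound : forall k, N (c k) <= G * l ^+ k / (k`!)%:R.

Definition deriv_sum n p : {poly C} := \sum_(0 <= k < n) c k *: p^`(k).

(** This radius satisfies [l / r <= 1 / 2] and stays positive when [l = 0]. *)
Local Notation r := (2 * l + 1).

(** The Cauchy estimate for the [k]-th derivative brings a factor [k!] that cancels the one in
    [c_bound]; the sum is then geometric with ratio at most [1 / 2]. The bound depends neither on
    [n] nor on the degree of [p], which makes the interchange of limits possible. *)
Lemma deriv_sum_le n p z M : (forall w, N (w - z) = r -> N p.[w] <= M) ->
  N (deriv_sum n p).[z] <= 2 * G * M.
Proof.
have r0 : 0 < r by rewrite ltr_wpDl // mulr_ge0.
move=> pM; have M0 : 0 <= M.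
  by apply: le_trans (normc_ge0 _) (pM (z + r%:C) _); rewrite addrC addKr normc_real gtr0_norm.
rewrite horner_sum (le_trans (normc_sum _ _ _)) //.
apply: (@le_trans _ _ (\sum_(0 <= k < n) G * M * (l / r) ^+ k)).
  apply: ler_sum => k _; rewrite hornerZ nderivn_def hornerMn Normc.normcM.
  rewrite -mulr_natr Normc.normcM normc_nat.
  have k0 : 0 < (k`!)%:R :> R by rewrite ltr0n fact_gt0.
  have := cauchy_estimate k (ltW r0) pM; rewrite -ler_pdivlMr ?exprn_gt0 // => h1.
  apply: le_trans (_ : G * l ^+ k / (k`!)%:R * (M / r ^+ k * (k`!)%:R) <= _).
    by apply: ler_pM; rewrite ?mulr_ge0 ?normc_ge0 ?ler_wpM2r ?c_bound ?ler0n.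
  rewrite le_eqVlt; apply/orP; left; apply/eqP; rewrite expr_div_n.
  by field; rewrite !gt_eqF // exprn_gt0.
rewrite -mulr_sumr; have : \sum_(0 <= k < n) (l / r) ^+ k <= 2 * (l / r) ^+ 0.
  apply: geo_tail; rewrite divr_ge0 ?(ltW r0) //= ler_pdivrMr // div1r; lra.
have : 0 <= G * M by rewrite mulr_ge0.
rewrite expr0 mulr1; nra.
Qed.

Lemma deriv_sumB n p q : deriv_sum n (p - q) = deriv_sum n p - deriv_sum n q.
Proof. by rewrite /deriv_sum -sumrB; apply: eq_bigr => k _; rewrite derivnB scalerBr. Qed.

Lemma deriv_sum_size n p : (size p <= n)%N -> deriv_sum n p = deriv_sum (size p) p.
Proof.
move=> pn; rewrite /deriv_sum (big_cat_nat (n := size p)) //= [X in _ + X]big1_seq ?addr0 //.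
move=> k /=; rewrite mem_index_iota => /andP[pk _].
by rewrite derivn_poly0 // scaler0.
Qed.

(** Both the partial sums of [f(D) phi] and the full [f(D) (P m)] must converge, to the same limit.
    [F2], uniform in the number of terms, compares the partial sums on [phi] with those on a fixed
    [P m], which are constant beyond the degree. *)
Lemma deriv_sum_loc_unif P (phi : C -> C) : loc_unif (fun n => horner (P n)) phi ->
  exists2 psi : C -> C,
   loc_unif (fun n z => \sum_(0 <= k < n) c k * derive1n k (phi : C^o -> C^o) z) psi &
   loc_unif (fun m => horner (deriv_sum (size (P m)) (P m))) psi.
Proof.
move=> lP; set part := (fun n z => _).
have F1 n : loc_unif (fun m => horner (deriv_sum n (P m))) (part n).
  have := @loc_unif_sum R nat (index_iota 0 n) (fun k m z => c k * (P m)^`(k).[z])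
    (fun k z => c k * derive1n k (phi : C^o -> C^o) z).
  move=> H; apply: loc_unif_eq (H _) => [m z|k].
    by rewrite /deriv_sum horner_sum; apply: eq_bigr => k _; rewrite hornerZ.
  exact: (loc_unif_cmul (@loc_bounded_cst R (c k)) (loc_unif_derive1n k lP)).
have F2 m L e : (forall w, N w <= L + r -> N ((P m).[w] - phi w) <= e) ->
    forall n z, N z <= L -> N ((deriv_sum n (P m)).[z] - part n z) <= 2 * G * e.
  move=> He n z zL; apply/ler_addgt0Pr => e' e'0.
  have K0 : 0 < 2 * G + 1 by rewrite ltr_wpDl // mulr_ge0.
  pose eta := e' / (2 * G + 1); have eta0 : 0 < eta by rewrite divr_gt0.
  have [j1 H1] := lP (L + r) _ eta0; have [j2 H2] := F1 n L _ eta0.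
  pose j := maxn j1 j2.
  apply: le_trans (normc_dist_trans (deriv_sum n (P j)).[z] _ _) _.
  have -> : e' = 2 * G * eta + eta by rewrite -{2}[eta]mul1r -mulrDl mulrC divfK // gt_eqF.
  rewrite addrA lerD ?H2 ?leq_maxr // -mulrDr.
  rewrite -hornerN -hornerD -deriv_sumB; apply: deriv_sum_le => w wz.
  have wL : N w <= L + r.
    by rewrite -(subrK z w) (le_trans (normcD _ _)) // wz addrC lerD.
  rewrite hornerD hornerN (le_trans (normc_dist_trans (phi w) _ _)) // lerD ?He //.
  by rewrite normc_dist H1 ?leq_maxl.
have E0 e : 0 < e -> exists2 eta, 0 < eta & 2 * G * eta <= e.
  move=> e0; have K0 : 0 < 2 * G + 1 by rewrite ltr_wpDl // mulr_ge0.
  exists (e / (2 * G + 1)); first exact: divr_gt0.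
  by rewrite mulrA ler_pdivrMr // mulrC ler_wpM2l ?(ltW e0) // lerDl.
have [psi lpsi] : exists psi, loc_unif part psi.
  apply: loc_unif_cauchy_cvg => L e e0; have [eta eta0 Heta] := E0 _ (divr2_gt0 e0).
  have [m H] := lP (L + r) _ eta0; exists (size (P m)) => n n' hn hn' z zL.
  have h k := F2 m L eta (H m (leqnn m)) k z zL.
  apply: le_trans (normc_dist_trans (deriv_sum n (P m)).[z] _ _) _.
  rewrite [e]splitr lerD //; first by rewrite normc_dist (le_trans (h n)).
  by rewrite deriv_sum_size // -(deriv_sum_size hn') (le_trans (h n')).
exists psi => // L e e0; have [eta eta0 Heta] := E0 _ (divr2_gt0 e0).
have [m0 H] := lP (L + r) _ eta0; exists m0 => m hm z zL.
have [n0 Hn] := lpsi L _ (divr2_gt0 e0).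
pose n := maxn n0 (size (P m)).
rewrite -(@deriv_sum_size n) ?leq_maxr //.
apply: le_trans (normc_dist_trans (part n z) _ _) _.
rewrite [e]splitr lerD ?Hn ?leq_maxl //.
exact: le_trans (F2 m L eta (H m hm) n z zL) Heta.
Qed.

End DifferentialOperator.

(** * From cosine sums to [f(D)] on real polynomials *)

Section CosineTransform.
Variables (R : realType).
Local Notation C := R[i].
Local Notation N := (@Normc.normc R).
Implicit Types (z w : C) (p q : {poly C}) (mu lambda : R).

Lemma ccos_coef_odd k : odd k -> ccos_coef R k = 0.
Proof. by move=> ok; rewrite /ccos_coef exprNn -signr_odd ok expr1 mulN1r subrr !mul0r. Qed.

(** Taylor's formula for the shifts; the symmetric sum produces [i ^ k + (- i) ^ k], which is [2 k!]
    times [ccos_coef k]. *)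
Lemma cos_sumE (e : nat -> R) n h p z : (cos_sum e n h p).[z] =
  2 * \sum_(k < size p) (h ^+ k * \sum_(j < n.+1) e j * j%:R ^+ k)%:C * (ccos_coef R k * p^`(k).[z]).
Proof.
rewrite /cos_sum horner_sum.
transitivity (\sum_(j < n.+1) \sum_(k < size p) (h ^+ k * (e j * j%:R ^+ k))%:C * 
    (('i ^+ k + (- 'i) ^+ k) * p^`N(k).[z])).
  apply: eq_bigr => j _; rewrite hornerZ hornerD !shift_polyE.
  have jE : (0 +i* h) *+ j = 'i * (h * j%:R)%:C :> C.
    rewrite imMn -[h *+ j]mulr_natr; apply/eqP; rewrite eq_complex /=.
    by apply/andP; split; apply/eqP; ring.
  have T a : p.[z + a] = \sum_(k < size p) p^`N(k).[z] * a ^+ k.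
    by apply: nderiv_taylor; exact: mulrC.
  rewrite !T -big_split /= mulr_sumr.
  apply: eq_bigr => k _; rewrite jE -mulNr !exprMn.
  have -> : (h ^+ k * (e j * j%:R ^+ k))%:C = (e j)%:C * (h * j%:R)%:C ^+ k.
    by rewrite !(rmorphM, rmorphXn) exprMn; ring.
  by ring.
rewrite exchange_big /= mulr_sumr; apply: eq_bigr => k _.
rewrite -mulr_suml -rmorph_sum /= -mulr_sumr.
have -> : p^`(k).[z] = p^`N(k).[z] * (k`!)%:R by rewrite nderivn_def hornerMn mulr_natr.
have k0 : (k`!)%:R != 0 :> C by rewrite pnatr_eq0 -lt0n fact_gt0.
by rewrite /ccos_coef; field.
Qed.

Lemma loc_unif_coef_sum d (a : nat -> nat -> R) (b : nat -> R) (q : nat -> C -> C) :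
  (forall k e, 0 < e -> exists m0, forall m, (m0 <= m)%N -> `|a m k - b k| <= e) ->
  (forall k, loc_bounded (q k)) ->
  loc_unif (fun m z => \sum_(k < d) (a m k)%:C * q k z) (fun z => \sum_(k < d) (b k)%:C * q k z).
Proof.
move=> H bq; apply: (@loc_unif_sum R _ (index_enum 'I_d) (fun k m z => (a m k)%:C * q k z)
  (fun k z => (b k)%:C * q k z)) => k.
apply: (@loc_unif_mul R (fun m _ => (a m k)%:C) (fun m => q k) (fun=> (b k)%:C) (q k)).
- exact: loc_bounded_cst.
- exact: bq.
- move=> L e e0; have [m0 Hm] := H k e e0; exists m0 => m hm z _.
  by rewrite -rmorphB normc_real Hm.
- exact: loc_unif_cst.
Qed.

Lemma real_strip_polyZ mu (a : R) p : a != 0 -> real_strip_poly mu p -> real_strip_poly mu (a%:C *: p).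
Proof.
have aE : (a%:C == 0 :> C) = (a == 0) by rewrite eq_complex /= eqxx andbT.
move=> a0 [sp rp]; split; first by move=> z; rewrite rootZ ?aE //; exact: sp.
by rewrite /real_poly map_polyZ rp -[X in X *: _]/(a%:C^*) conjc_real.
Qed.

Lemma real_strip_poly_le mu mu' : mu <= mu' -> real_strip_poly mu `<=` real_strip_poly mu'.
Proof. by move=> le p [sp rp]; split => // z /sp h; exact: le_trans le. Qed.

(** The perturbation parameter [1 / (m + 1)] will enter the coefficients polynomially, so its
    removal is continuity of a polynomial at 0. *)
Lemma horner_invn_cvg (q : {poly R}) (e : R) : 0 < e ->
  exists m0, forall m, (m0 <= m)%N -> `|q.[m.+1%:R^-1] - q.[0]| <= e.
Proof.
move=> e0; have cv : q.[m.+1%:R^-1] @[m --> \oo] --> q.[0].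
  by apply: continuous_cvg; [exact: continuous_horner|exact: cvg_harmonic].
by have [m0 _ H] := (cvgrPdistC_le _ _).1 cv _ e0; exists m0.
Qed.

(** The larger step only enlarges [tau], which narrows the strip, so every perturbed sum already
    lies in the unperturbed class. The factor [1 / 2] in [P] compensates the two shifts in each
    cosine. *)
Lemma cos_weights_approximable mu lambda (W : nat -> R) n p : (0 < n)%N ->
  real_strip_poly mu p -> 
  (forall j, (j <= n)%N -> 0 <= W j) -> (forall j, (j < n)%N -> W j <= W j.+1) ->
  approximable (real_strip_poly (Num.sqrt (Num.max (mu ^+ 2 - lambda ^+ 2 / 4) 0)))
    (fun z => \sum_(k < size p) (`|lambda| ^+ k * \sum_(j < n.+1) W j * (j%:R / n%:R) ^+ k)%:C *
       (ccos_coef R k * p^`(k).[z])).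
Proof.
move=> n0 pS W0 WS; have n0R : 0 < n%:R :> R by rewrite ltr0n.
pose eta m : R := m.+1%:R^-1.
have eta0 m : 0 < eta m by rewrite invr_gt0.
pose P m : {poly C} := (2^-1 : R)%:C *: 
  cos_sum (fun k => (W k + eta m) * (1 + eta m) ^+ k) n ((`|lambda| + eta m) / n%:R) p.
exists P.
  move=> m; apply: real_strip_polyZ; first by rewrite invr_eq0 pnatr_eq0.
  have h0 : 0 < (`|lambda| + eta m) / n%:R by rewrite divr_gt0 // ltr_wpDl.
  have := @cos_sum_strip R (fun k => W k + eta m) n (1 + eta m) _ mu p pS n0 h0.
  move=> /(_ _ _ _ _)/(real_strip_poly_le _); apply.
  - rewrite ler_wsqrtr // ge_max !le_max lexx orbT andbT; apply/orP; left; rewrite lerD2l lerN2.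
    rewrite -[X in X / 2]mulr_natr divfK ?gt_eqF // expr_div_n -natrX ler_wpM2r //.
    rewrite -[lambda ^+ 2]real_normK ?num_real // lerXn2r ?nnegrE ?addr_ge0 ?(ltW (eta0 m)) //.
    by rewrite lerDl ltW.
  - by move=> k kn; rewrite addr_ge0 ?W0 // ltW.
  - by move=> k kn; rewrite lerD2r WS.
  - by rewrite ltr_wpDl ?W0.
  - by rewrite ltrDl.
pose q k : {poly R} := (`|lambda|%:P + 'X) ^+ k *
  \sum_(j < n.+1) ((W j)%:P + 'X) * (1 + 'X) ^+ j * ((j%:R / n%:R) ^+ k)%:P.
have qE k x : (q k).[x] = (`|lambda| + x) ^+ k * \sum_(j < n.+1) (W j + x) * (1 + x) ^+ j * (j%:R / n%:R) ^+ k.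
  rewrite /q hornerM horner_exp hornerD hornerC hornerX horner_sum; congr (_ * _).
  by apply: eq_bigr => j _; rewrite !hornerE.
pose a m k := (q k).[eta m]; pose b k := (q k).[0].
have := @loc_unif_coef_sum (size p) a b (fun k z => ccos_coef R k * p^`(k).[z]).
have -> : (fun z => \sum_(k < size p) (b k)%:C * (ccos_coef R k * p^`(k).[z])) =
   (fun z => \sum_(k < size p) (`|lambda| ^+ k * \sum_(j < n.+1) W j * (j%:R / n%:R) ^+ k)%:C *
       (ccos_coef R k * p^`(k).[z])).
  apply/funext => z; apply: eq_bigr => k _; rewrite /b qE addr0.
  by under eq_bigr do rewrite !addr0 expr1n mulr1.
move=> H; apply: loc_unif_eq (H _ _) => [m z|k e e0|k].
- rewrite /P hornerZ cos_sumE mulrA fmorphV /= rmorph_nat mulVf ?pnatr_eq0 // mul1r.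
  apply: eq_bigr => k _; congr (_%:C * _); rewrite /a qE expr_div_n -mulrA; congr (_ * _).
  rewrite mulr_sumr; apply: eq_bigr => j _; rewrite expr_div_n; field.
  by rewrite gt_eqF // exprn_gt0.
- exact: horner_invn_cvg.
- move=> L; have [M M0 HM] := loc_bounded_poly p^`(k) L.
  exists (N (ccos_coef R k) * M); first by rewrite mulr_ge0 ?normc_ge0.
  by move=> z /HM h; rewrite Normc.normcM ler_wpM2l ?normc_ge0.
Qed.

Variable g : R -> R.
Hypothesis g_ge0 : forall t : R, t \in `]0, 1[ -> 0 <= g t.
Hypothesis g_ndecr : forall s t : R, s \in `]0, 1[ -> t \in `]0, 1[ -> s <= t -> g s <= g t.
Hypothesis g_int : lebesgue_measure.-integrable `[0, 1] (EFin \o g).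

Lemma deriv_sum_approximable mu lambda p : real_strip_poly mu p ->
  approximable (real_strip_poly (Num.sqrt (Num.max (mu ^+ 2 - lambda ^+ 2 / 4) 0)))
    (horner (deriv_sum (rep_coef g lambda) (size p) p)).
Proof.
(* Right-endpoint sums: node [j] carries the mass of the cell ending there, and node 0 carries 0,
   which keeps the weights nondecreasing. *)
move=> pS; pose W n j := if j is j'.+1 then weight g n j' else 0.
have Wapp n := @cos_weights_approximable mu lambda (W n.+1) n.+1 p isT pS.
apply: approximable_closed => [n|]; [apply: (Wapp n)|].
- by case=> [|j] jn //=; exact: weight_ge0.
- by case=> [|j] jn /=; [exact: weight_ge0|exact: weight_ndecr].
pose a n k := `|lambda| ^+ k * \sum_(j < n.+2) W n.+1 j * (j%:R / n.+1%:R) ^+ k.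
pose b k := `|lambda| ^+ k * moment g k.
have := @loc_unif_coef_sum (size p) a b (fun k z => ccos_coef R k * p^`(k).[z]).
have -> : (fun z => \sum_(k < size p) (b k)%:C * (ccos_coef R k * p^`(k).[z])) =
   horner (deriv_sum (rep_coef g lambda) (size p) p).
  apply/funext => z; rewrite /deriv_sum horner_sum big_mkord; apply: eq_bigr => k _.
  rewrite hornerZ mulrA; congr (_ * _); rewrite /rep_coef /b mulrC.
  (* Odd coefficients vanish, and even powers do not distinguish [lambda] from [|lambda|]. *)
  have [ok|ek] := boolP (odd k); first by rewrite ccos_coef_odd // !mul0r.
  congr (_ * (_ * _)%:C); rewrite -[X in _ ^+ X](odd_double_half k) (negPf ek) add0n.
  by rewrite -[in RHS](odd_double_half k) (negPf ek) add0n -!muln2 [(_ * 2)%N]mulnC !exprM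
    real_normK ?num_real.
apply=> [k e e0|k]; last first.
  move=> L; have [M M0 HM] := loc_bounded_poly p^`(k) L.
  exists (N (ccos_coef R k) * M); first by rewrite mulr_ge0 ?normc_ge0.
  by move=> z /HM h; rewrite Normc.normcM ler_wpM2l ?normc_ge0.
pose K := `|lambda| ^+ k * (k%:R * abs_mass g).
have K0 : 0 <= K by rewrite !mulr_ge0 ?exprn_ge0 // abs_mass_ge0.
exists (Num.bound (K / e)) => n hn.
rewrite /a /b -mulrBr normrM ger0_norm ?exprn_ge0 // big_ord_recl /= mul0r add0r.
have := moment_approx g_int k (ltn0Sn n).
set d := `|_| => hd; apply: (@le_trans _ _ (`|lambda| ^+ k * (k%:R / n.+1%:R * abs_mass g))).
  by rewrite ler_wpM2l ?exprn_ge0.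
have -> : `|lambda| ^+ k * (k%:R / n.+1%:R * abs_mass g) = K / n.+1%:R.
  by rewrite /K; ring.
rewrite ler_pdivrMr // mulrC -ler_pdivrMr //.
by rewrite (le_trans (ltW (archi_boundP _))) ?divr_ge0 ?(ltW e0) // ler_nat (leq_trans hn).
Qed.

Lemma rep_coef_bound lambda k : N (rep_coef g lambda k) <= abs_mass g * `|lambda| ^+ k / (k`!)%:R.
Proof.
have k0 : 0 < (k`!)%:R :> R by rewrite ltr0n fact_gt0.
have m_le : `|moment g k| <= abs_mass g.
  rewrite -[leRHS]mul1r.
  apply: (normr_integral_mulg g_int _ _ (@measurable_exprn R _ _) (@exprn_unit_le1 R k)) => //.
  by move=> t /= tU; exact: exprn_unit_le1.
have c_le : N (ccos_coef R k) <= (k`!)%:R^-1.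
  rewrite /ccos_coef normc_div normc_nat -[leRHS]mul1r ler_wpM2r ?invr_ge0 ?(ltW k0) //.
  rewrite normc_div normc_nat ler_pdivrMr // mul1r (le_trans (normcD _ _)) //.
  by rewrite !normcX normc_opp normc_i !expr1n.
rewrite /rep_coef Normc.normcM normc_real normrM normrX mulrC.
by rewrite ler_pM ?mulr_ge0 ?exprn_ge0 ?normc_ge0 // mulrC ler_wpM2r ?exprn_ge0.
Qed.

End CosineTransform.

(** * Functions in the closure are limits of real polynomials of the class *)

Section RootSums.
Variable R : realType.
Local Notation C := R[i].
Local Notation N := (@Normc.normc R).
Implicit Types (z w u : C) (p q : {poly C}) (s : seq C) (phi : C -> C) (mu : R).

Definition monic_roots s : {poly C} := \prod_(x <- s) ('X - x%:P).

Lemma monic_rootsE s z : (monic_roots s).[z] = \prod_(x <- s) (z - x).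
Proof. by rewrite horner_prod; apply: eq_bigr => x _; rewrite !hornerE. Qed.

Lemma monic_roots_neq0 s z : z \notin s -> (monic_roots s).[z] != 0.
Proof. by move=> zs; rewrite -rootE root_prod_XsubC. Qed.

Lemma deriv_monic_roots s z : z \notin s ->
  (monic_roots s)^`().[z] = (monic_roots s).[z] * \sum_(x <- s) (z - x)^-1.
Proof.
elim: s => [|x s IH]; first by rewrite /monic_roots !big_nil derivC horner0 mulr0.
rewrite inE negb_or => /andP[zx /IH {}IH].
rewrite /monic_roots !big_cons -/(monic_roots s) derivM derivXsubC mul1r hornerD !hornerM !hornerXsubC IH.
by field; rewrite subr_eq0.
Qed.

(** This is [P'' / P = (P' / P) ^ 2 + (P' / P)']. With the first derivative it expresses the sums of
    [x ^ -1] and [x ^ -2] over the zeros through Taylor coefficients at 0. *)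
Lemma deriv2_monic_roots s z : z \notin s ->
  (monic_roots s)^`()^`().[z] = (monic_roots s).[z] *
    ((\sum_(x <- s) (z - x)^-1) ^+ 2 - \sum_(x <- s) (z - x)^-1 ^+ 2).
Proof.
elim: s => [|x s IH].
  by rewrite /monic_roots !big_nil !derivC horner0 expr0n subr0 mulr0.
rewrite inE negb_or => /andP[zx zs].
rewrite /monic_roots !big_cons -/(monic_roots s) !derivM derivXsubC mul1r derivD derivM derivXsubC.
rewrite mul1r !hornerD !hornerM (IH zs) (deriv_monic_roots zs) !hornerXsubC.
by field; rewrite subr_eq0.
Qed.

Lemma strip_poly_roots mu p : strip_poly mu p -> exists s, 
  [/\ p = lead_coef p *: monic_roots s, lead_coef p != 0 &
      forall x, x \in s -> `|complex.Im x| <= mu].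
Proof.
move=> sp; have [s pE] := closed_field_poly_normal p; exists s.
have l0 : lead_coef p != 0 by rewrite lead_coef_eq0 (strip_poly_neq0 sp).
split=> // x xs; apply: sp; rewrite pE rootZ // root_prod_XsubC //.
Qed.

Lemma strip_poly_monic_roots mu a s : a != 0 -> (forall x, x \in s -> `|complex.Im x| <= mu) ->
  strip_poly mu (a *: monic_roots s).
Proof. by move=> a0 sH z; rewrite rootZ // root_prod_XsubC => /sH. Qed.

Lemma upper_notin mu z s : (forall x, x \in s -> `|complex.Im x| <= mu) -> mu < complex.Im z ->
  z \notin s.
Proof.
move=> sH zmu; apply/negP => /sH; apply/negP; rewrite -ltNge (lt_le_trans zmu) //.
exact: ler_norm.
Qed.

(** At height at least 1 above the strip each [- Im (z - x) ^ -1] is at least [|z - x| ^ -2]; all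
    terms having one sign, nothing cancels in the sum. *)
Lemma root_sum_bound mu z s : (forall x, x \in s -> `|complex.Im x| <= mu) -> 
  mu + 1 <= complex.Im z ->
  \sum_(x <- s) (N (z - x)) ^- 2 <= N (\sum_(x <- s) (z - x)^-1).
Proof.
move=> sH zmu; apply: le_trans (normc_Im _); rewrite -normrN; apply: le_trans (ler_norm _).
rewrite (big_morph (@complex.Im R) (id1 := 0) (op1 := +%R)) //; last by case=> [? ?] [? ?].
rewrite -sumrN big_seq [leRHS]big_seq; apply: ler_sum => x /sH xmu.
have n0 : 0 < N (z - x).
  rewrite normc_gt0 subr_eq0; apply: contraL xmu => /eqP <-; rewrite -ltNge.
  by rewrite (lt_le_trans _ (ler_norm _)) // (lt_le_trans _ zmu) // ltrDl.
have -> : - complex.Im (z - x)^-1 = complex.Im (z - x) / N (z - x) ^+ 2.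
  rewrite sqr_normcE; case: (z - x) => a b /=. by rewrite opprK.
rewrite -[leLHS]mul1r ler_wpM2r ?invr_ge0 ?exprn_ge0 ?(ltW n0) //.
have -> : complex.Im (z - x) = complex.Im z - complex.Im x by case: (z) (x) => [? ?] [? ?].
have := ler_norm (complex.Im x); lra.
Qed.

(** The raised point is farther from every zero; this will show that a function of the closure, if
    not identically 0, is nonzero at some point of height at least [mu + 1]. *)
Lemma base_point_le mu p (x y : R) : strip_poly mu p -> 0 <= mu ->
  N p.[x +i* y] <= N p.[x +i* (`|y| + 2 * mu + 1)].
Proof.
move=> sp mu0; have [s [-> _ sH]] := strip_poly_roots sp.
rewrite !hornerZ !Normc.normcM ler_wpM2l ?normc_ge0 // !monic_rootsE !normc_prod.
rewrite big_seq [leRHS]big_seq; apply: ler_prod => -[a b] /sH /= bmu.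
rewrite normc_ge0 /= -(@ler_pXn2r _ 2) ?nnegrE ?normc_ge0 // !sqr_normcE /=.
rewrite lerD2l -[leLHS]real_normK ?num_real // lerXn2r ?nnegrE //.
  have := ler_norm b; have := normr_ge0 y; lra.
have := ler_normB y b; have := ler_norm b; lra.
Qed.

(** [c] is half of [|phi z0|]: an approximant within [c] of [phi] has [|p z0| >= c] and, by the
    Cauchy estimate on the unit circle, [|p' z0| <= M + c]. The bounds on the zeros are thus the
    same for all close approximants. *)
Lemma near_log_deriv_bound mu phi z0 : loc_bounded phi -> phi z0 != 0 -> 
  mu + 1 <= complex.Im z0 ->
  exists B c e0, [/\ 0 <= B, 0 < c, 0 < e0 &
    forall p, strip_poly mu p -> (forall z, N z <= N z0 + 1 -> N (p.[z] - phi z) <= e0) ->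
      c <= N p.[z0] /\ forall a s, p = a *: monic_roots s -> 
        [/\ a != 0, (forall x, x \in s -> `|complex.Im x| <= mu),
            N (\sum_(x <- s) (z0 - x)^-1) <= B & \sum_(x <- s) (N (z0 - x)) ^- 2 <= B]].
Proof.
move=> bphi nz zmu; have [M M0 HM] := bphi (N z0 + 1).
have c0 : 0 < N (phi z0) by rewrite normc_gt0.
pose c := N (phi z0) / 2; have cc : 0 < c by exact: divr2_gt0.
exists ((M + c) / c), c, c; split => //; first by rewrite divr_ge0 ?addr_ge0 // ltW.
move=> p sp near.
have pz0 : c <= N p.[z0].
  have h : N (p.[z0] - phi z0) <= c by apply: near; rewrite lerDl.
  have := normc_sub_ge (phi z0) p.[z0]; rewrite normc_dist.
  rewrite (_ : N (phi z0) = c + c); [lra|exact: splitr].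
split=> // a s pE.
have a0 : a != 0.
  by apply: contra (strip_poly_neq0 sp) => /eqP a0; rewrite pE a0 scale0r.
have sH x : x \in s -> `|complex.Im x| <= mu.
  by move=> xs; apply: sp; rewrite pE rootZ // root_prod_XsubC.
have zs : z0 \notin s by apply: (upper_notin sH); apply: lt_le_trans zmu; rewrite ltrDl.
have hB : N (\sum_(x <- s) (z0 - x)^-1) <= (M + c) / c.
  have -> : \sum_(x <- s) (z0 - x)^-1 = p^`().[z0] / p.[z0].
    rewrite pE derivZ !hornerZ deriv_monic_roots //.
    by field; rewrite a0 monic_roots_neq0.
  rewrite normc_div ler_pM ?invr_ge0 ?normc_ge0 //; last first.
    by rewrite lef_pV2 ?posrE // (lt_le_trans cc).
  have := @cauchy_estimate _ p z0 1 (M + c) 1 ler01.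
  rewrite nderivn1 expr1 mulr1; apply=> w wz.
  have wL : N w <= N z0 + 1 by rewrite -(subrK z0 w) (le_trans (normcD _ _)) // wz addrC.
  by rewrite -(subrK (phi w) p.[w]) (le_trans (normcD _ _)) // addrC lerD ?HM ?near.
by split=> //; apply: le_trans hB; exact: root_sum_bound sH zmu.
Qed.

(** Write [1 / (1 - u) = 1 + v] and use [|1 + v| ^ 2 <= exp (2 Re v + |v| ^ 2)]. The first-order
    term is kept as [Re u], not [|u|], since over all zeros it is the sum of the [u], not that of
    their moduli, that is bounded. *)
Lemma inv_one_sub_le u (k : R) : 0 < k -> k <= N (1 - u) ->
  (N (1 - u))^-1 <= expR (complex.Re u + (k^-1 + k ^- 2) * N u ^+ 2).
Proof.
move=> k0 ku; have n0 : 0 < N (1 - u) := lt_le_trans k0 ku.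
have u1 : 1 - u != 0 by rewrite -normc_gt0.
pose v := u / (1 - u).
have vE : v = u + u ^+ 2 / (1 - u) by rewrite /v; field.
have oneE : (1 - u)^-1 = 1 + v by rewrite /v; field.
have nv : N v ^+ 2 <= k ^- 2 * N u ^+ 2.
  rewrite /v normc_div expr_div_n mulrC ler_wpM2r ?exprn_ge0 ?normc_ge0 //.
  by rewrite lef_pV2 ?posrE ?exprn_gt0 // lerXn2r ?nnegrE ?(ltW k0) ?normc_ge0.
have rev : complex.Re v <= complex.Re u + k^-1 * N u ^+ 2.
  have -> : complex.Re v = complex.Re u + complex.Re (u ^+ 2 / (1 - u)).
    by rewrite {1}vE; case: (u) (u ^+ 2 / (1 - u)) => [? ?] [? ?].
  rewrite lerD2l (le_trans (ler_norm _)) // (le_trans (normc_Re _)) //.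
  by rewrite normc_div normcX mulrC ler_wpM2r ?exprn_ge0 ?normc_ge0 // lef_pV2 ?posrE.
rewrite -Normc.normcV oneE -(@ler_pXn2r _ 2) ?nnegrE ?normc_ge0 ?expR_ge0 //.
have -> : N (1 + v) ^+ 2 = 1 + (2 * complex.Re v + N v ^+ 2).
  by rewrite !sqr_normcE; case: (v) => a b /=; ring.
rewrite (le_trans (expR_ge1Dx _)) // -expRM_natl ler_expR.
have : 0 <= k ^- 2 * N u ^+ 2 by rewrite mulr_ge0 ?invr_ge0 ?exprn_ge0 ?normc_ge0 // ltW.
by lra.
Qed.

(** Each ratio [(w - x) / (z0 - x)] is [1 - u] with [u = d / (z0 - x)], and [k] bounds its modulus
    from below by the triangle inequality. Given bounds on the two sums, the value at [w] cannot be
    small compared with the value at [z0] unless a zero is within [e] of [w]. *)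
Lemma monic_roots_lower s z0 w (d : C) (e k : R) : d = z0 - w -> k = e / (e + N d) -> 0 < e -> z0 \notin s -> 
  (forall x, x \in s -> e <= N (w - x)) ->
  N (monic_roots s).[z0] <= N (monic_roots s).[w] *
    expR (N d * N (\sum_(x <- s) (z0 - x)^-1) + 
          (k^-1 + k ^- 2) * N d ^+ 2 * \sum_(x <- s) (N (z0 - x)) ^- 2).
Proof.
move=> dE kE e0 zs sw.
have k0 : 0 < k by rewrite kE divr_gt0 // ltr_wpDr ?normc_ge0.
have main : N (monic_roots s).[z0] <= N (monic_roots s).[w] *
    expR (complex.Re (d * \sum_(x <- s) (z0 - x)^-1) + 
          (k^-1 + k ^- 2) * N d ^+ 2 * \sum_(x <- s) (N (z0 - x)) ^- 2).
  elim: s zs sw => [_ _|x s IH].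
    by rewrite /monic_roots !big_nil !hornerC !Normc.normc1 !mulr0 addr0 /= expR0 mul1r.
  rewrite inE negb_or => /andP[zx zs] sw.
  have {}IH : _ := IH zs (fun y (ys : y \in s) => sw y (@mem_behead _ (x :: s) y ys)).
  rewrite !monic_rootsE !big_cons -!monic_rootsE !Normc.normcM.
  have n0 : 0 < N (z0 - x) by rewrite normc_gt0 subr_eq0.
  have xw : e <= N (w - x) by apply: sw; exact: mem_head.
  have wx0 : 0 < N (w - x) := lt_le_trans e0 xw.
  pose u := d / (z0 - x).
  have uE : 1 - u = (w - x) / (z0 - x) by rewrite /u dE; field; rewrite -normc_gt0.
  have ku : k <= N (1 - u).
    rewrite uE normc_div kE ler_pdivrMr ?ltr_wpDr ?normc_ge0 // mulrAC ler_pdivlMr //.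
    have : N (z0 - x) <= N d + N (w - x) by rewrite dE normc_dist_trans.
    have := normc_ge0 d; nra.
  have h := inv_one_sub_le k0 ku.
  have hu : N (z0 - x) <= N (w - x) * expR (complex.Re u + (k^-1 + k ^- 2) * N u ^+ 2).
    rewrite mulrC -ler_pdivrMr //; apply: le_trans h.
    by rewrite uE normc_div invf_div.
  have -> : expR (complex.Re (d * ((z0 - x)^-1 + \sum_(j <- s) (z0 - j)^-1)) +
      (k^-1 + k ^- 2) * N d ^+ 2 * ((N (z0 - x)) ^- 2 + \sum_(j <- s) (N (z0 - j)) ^- 2)) =
    expR (complex.Re u + (k^-1 + k ^- 2) * N u ^+ 2) *
    expR (complex.Re (d * \sum_(j <- s) (z0 - j)^-1) +
      (k^-1 + k ^- 2) * N d ^+ 2 * \sum_(j <- s) (N (z0 - j)) ^- 2).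
    rewrite -expRD; congr expR.
    have -> : complex.Re (d * ((z0 - x)^-1 + \sum_(j <- s) (z0 - j)^-1)) =
       complex.Re u + complex.Re (d * \sum_(j <- s) (z0 - j)^-1).
      have ReD (a b : C) : complex.Re (a + b) = complex.Re a + complex.Re b by case: a b => [? ?] [? ?].
      by rewrite mulrDr ReD.
    rewrite /u normc_div expr_div_n; ring.
  by rewrite mulrACA ler_pM ?normc_ge0.
apply: le_trans main _; rewrite ler_wpM2l ?normc_ge0 // ler_expR lerD2r.
by rewrite (le_trans (ler_norm _)) // (le_trans (normc_Re _)) // Normc.normcM.
Qed.

End RootSums.

(** * A Hurwitz theorem, and division by the zeros of a limit *)

Section ZeroRemoval.
Variable R : realType.
Local Notation C := R[i].
Local Notation N := (@Normc.normc R).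
Implicit Types (z w u : C) (p q : {poly C}) (s : seq C) (phi psi : C -> C) (mu : R).

(** Away from [x] the linear factor has modulus at least 1. Near [x], the circle of radius 2 about
    [z] stays at distance at least 1 from [x], and the Cauchy estimate of order 0 is the maximum
    principle. *)
Lemma quotient_le q x z M : (forall w, N w <= N z + 2 -> N (('X - x%:P) * q).[w] <= M) ->
  N q.[z] <= M.
Proof.
move=> H; have far w : N w <= N z + 2 -> 1 <= N (w - x) -> N q.[w] <= M.
  move=> wz wx; apply: le_trans (H w wz).
  by rewrite hornerM hornerXsubC Normc.normcM ler_peMl ?normc_ge0.
have [zx|zx] := lerP 1 (N (z - x)); first by apply: far => //; rewrite lerDl.
have := @cauchy_estimate _ q z 2 M 0 (ler0n _ 2).
rewrite nderivn0 expr0 mulr1; apply => w wz; apply: far.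
  by rewrite -(subrK z w) (le_trans (normcD _ _)) // wz addrC.
have := normc_dist_trans x w z; rewrite wz [N (x - z)]normc_dist; lra.
Qed.

Lemma loc_unif_quotient (Q : nat -> {poly C}) rho psi :
  loc_unif (fun n => horner (('X - rho%:P) * Q n)) psi ->
  exists2 psi1, loc_unif (fun n => horner (Q n)) psi1 & forall z, psi z = (z - rho) * psi1 z.
Proof.
move=> lQ; have [psi1 l1] : exists psi1, loc_unif (fun n => horner (Q n)) psi1.
  apply: loc_unif_cauchy_cvg => L e e0.
  have [n0 H] := lQ (L + 2) _ (divr2_gt0 e0); exists n0 => n m hn hm z zL.
  rewrite -hornerN -hornerD; apply: (@quotient_le _ rho) => w wz.
  have wL : N w <= L + 2 by rewrite (le_trans wz) // lerD2r.
  rewrite mulrBr hornerD hornerN (le_trans (normc_dist_trans (psi w) _ _)) //.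
  by rewrite [e]splitr lerD ?H // normc_dist H.
exists psi1 => // z.
have h : loc_unif (fun n => horner (('X - rho%:P) * Q n)) (fun z => (z - rho) * psi1 z).
  have b : loc_bounded (fun z : C => z - rho).
    have := @loc_bounded_poly R ('X - rho%:P); congr loc_bounded.
    by apply/funext => w; rewrite hornerXsubC.
  by apply: loc_unif_eq (loc_unif_cmul b l1) => n w; rewrite hornerM hornerXsubC.
by rewrite (loc_unif_unique lQ h).
Qed.

Lemma approximable_bounded S phi : approximable S phi -> loc_bounded phi.
Proof. by move=> [P _ lP]; apply: loc_unif_bounded lP => n; exact: loc_bounded_poly. Qed.

Lemma approximable_epsP S phi : approximable S phi -> forall L (e : R), 0 < e ->
  exists2 p, S p & forall z, N z <= L -> N (p.[z] - phi z) <= e.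
Proof.
move=> [P SP lP] L e e0; have [n0 H] := lP L e e0.
by exists (P n0) => // z zL; exact: H.
Qed.

(** Hurwitz's theorem: were every zero of a close approximant at distance at least [e] from [rho],
    [monic_roots_lower] would give [c <= |p z0| <= K |p rho|] with [K] independent of [p], while
    [p rho] tends to 0. *)
Lemma near_root mu psi z0 rho : approximable (strip_poly mu) psi ->
  mu + 1 <= complex.Im z0 -> psi z0 != 0 -> psi rho = 0 ->
  forall (L e e1 : R), 0 < e -> 0 < e1 -> exists x q,
    [/\ strip_poly mu (('X - x%:P) * q), N (rho - x) < e &
        forall z, N z <= L -> N ((('X - x%:P) * q).[z] - psi z) <= e1].
Proof.
move=> app zmu nz rz L e e1 e0 e10.
have [B [c [eb [B0 c0 eb0 Hb]]]] := near_log_deriv_bound (approximable_bounded app) nz zmu.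
pose d := z0 - rho; pose k := e / (e + N d).
pose K := expR (N d * B + (k^-1 + k ^- 2) * N d ^+ 2 * B).
have K0 : 0 < K := expR_gt0 _.
pose e2 := Num.min (Num.min e1 eb) (c / (2 * K)).
have e20 : 0 < e2 by rewrite !lt_min e10 eb0 divr_gt0 // mulr_gt0.
have [e21 e2b e2K] : [/\ e2 <= e1, e2 <= eb & e2 <= c / (2 * K)].
  by split; rewrite !ge_min lexx ?orbT.
pose L' := Num.max (Num.max L (N z0 + 1)) (N rho).
have [p sp near] := approximable_epsP app L' e20.
have near1 z : N z <= L -> N (p.[z] - psi z) <= e1.
  by move=> zL; apply: le_trans e21; apply: near; rewrite !le_max zL.
have near2 z : N z <= N z0 + 1 -> N (p.[z] - psi z) <= eb.
  by move=> zL; apply: le_trans e2b; apply: near; rewrite !le_max zL orbT.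
have near3 : N p.[rho] <= c / (2 * K).
  have -> : p.[rho] = p.[rho] - psi rho by rewrite rz subr0.
  by rewrite (le_trans _ e2K) // near // !le_max lexx orbT.
have [pz0 Hs] := Hb p sp near2.
have [s [pE l0 sH]] := strip_poly_roots sp.
have [a0 _ S1 S2] := Hs _ _ pE.
have [/hasP[x xs rx]|/hasPn far] := boolP (has (fun x => N (rho - x) < e) s).
  have rpx : root p x by rewrite pE rootZ // root_prod_XsubC.
  have /factor_theorem[q pq] := rpx.
  by exists x, q; rewrite mulrC -pq.
exfalso.
have zs : z0 \notin s by apply: (upper_notin sH); apply: lt_le_trans zmu; rewrite ltrDl.
have k0 : 0 < k by rewrite divr_gt0 // ltr_wpDr ?normc_ge0.
have far' x : x \in s -> e <= N (rho - x) by move=> /far; rewrite -leNgt.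
have := @monic_roots_lower R s z0 rho d e k erefl erefl e0 zs far'.
set X := expR _ => low.
have XK : X <= K.
  rewrite ler_expR lerD ?ler_wpM2l ?normc_ge0 ?mulr_ge0 ?addr_ge0 ?invr_ge0 ?exprn_ge0 ?normc_ge0 //.
  - exact: ltW.
  - exact: ltW.
have : N p.[z0] <= N p.[rho] * K.
  rewrite pE !hornerZ !Normc.normcM -mulrA ler_wpM2l ?normc_ge0 //.
  by apply: le_trans low _; rewrite ler_wpM2l ?normc_ge0.
move=> h; have := le_trans pz0 (le_trans h (ler_wpM2r (ltW K0) near3)).
have -> : c / (2 * K) * K = c / 2 by field; rewrite gt_eqF.
lra.
Qed.

(** An approximant has a zero [x] near [rho]; replacing [x] by [rho] changes it by [(x - rho) q],
    small since [q] is bounded through [quotient_le]. After this all approximants share the factor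
    [X - rho] and can be divided by it. *)
Lemma zero_removal mu psi z0 rho : approximable (strip_poly mu) psi ->
  mu + 1 <= complex.Im z0 -> psi z0 != 0 -> psi rho = 0 ->
  `|complex.Im rho| <= mu /\ exists2 psi1, approximable (strip_poly mu) psi1 &
    forall z, psi z = (z - rho) * psi1 z.
Proof.
move=> app zmu nz rz; have nr := near_root app zmu nz rz; split.
  apply/ler_addgt0Pr => e e0; have [x [q [sp xr _]]] := nr 0 e 1 e0 ltr01.
  have : `|complex.Im x| <= mu by apply: sp; rewrite rootM root_XsubC eqxx.
  have := normc_Im (rho - x).
  have -> : complex.Im (rho - x) = complex.Im rho - complex.Im x by case: (rho) (x) => [? ?] [? ?].
  have := ler_normD (complex.Im rho - complex.Im x) (complex.Im x); rewrite subrK; lra.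
pose S' : set {poly C} := [set p | exists2 q, strip_poly mu q & p = ('X - rho%:P) * q].
have [P SP lP] : approximable S' psi.
  apply: approximable_eps => L e e0; have [M M0 HM] := approximable_bounded app (L + 2).
  have M10 : 0 < M + 1 by rewrite ltr_wpDl.
  pose e1 := Num.min 1 (e / 2); have e10 : 0 < e1 by rewrite lt_min ltr01 divr2_gt0.
  pose e2 := e / 2 / (M + 1); have e20 : 0 < e2 by rewrite divr_gt0 // divr2_gt0.
  have [x [q [sp xr near]]] := nr (L + 2) e2 e1 e20 e10.
  exists (('X - rho%:P) * q).
    exists q => // z qz; apply: sp; by rewrite rootM qz orbT.
  move=> z zL; have qM : N q.[z] <= M + 1.
    apply: (@quotient_le _ x) => w wz; have wL : N w <= L + 2 by rewrite (le_trans wz) // lerD2r.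
    rewrite -(subrK (psi w) _.[w]) (le_trans (normcD _ _)) // addrC lerD ?HM //.
    by rewrite (le_trans (near w wL)) // ge_min lexx.
  have -> : (('X - rho%:P) * q).[z] - psi z = ((('X - x%:P) * q).[z] - psi z) + (x - rho) * q.[z].
    by rewrite !hornerM !hornerXsubC; ring.
  rewrite (le_trans (normcD _ _)) // [e]splitr lerD //.
    by rewrite (le_trans (near z _)) ?ge_min ?lexx ?orbT // (le_trans zL) // lerDl.
  rewrite Normc.normcM normc_dist -[e / 2](divfK (lt0r_neq0 M10)).
  by rewrite ler_pM ?normc_ge0 // ltW.
have /choice[Q HQ] : forall n, exists q, strip_poly mu q /\ P n = ('X - rho%:P) * q.
  by move=> n; have [q sq ->] := SP n; exists q.
have [|psi1 l1 E] := @loc_unif_quotient Q rho psi.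
  by apply: loc_unif_eq lP => n z; rewrite (HQ n).2.
by exists psi1 => //; exists Q => // n; case: (HQ n).
Qed.

Lemma Re_Im_sub z w : complex.Re (z - w) = complex.Re z - complex.Re w /\
  complex.Im (z - w) = complex.Im z - complex.Im w.
Proof. by case: z w => [? ?] [? ?]. Qed.

Lemma loc_unif_derive1_real P phi : loc_unif (fun n => horner (P n)) phi ->
  real_on_reals (phi : C^o -> C^o) -> real_on_reals ((phi : C^o -> C^o)^`()%classic).
Proof.
move=> lP rphi x; set psi := _^`()%classic.
have bphi : loc_bounded phi by apply: loc_unif_bounded lP => n; exact: loc_bounded_poly.
have [M M0 HM] := bphi (N x%:C + 1).
apply/eqP; rewrite -normr_eq0 eq_le normr_ge0 andbT; apply/ler_addgt0Pr => e e0; rewrite add0r.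
pose h := Num.min (1 / 2) (e / (2 * M + 1)).
have M10 : 0 < 2 * M + 1 by rewrite ltr_wpDl // mulr_ge0.
have h0 : 0 < h by rewrite lt_min !divr_gt0.
have h2 : h <= 1 / 2 by rewrite ge_min lexx.
have he : h * (2 * M + 1) <= e by rewrite -ler_pdivlMr // ge_min lexx orbT.
have Nh : N h%:C = h by rewrite normc_real ger0_norm // ltW.
have := @loc_unif_taylor _ _ _ x%:C 1 M 2 h%:C lP ltr01.
rewrite Nh divr1 big_nat_recr //= big_nat1 expr0 mulr1 expr1 !divr1 -[derive1n 0 _ _]/(phi x%:C) -/psi => H.
have near w : N (w - x%:C) = 1 -> N (phi w) <= M.
  by move=> wz; apply: HM; rewrite -(subrK x%:C w) (le_trans (normcD _ _)) // wz addrC.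
move: (le_trans (normc_Im _) (H near h2)).
rewrite (Re_Im_sub _ _).2 -rmorphD rphi sub0r normrN.
have -> : complex.Im (phi x%:C + psi x%:C * h%:C) = complex.Im (psi x%:C * h%:C).
  by have := rphi x; case: (phi x%:C) (psi x%:C * h%:C) => [? a] [? ?] /= ->; exact: add0r.
have -> : complex.Im (psi x%:C * h%:C) = complex.Im (psi x%:C) * h.
  by case: (psi x%:C) => a b /=; ring.
rewrite normrM (gtr0_norm h0) expr2 mulrA ler_pM2r // => h1.
apply: le_trans h1 _; apply: le_trans he; rewrite [leRHS]mulrC ler_pM2r //.
by rewrite lerDl.
Qed.

Lemma loc_unif_derive1n_real P phi k : loc_unif (fun n => horner (P n)) phi ->
  real_on_reals (phi : C^o -> C^o) -> real_on_reals (derive1n k (phi : C^o -> C^o)).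
Proof.
move=> lP rphi; elim: k => [//|k IH].
exact: loc_unif_derive1_real (loc_unif_derive1n k lP) IH.
Qed.

Lemma real_conj z : complex.Im z = 0 -> z^* = z.
Proof. by case: z => a b /= ->; rewrite oppr0. Qed.

(** Taylor polynomials at 0 have real coefficients, hence commute with conjugation, and they
    converge to [phi] at both points. *)
Lemma loc_unif_real_conj P phi z : loc_unif (fun n => horner (P n)) phi ->
  real_on_reals (phi : C^o -> C^o) -> phi z^* = (phi z)^*.
Proof.
move=> lP rphi; have bphi : loc_bounded phi.
  by apply: loc_unif_bounded lP => n; exact: loc_bounded_poly.
pose r := 2 * N z + 1; have r0 : 0 < r by rewrite ltr_wpDl // mulr_ge0 ?normc_ge0.
have [M M0 HM] := bphi r.
have zr : N z <= r / 2 by rewrite /r; lra.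
have zr2 : 0 <= N z / r <= 1 / 2.
  by rewrite divr_ge0 ?normc_ge0 ?(ltW r0) //= ler_pdivrMr // div1r mulrC.
pose T m w := \sum_(0 <= i < m) derive1n i (phi : C^o -> C^o) 0 / (i`!)%:R * w ^+ i.
have HT m w : N w = N z -> N (phi w - T m w) <= 2 * M * (1 / 2) ^+ m.
  move=> wz; have := @loc_unif_taylor _ _ _ 0 r M m w lP r0.
  rewrite add0r wz => /(_ _ zr) H; apply: le_trans (H _) _.
    by move=> v; rewrite subr0 => vr; apply: HM; rewrite vr.
  by case/andP: zr2 => ? ?; rewrite ler_wpM2l ?mulr_ge0 // lerXn2r ?nnegrE.
have Tc m : T m z^* = (T m z)^*.
  rewrite /T rmorph_sum /=; apply: eq_bigr => i _; rewrite !rmorphM rmorphXn /=; congr (_ * _).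
  rewrite rmorphV ?unitfE ?pnatr_eq0 -?lt0n ?fact_gt0 // rmorph_nat; congr (_ / _).
  by rewrite real_conj //; exact: (loc_unif_derive1n_real i lP rphi 0).
apply/eqP; rewrite -subr_eq0 -normc_eq0 eq_le normc_ge0 andbT.
apply/ler_addgt0Pr => e e0; rewrite add0r.
have [m0 Hm] := @geo_le_eps R (4 * M) e e0.
apply: le_trans (Hm m0 (leqnn _)); apply: le_trans (normc_dist_trans (T m0 z^*) _ _) _.
have h1 := HT m0 z^* (normc_conj z); have h2 := HT m0 z erefl.
have h3 : N (T m0 z^* - (phi z)^*) = N (phi z - T m0 z).
  by rewrite Tc -rmorphB normc_conj normc_dist.
have -> : 4 * M * (1 / 2) ^+ m0 = 2 * M * (1 / 2) ^+ m0 + 2 * M * (1 / 2) ^+ m0 by ring.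
by rewrite lerD // h3.
Qed.

Lemma loc_unif_lipschitz P phi z : loc_unif (fun n => horner (P n)) phi ->
  exists2 M, 0 <= M & forall h, N h <= 1 / 2 -> N (phi (z + h) - phi z) <= M * N h.
Proof.
move=> lP; have bphi : loc_bounded phi.
  by apply: loc_unif_bounded lP => n; exact: loc_bounded_poly.
have [M M0 HM] := bphi (N z + 1); exists (2 * M); first by rewrite mulr_ge0.
move=> h h2; have := @loc_unif_taylor _ _ _ z 1 M 1 h lP ltr01.
rewrite big_nat1 expr0 mulr1 divr1 [derive1n 0 _ _]/= divr1 expr1; apply=> // w wz.
by apply: HM; rewrite -(subrK z w) (le_trans (normcD _ _)) // wz addrC.
Qed.

Lemma real_poly_roots s : map (@conjc R) s = s -> real_poly (monic_roots s).
Proof.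
move=> sc; rewrite /real_poly /monic_roots rmorph_prod /=.
rewrite -{2}sc big_map; apply: eq_bigr => x _.
by rewrite rmorphB /= map_polyX map_polyC.
Qed.

(** A real zero is divided out alone, the quotient being real off [rho] and at [rho] by continuity.
    A nonreal zero goes with its conjugate: on the real axis the two factors multiply to
    [|x - rho| ^ 2 > 0], so the quotient stays real. *)
Lemma real_zero_removal mu psi z0 rho : approximable (strip_poly mu) psi ->
  real_on_reals (psi : C^o -> C^o) ->
  mu + 1 <= complex.Im z0 -> psi z0 != 0 -> psi rho = 0 ->
  exists s psi1, [/\ s != [::] /\ real_poly (monic_roots s),
     forall x, x \in s -> `|complex.Im x| <= mu /\ N x = N rho,
     approximable (strip_poly mu) psi1, real_on_reals (psi1 : C^o -> C^o) &
     forall z, psi z = (monic_roots s).[z] * psi1 z].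
Proof.
move=> app rpsi zmu nz rz.
have [rmu [psi1 app1 E1]] := zero_removal app zmu nz rz.
have [P _ lP] := app; have [P1 _ lP1] := app1.
have [r0|r0] := eqVneq (complex.Im rho) 0.
  have rE : rho = (complex.Re rho)%:C by case: (rho) r0 => a b /= ->.
  exists [:: rho], psi1; split=> //.
  - by split=> //; apply: real_poly_roots; rewrite /= real_conj.
  - by move=> x; rewrite inE => /eqP ->.
  - have off (x : R) : x != complex.Re rho -> complex.Im (psi1 x%:C) = 0.
      move=> xr; have := rpsi x; rewrite E1 {1}rE -rmorphB.
      case: (psi1 x%:C) => a b /=; rewrite mul0r addr0 => /eqP.
      by rewrite mulf_eq0 subr_eq0 (negPf xr) => /eqP.
    move=> x; have [xr|/off //] := eqVneq x (complex.Re rho).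
    have [M M0 HM] := loc_unif_lipschitz x%:C lP1.
    apply/eqP; rewrite -normr_eq0 eq_le normr_ge0 andbT; apply/ler_addgt0Pr => e e0; rewrite add0r.
    pose h := Num.min (1 / 2) (e / (M + 1)).
    have M10 : 0 < M + 1 by rewrite ltr_wpDl.
    have h0 : 0 < h by rewrite lt_min !divr_gt0.
    have h2 : h <= 1 / 2 by rewrite ge_min lexx.
    have he : h * (M + 1) <= e by rewrite -ler_pdivlMr // ge_min lexx orbT.
    have Nh : N h%:C = h by rewrite normc_real ger0_norm // ltW.
    have := HM h%:C; rewrite Nh => /(_ h2) /(le_trans (normc_Im _)).
    have oxh : complex.Im (psi1 (x%:C + h%:C)) = 0.
      by rewrite -rmorphD; apply: off; rewrite -xr -subr_eq0 addrAC subrr add0r gt_eqF.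
    rewrite (Re_Im_sub _ _).2 oxh sub0r normrN => h3.
    by apply: le_trans h3 _; apply: le_trans he; rewrite mulrC ler_pM2l // lerDl.
  - by move=> z; rewrite monic_rootsE big_seq1.
have rc : rho^* != rho.
  apply/eqP => /(congr1 (@complex.Im R)); case: (rho) r0 => a b /= b0 h.
  by move/eqP: b0; apply; lra.
have p1c : psi1 rho^* = 0.
  have := E1 rho^*; rewrite (loc_unif_real_conj _ lP rpsi) rz rmorph0 => /esym/eqP.
  by rewrite mulf_eq0 subr_eq0 (negPf rc) => /eqP.
have nz1 : psi1 z0 != 0 by apply: contra nz => /eqP h; rewrite E1 h mulr0.
have [rmu' [psi2 app2 E2]] := zero_removal app1 zmu nz1 p1c.
exists [:: rho; rho^*], psi2; split=> //.
- split=> //; by rewrite /real_poly /monic_roots rmorph_prod /= !big_cons !big_nil !mulr1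
    !rmorphB /= !map_polyX !map_polyC /= conjcK mulrC.
- by move=> x; rewrite !inE => /orP[/eqP ->|/eqP ->]; rewrite ?normc_conj.
- move=> x; have := rpsi x; rewrite E1 E2 mulrA.
  have -> : (x%:C - rho) * (x%:C - rho^*) = (N (x%:C - rho) ^+ 2)%:C.
    rewrite sqr_normcE; case: (rho) => a b; apply/eqP; rewrite eq_complex /=.
    by apply/andP; split; apply/eqP; ring.
  have d0 : N (x%:C - rho) != 0.
    by rewrite normc_eq0 subr_eq0; apply: contra r0 => /eqP <-.
  case: (psi2 x%:C) => a b /=; rewrite mul0r addr0 => /eqP.
  by rewrite mulf_eq0 expf_eq0 /= (negPf d0) => /eqP.
- by move=> z; rewrite E1 E2 monic_rootsE !big_cons big_nil mulr1 mulrA.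
Qed.

End ZeroRemoval.

(** * Finiteness of the zeros in a square, and canonical factors for the far zeros *)

Section Factorization.
Variable R : realType.
Local Notation C := R[i].
Local Notation N := (@Normc.normc R).
Implicit Types (z w u : C) (p q : {poly C}) (s : seq C) (phi psi : C -> C) (mu : R).

Definition in_square (K : R) z := `|complex.Re z| <= K /\ `|complex.Im z| <= K.

Lemma in_square_norm K z : in_square K z -> N z <= 2 * K.
Proof. by move=> [h1 h2]; apply: le_trans (normc_le_ReIm z) _; lra. Qed.

Lemma norm_in_square K z : N z <= K -> in_square K z.
Proof. by move=> zK; split; apply: le_trans zK; rewrite ?normc_Re ?normc_Im. Qed.

Lemma square_lower_bound P psi K : loc_unif (fun n => horner (P n)) psi ->
  (forall z, in_square K z -> psi z != 0) ->
  exists2 c, 0 < c & forall z, in_square K z -> c <= N (psi z).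
Proof.
move=> lP nz; pose h (z : C^o) : R := (N (psi z))^-1.
have ch z : in_square K z -> {for z, continuous h}.
  move=> zK; have p0 : N (psi z) != 0 by rewrite normc_eq0 nz.
  suff cN : (fun w : C^o => N (psi w)) @ nbhs (z : C^o) --> N (psi z) by exact: cvgV p0 cN.
  have [M M0 HM] := loc_unif_lipschitz z lP.
  apply/(@cvgrPdist_lt _ _ _ (nbhs (z : C^o)) (nbhs_filter _)) => e e0.
  apply/nbhs_normcP; exists (Num.min (1 / 2) (e / (M + 1))).
    by rewrite lt_min !divr_gt0 // ltr_wpDl.
  move=> w; rewrite lt_min => /andP[h1 h2].
  have M10 : 0 < M + 1 by rewrite ltr_wpDl.
  have := HM (w - z) (ltW h1); rewrite [z + _]addrC subrK => h3.
  apply: le_lt_trans (_ : N (psi w - psi z) < e).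
    by rewrite ler_norml lerNl opprB normc_sub_ge normc_dist normc_sub_ge.
  apply: le_lt_trans h3 _; move: h2; rewrite ltr_pdivlMr // mulrDr mulr1 [_ * M]mulrC.
  by apply: le_lt_trans; rewrite lerDl normc_ge0.
have : compact (h @` [set z : C^o | in_square K z]).
  apply: continuous_compact; last exact: square_compact.
  by apply: continuous_in_subspaceT => z /set_mem; exact: ch.
move=> /compact_bounded[M [_ HM]].
pose M' := `|M| + 1; have M'0 : 0 < M' by rewrite ltr_wpDl.
exists M'^-1; first by rewrite invr_gt0.
move=> z zK; have p0 : 0 < N (psi z) by rewrite normc_gt0 nz.
rewrite -[N _]invrK lef_pV2 ?posrE ?invr_gt0 //.
have MM : M < M' by rewrite (le_lt_trans (ler_norm M)) // ltrDl.
have := HM M' MM (h z) => /= H; apply: le_trans (H _); first exact: ler_norm.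
by exists z.
Qed.

Lemma near_product S psi (Nn : {poly C}) phi : approximable S psi ->
  (forall z, phi z = Nn.[z] * psi z) -> forall (L1 L2 e1 e2 : R), 0 < e1 -> 0 < e2 ->
  exists q, [/\ S q, forall z, N z <= L1 -> N (q.[z] - psi z) <= e1 &
    forall z, N z <= L2 -> N ((Nn * q).[z] - phi z) <= e2].
Proof.
move=> app E L1 L2 e1 e2 e10 e20; have [M M0 HM] := loc_bounded_poly Nn L2.
have M10 : 0 < M + 1 by rewrite ltr_wpDl.
have e0 : 0 < Num.min e1 (e2 / (M + 1)) by rewrite lt_min e10 divr_gt0.
have [q Sq near] := approximable_epsP app (Num.max L1 L2) e0.
exists q; split=> // z zL.
  by rewrite (le_trans (near z _)) ?ge_min ?lexx // le_max zL.
rewrite E hornerM -mulrBr Normc.normcM -[e2](divfK (lt0r_neq0 M10)) [leRHS]mulrC.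
apply: ler_pM; rewrite ?normc_ge0 //; first by rewrite (le_trans (HM z zL)) // lerDl.
by rewrite (le_trans (near z _)) ?ge_min ?lexx ?orbT // le_max zL orbT.
Qed.

Lemma monic_roots_cat s t : monic_roots (s ++ t) = monic_roots s * monic_roots t.
Proof. by rewrite /monic_roots big_cat. Qed.

(** The division stops: every zero found in the square adds at least [T ^ -2] to
    [sum |z0 - x| ^ -2], which [near_log_deriv_bound] bounds by [B]. Supposing that it never stops
    yields more than [B * T ^ 2] factors. *)
Lemma factor_zeros mu phi z0 K : approximable (strip_poly mu) phi ->
  real_on_reals (phi : C^o -> C^o) -> 0 <= K ->
  mu + 1 <= complex.Im z0 -> phi z0 != 0 ->
  exists s psi, [/\ real_poly (monic_roots s), forall x, x \in s -> `|complex.Im x| <= mu,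
     approximable (strip_poly mu) psi, real_on_reals (psi : C^o -> C^o) &
     (forall z, phi z = (monic_roots s).[z] * psi z) /\
     (forall z, in_square K z -> psi z != 0)].
Proof.
move=> app rphi K0 zmu nz; apply: contrapT => none.
have grow m : exists s psi, [/\ (m <= size s)%N /\ real_poly (monic_roots s), 
     forall x, x \in s -> `|complex.Im x| <= mu /\ N x <= 2 * K,
     approximable (strip_poly mu) psi, real_on_reals (psi : C^o -> C^o) &
     (forall z, phi z = (monic_roots s).[z] * psi z)].
  elim: m => [|m [s [psi [[ms rs] sH appp rp E]]]].
    exists [::], phi; split=> //; last by move=> z; rewrite monic_rootsE big_nil mul1r.
    by split=> //; exact: real_poly_roots.
  have [rho [rK rz]] : exists rho, in_square K rho /\ psi rho = 0.
    apply: contrapT => nozero; apply: none; exists s, psi; split=> //.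
      by move=> x /sH[].
    split=> // z zK; apply/eqP => z0'; apply: nozero; by exists z.
  have nzp : psi z0 != 0 by apply: contra nz => /eqP h; rewrite E h mulr0.
  have [t [psi1 [[t0 rt] tH app1 rp1 E1]]] := real_zero_removal appp rp zmu nzp rz.
  exists (s ++ t), psi1; split=> //.
  - split; last by rewrite /real_poly monic_roots_cat rmorphM /= rs rt.
    rewrite size_cat -addn1 leq_add // lt0n size_eq0 //.
  - move=> x; rewrite mem_cat => /orP[/sH //|/tH[h1 h2]]; split=> //.
    by rewrite h2 in_square_norm.
  - by move=> z; rewrite E E1 monic_roots_cat hornerM mulrA.
have [B [c [eb [B0 c0 eb0 Hb]]]] := near_log_deriv_bound (approximable_bounded app) nz zmu.
pose T := N z0 + 2 * K + 1.
have T0 : 0 < T by rewrite ltr_wpDl // addr_ge0 ?normc_ge0 // mulr_ge0.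
pose m := (Num.bound (B * T ^+ 2)).+1.
have [s [psi [[ms rs] sH appp rp E]]] := grow m.
have [q [sq _ near]] := near_product appp E 0 (N z0 + 1) ltr01 eb0.
have [t [qE a0 tH]] := strip_poly_roots sq.
have pE : monic_roots s * q = lead_coef q *: monic_roots (s ++ t).
  by rewrite {1}qE monic_roots_cat scalerAr.
have sp : strip_poly mu (monic_roots s * q).
  rewrite pE; apply: strip_poly_monic_roots => // x.
  by rewrite mem_cat => /orP[/sH[]|/tH].
have [_ /(_ _ _ pE)[_ _ _]] := Hb _ sp near.
rewrite big_cat /= => hB.
have h1 : \sum_(x <- s) (N (z0 - x)) ^- 2 <= B.
  apply: le_trans hB; rewrite lerDl; apply: sumr_ge0 => x _.
  by rewrite invr_ge0 exprn_ge0 ?normc_ge0.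
have zs : z0 \notin s.
  by apply: (@upper_notin _ mu) => [x /sH[]|] //; apply: lt_le_trans zmu; rewrite ltrDl.
have h2 : (size s)%:R * T ^- 2 <= \sum_(x <- s) (N (z0 - x)) ^- 2.
  have -> : (size s)%:R * T ^- 2 = \sum_(x <- s) T ^- 2.
    by rewrite big_const_seq count_predT iter_addr_0 mulr_natl.
  rewrite big_seq [leRHS]big_seq; apply: ler_sum => x xs.
  have n0 : 0 < N (z0 - x).
    by rewrite normc_gt0 subr_eq0; apply: contraNneq zs => ->.
  rewrite lef_pV2 ?posrE ?exprn_gt0 // lerXn2r ?nnegrE ?(ltW T0) ?(ltW n0) //.
  rewrite (le_trans (normcB _ _)) // /T; have [_ h] := sH x xs; lra.
have := le_trans h2 h1; rewrite ler_pdivrMr ?exprn_gt0 // leNgt => /negP; apply.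
apply: lt_le_trans (archi_boundP _) _; first by rewrite mulr_ge0 // exprn_ge0 // ltW.
by rewrite ler_nat (leq_trans (leqnSn _)).
Qed.

(** Canonical factor of genus 2: the cubic error leaves, beside [sum |x| ^ -2], a spare factor
    [1 / |x|], which tends to 0 as the zeros are pushed away. *)
Definition weierstrass_factor u := (1 - u) * cexp (u + u ^+ 2 / 2).

(** [4 * expR 2] comes from [|1 - u| <= 2] times the Taylor remainder of the exponential with
    [r = 2], the 1 from the polynomial part. *)
Definition weierstrass_cst : R := 4 * expR 2 + 1.

Lemma weierstrass_factor_bound u : N u <= 1 / 2 ->
  N (weierstrass_factor u - 1) <= weierstrass_cst * N u ^+ 3.
Proof.
move=> u2; have u0 := normc_ge0 u; pose v := u + u ^+ 2 / 2.
have vu : N v <= 5 / 4 * N u.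
  rewrite (le_trans (normcD _ _)) // normc_div normcX normc_nat; nra.
have v1 : N v <= 2 / 2 by rewrite divff //; lra.
have := @cexp_taylor R v 2 3 (ltr0n _ 2) v1.
rewrite !big_nat_recr //= big_geq // add0r.
rewrite -[0`!]/1%N -[1`!]/1%N -[2`!]/2%N expr0 expr1 !divr1.
set t := cexp v - _ => ht.
have N3 : N v ^+ 3 <= 8 * N u ^+ 3.
  have : N v ^+ 3 <= (2 * N u) ^+ 3 by rewrite lerXn2r ?nnegrE ?normc_ge0 ?mulr_ge0 //; lra.
  by rewrite exprMn; lra.
have {}ht : N t <= 2 * expR 2 * N u ^+ 3.
  apply: le_trans ht _; rewrite ler_wpM2l ?mulr_ge0 ?expR_ge0 // expr_div_n.
  by rewrite ler_pdivrMr ?exprn_gt0 //; lra.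
have -> : weierstrass_factor u - 1 = (1 - u) * t + u ^+ 3 * (- (1 / 2) - 3 / 8 * u - u ^+ 2 / 8).
  by rewrite /weierstrass_factor -/v /t; move: (cexp v) => ev; rewrite /v; field.
rewrite (le_trans (normcD _ _)) // [N ((1 - u) * t)]Normc.normcM [N (u ^+ 3 * _)]Normc.normcM normcX.
have h1 : N (1 - u) <= 2 by rewrite (le_trans (normcB _ _)) // Normc.normc1; lra.
have h2 : N (- (1 / 2) - 3 / 8 * u - u ^+ 2 / 8) <= 1.
  rewrite (le_trans (normcB _ _)) // (le_trans (lerD (normcB _ _) (lexx _))) //.
  rewrite normc_opp !normc_div [N (3 / 8 * u)]Normc.normcM normc_div normcX !normc_nat Normc.normc1; nra.
have u3 : 0 <= N u ^+ 3 by rewrite exprn_ge0.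
have E0 : 0 <= expR 2 :> R := expR_ge0 _.
have h3 : N (1 - u) * N t <= 2 * (2 * expR 2 * N u ^+ 3) by rewrite ler_pM ?normc_ge0.
have h4 : N u ^+ 3 * N (- (1 / 2) - 3 / 8 * u - u ^+ 2 / 8) <= N u ^+ 3 * 1 by rewrite ler_wpM2l.
by rewrite /weierstrass_cst; lra.
Qed.

Lemma prod_near_one (s : seq C) (F : C -> C) :
  N (\prod_(x <- s) F x - 1) <= expR (\sum_(x <- s) N (F x - 1)) - 1.
Proof.
elim: s => [|x s IH]; first by rewrite !big_nil subrr Normc.normc0 expR0 subrr.
rewrite !big_cons expRD; set S := \prod_(j <- s) F j in IH *; set T := expR (\sum_(j <- s) _) in IH *.
have -> : F x * S - 1 = (F x - 1) * (S - 1) + (F x - 1) + (S - 1) by ring.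
apply: le_trans (normcD _ _) _; apply: le_trans (lerD (normcD _ _) (lexx _)) _.
rewrite Normc.normcM; set d := N (F x - 1).
have d0 : 0 <= d := normc_ge0 _.
have hd : 1 + d <= expR d := expR_ge1Dx d.
have T1 : 1 <= T by have := normc_ge0 (S - 1); lra.
have : d * N (S - 1) <= d * (T - 1) by rewrite ler_wpM2l.
have : (1 + d) * T <= expR d * T by rewrite ler_wpM2r // (le_trans ler01).
nra.
Qed.

(** [p z / p 0] is the product of the [1 - z / x], that is the exponential of the two power sums
    times the canonical factors. Zeros beyond [K >= 2 L] give [|z / x| <= 1 / 2] and
    [|z / x| ^ 3 <= L ^ 3 / K * |x| ^ -2]. *)
Lemma far_roots_approx s z (a : C) (K L : R) : 0 < L -> 2 * L <= K -> N z <= L ->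
  (forall x, x \in s -> K <= N x) ->
  N ((a *: monic_roots s).[z] - (a *: monic_roots s).[0] *
       cexp (- (z * \sum_(x <- s) x^-1) - z ^+ 2 / 2 * \sum_(x <- s) x^-1 ^+ 2)) <=
  (expR (weierstrass_cst * L ^+ 3 / K * \sum_(x <- s) (N x) ^- 2) - 1) *
  N ((a *: monic_roots s).[0] *
       cexp (- (z * \sum_(x <- s) x^-1) - z ^+ 2 / 2 * \sum_(x <- s) x^-1 ^+ 2)).
Proof.
move=> L0 LK zL sH; set V := cexp _.
have K0 : 0 < K by lra.
have x0 x : x \in s -> x != 0.
  by move=> /sH; apply: contraTneq => ->; rewrite Normc.normc0 -ltNge.
pose W := \prod_(x <- s) weierstrass_factor (z / x).
have E : (a *: monic_roots s).[z] = (a *: monic_roots s).[0] * V * W.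
  rewrite !hornerZ -!mulrA; congr (_ * _); rewrite !monic_rootsE.
  have -> : W = \prod_(x <- s) (1 - z / x) * \prod_(x <- s) cexp (z / x + (z / x) ^+ 2 / 2).
    by rewrite -big_split.
  rewrite -cexp_sum [\prod_(x <- s) (1 - _) * _]mulrC !mulrA -[_ * V * _]mulrA.
  have -> : V * cexp (\sum_(x <- s) (z / x + (z / x) ^+ 2 / 2)) = 1.
    rewrite -cexpD big_split /= -mulr_sumr -mulr_suml.
    under [X in _ + (_ + X / 2)]eq_bigr do rewrite expr_div_n -exprVn.
    rewrite -mulr_sumr -[RHS]cexp0; congr cexp; ring.
  rewrite mulr1 -big_split /= big_seq [RHS]big_seq; apply: eq_bigr => x /x0 xn.
  by field.
rewrite E; set Y := _ * V; have -> : Y * W - Y = Y * (W - 1) by ring.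
rewrite Normc.normcM [leRHS]mulrC ler_wpM2l ?normc_ge0 //.
apply: le_trans (prod_near_one _ _) _; rewrite lerD2r ler_expR mulr_sumr.
rewrite big_seq [leRHS]big_seq; apply: ler_sum => x xs.
have Nx : 0 < N x by rewrite normc_gt0 x0.
have u2 : N (z / x) <= 1 / 2.
  rewrite normc_div ler_pdivrMr //; have := sH x xs; lra.
apply: le_trans (weierstrass_factor_bound u2) _.
have w0 : 0 <= weierstrass_cst by rewrite addr_ge0 // mulr_ge0 // expR_ge0.
have -> : weierstrass_cst * L ^+ 3 / K * N x ^- 2 = weierstrass_cst * (L ^+ 3 * (K^-1 * N x ^- 2)) by ring.
rewrite ler_wpM2l // normc_div expr_div_n.
have h1 : N z ^+ 3 <= L ^+ 3 by rewrite lerXn2r ?nnegrE ?normc_ge0 // ltW.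
have h2 : (N x ^+ 3)^-1 <= K^-1 * (N x) ^- 2.
  rewrite exprS invfM ler_wpM2r ?invr_ge0 ?exprn_ge0 ?(ltW Nx) //.
  by rewrite lef_pV2 ?posrE // sH.
by rewrite ler_pM ?invr_ge0 ?exprn_ge0 ?normc_ge0.
Qed.

End Factorization.

(** * The zero-free factor is close to a real Gaussian exponential *)

Section RealApproximation.
Variable R : realType.
Local Notation C := R[i].
Local Notation N := (@Normc.normc R).
Implicit Types (z w u : C) (p q : {poly C}) (s : seq C) (phi psi : C -> C) (mu : R).

Lemma loc_unif_comp (u : nat -> C -> C) phi (h : C -> C) : loc_bounded h -> loc_unif u phi ->
  loc_unif (fun n z => u n (h z)) (fun z => phi (h z)).
Proof.
move=> bh lu L e e0; have [M M0 HM] := bh L; have [n0 H] := lu M e e0.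
by exists n0 => n hn z /HM; exact: H.
Qed.

(** Sequences are viewed as constant functions, so that the algebra of locally uniform limits
    applies to them. *)
Definition ccvg (u : nat -> C) (l : C) := loc_unif (fun n _ => u n) (fun=> l).

Lemma ccvgP (u : nat -> C) l : ccvg u l <-> forall e : R, 0 < e -> 
  exists n0, forall n, (n0 <= n)%N -> N (u n - l) <= e.
Proof.
split=> [cu e e0|H L e e0]; last by have [n0 Hn] := H e e0; exists n0 => n hn z _; exact: Hn.
have [n0 Hn] := cu 0 e e0; exists n0 => n hn; apply: (Hn n hn 0).
by rewrite Normc.normc0.
Qed.

Lemma ccvg_mul (u v : nat -> C) l m : ccvg u l -> ccvg v m -> ccvg (fun n => u n * v n) (l * m).
Proof. by move=> cu cv; apply: loc_unif_mul => //; exact: loc_bounded_cst. Qed.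

Lemma ccvg_cst (l : C) : ccvg (fun=> l) l.
Proof. exact: loc_unif_cst. Qed.

Lemma ccvg_inv (u : nat -> C) l : l != 0 -> ccvg u l -> ccvg (fun n => (u n)^-1) l^-1.
Proof.
move=> l0 /ccvgP cu; apply/ccvgP => e e0.
have Nl : 0 < N l by rewrite normc_gt0.
pose e1 := Num.min (N l / 2) (e * N l ^+ 2 / 2).
have e10 : 0 < e1 by rewrite lt_min !divr_gt0 // mulr_gt0 // exprn_gt0.
have [n0 Hn] := cu e1 e10; exists n0 => n /Hn; rewrite le_min => /andP[h1 h2].
have hu : N l / 2 <= N (u n).
  by have := normc_sub_ge l (u n); rewrite normc_dist; move: h1; set t := N (_ - _); lra.
have Nu : 0 < N (u n) by rewrite (lt_le_trans _ hu) // divr_gt0.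
have u0 : u n != 0 by rewrite -normc_gt0.
have -> : (u n)^-1 - l^-1 = (l - u n) / (u n * l) by field; rewrite l0.
rewrite normc_div Normc.normcM ler_pdivrMr ?mulr_gt0 // normc_dist.
apply: le_trans h2 _; rewrite -mulrA ler_pM2l // expr2.
by rewrite mulrAC ler_wpM2r // ltW.
Qed.

Lemma ccvg_cexp (u : nat -> C) l : ccvg u l -> ccvg (fun n => cexp (u n)) (cexp l).
Proof.
move=> /ccvgP cu; have [M M0 HM] := loc_unif_lipschitz l (@loc_unif_cexp R).
apply/ccvgP => e e0; have M10 : 0 < M + 1 by rewrite ltr_wpDl.
have e10 : 0 < Num.min (1 / 2) (e / (M + 1)) by rewrite lt_min !divr_gt0.
have [n0 Hn] := cu _ e10; exists n0 => n /Hn; rewrite le_min => /andP[h1 h2].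
have := HM (u n - l) h1; rewrite [l + _]addrC subrK => h3.
apply: le_trans h3 _; move: h2; rewrite ler_pdivlMr // mulrDr mulr1 [_ * M]mulrC.
by apply: le_trans; rewrite lerDl normc_ge0.
Qed.

Lemma ccvg_normc_le (u v : nat -> C) l m (eta : R) : 0 <= eta -> ccvg u l -> ccvg v m ->
  (forall n, N (u n) <= eta * N (v n)) -> N l <= eta * N m.
Proof.
move=> eta0 /ccvgP cu /ccvgP cv H; apply/ler_addgt0Pr => e e0.
have K0 : 0 < 1 + eta by rewrite ltr_wpDr.
have e10 : 0 < e / (1 + eta) by rewrite divr_gt0.
have [n1 H1] := cu _ e10; have [n2 H2] := cv _ e10; pose n := maxn n1 n2.
have h1 := H1 n (leq_maxl _ _); have h2 := H2 n (leq_maxr _ _).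
have := H n; have := normc_sub_ge l (u n); have := normc_sub_ge (v n) m.
rewrite [N (l - _)]normc_dist => q1 q2 q3.
have : eta * N (v n) <= eta * (N m + e / (1 + eta)) by rewrite ler_wpM2l //; lra.
have : (1 + eta) * (e / (1 + eta)) = e by rewrite mulrC divfK ?gt_eqF.
lra.
Qed.

Lemma ccvg_Re_ge0 (u : nat -> C) l : ccvg u l -> 
  (forall n, 0 <= complex.Re (u n)) -> 0 <= complex.Re l.
Proof.
move=> /ccvgP cu H; apply/ler_addgt0Pr => e e0; have [n0 Hn] := cu _ e0.
have := le_trans (normc_Re _) (Hn n0 (leqnn _)).
rewrite (Re_Im_sub _ _).1 ler_norml => /andP[_]; have := H n0; lra.
Qed.

Lemma expR_sub1_le (x : R) : 0 <= x <= 1 / 2 -> expR x - 1 <= 2 * x.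
Proof.
move=> /andP[x0 x1]; have h : 1 - x <= expR (- x) by rewrite (le_trans _ (expR_ge1Dx _)).
have h1 : (expR (- x))^-1 <= (1 - x)^-1 by rewrite lef_pV2 ?posrE ?expR_gt0 //; lra.
rewrite -expRN opprK in h1.
have : (1 - x)^-1 <= 1 + 2 * x by rewrite invf_ple ?posrE; [|lra|lra]; rewrite -div1r ler_pdivrMr; nra.
lra.
Qed.

(** Once the zeros in the square of size [K] are divided out, the approximants of [psi] have only
    far zeros, and their power sums [S1], [S2] are rational in the derivatives at 0, hence converge
    to real limits [- b] and [a]. The error is relative, so it is unchanged when the divided zeros
    are put back. *)
Lemma exponential_approx mu phi z0 (L eta : R) : 0 <= mu -> 0 < L -> 0 < eta ->
  approximable (strip_poly mu) phi -> real_on_reals (phi : C^o -> C^o) ->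
  mu + 1 <= complex.Im z0 -> phi z0 != 0 ->
  exists s (beta a b : R), [/\ real_poly (monic_roots s), 
    forall x, x \in s -> `|complex.Im x| <= mu, beta != 0, 0 <= a &
    forall z, N z <= L -> 
      let E := (monic_roots s).[z] * (beta%:C * cexp (b%:C * z - z ^+ 2 / 2 * a%:C)) in
      N (phi z - E) <= eta * N E].
Proof.
move=> mu0 L0 eta0 app rphi zmu nz.
have [B [c [eb [B0 c0 eb0 Hb]]]] := near_log_deriv_bound (approximable_bounded app) nz zmu.
pose k := Num.min (1 / 2) (eta / 2).
have k0 : 0 < k by rewrite lt_min !divr_gt0.
have w0 : 0 <= weierstrass_cst R by rewrite addr_ge0 // mulr_ge0 // expR_ge0.
pose A := weierstrass_cst R * L ^+ 3 * (4 * B).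
have A0 : 0 <= A by rewrite !mulr_ge0 // ltW.
(* [2 * L] is for the canonical factors, [N z0] to pass from [|z0 - x|] to [|x|], [2 * mu] for
   [0 <= a], and [A / k] makes the relative error at most [eta]. *)
pose K := 2 * L + N z0 + 2 * mu + 1 + A / k.
have Ak0 : 0 <= A / k by rewrite divr_ge0 // ltW.
have Nz0 := normc_ge0 z0.
have [K0 KL Kz Kmu] : [/\ 0 < K, 2 * L <= K, N z0 <= K & 2 * mu <= K].
  by rewrite /K; split; lra.
have AK : A / K <= k.
  rewrite ler_pdivrMr // mulrC -ler_pdivrMr // /K; lra.
have etaK : expR (A / K) - 1 <= eta.
  apply: le_trans (expR_sub1_le _) _.
    by rewrite divr_ge0 ?(ltW K0) //= (le_trans AK) // ge_min lexx.
  by rewrite mulrC -ler_pdivlMr // (le_trans AK) // ge_min lexx orbT.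
have [s [psi [rs sH appp rp [E nzp]]]] := factor_zeros app rphi (ltW K0) zmu nz.
have [P0 SP0 lP0] := appp.
have [c1 c10 Hc1] := square_lower_bound lP0 nzp.
have lNP : loc_unif (fun n => horner (monic_roots s * P0 n)) phi.
  rewrite (_ : phi = fun z => (monic_roots s).[z] * psi z); last exact/funext.
  apply: loc_unif_eq (loc_unif_cmul (@loc_bounded_poly R (monic_roots s)) lP0) => n z.
  by rewrite hornerM.
(* Approximants within [c1 / 2] of [psi] have no zero in the square, which the disc of radius
   [2 * K] covers. *)
have [n1 Hn1] := lP0 (2 * K) _ (divr2_gt0 c10).
have [n2 Hn2] := lNP (N z0 + 1) _ eb0.
pose P n := P0 (n + maxn n1 n2)%N.
have lP : loc_unif (fun n => horner (P n)) psi by exact: loc_unif_shiftn lP0.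
have mn n : (n1 <= n + maxn n1 n2)%N /\ (n2 <= n + maxn n1 n2)%N.
  by split; apply: leq_trans (leq_addl _ _); rewrite ?leq_maxl ?leq_maxr.
have /choice[t Ht] : forall n, exists t : seq C, 
    [/\ P n = lead_coef (P n) *: monic_roots t, lead_coef (P n) != 0,
      forall x, x \in t -> `|complex.Im x| <= mu, forall x, x \in t -> K <= N x &
      \sum_(x <- t) (N x) ^- 2 <= 4 * B].
  move=> n; have [t [PE a0 tH]] := strip_poly_roots (SP0 (n + maxn n1 n2)%N).
  have pE : monic_roots s * P n = lead_coef (P n) *: monic_roots (s ++ t).
    by rewrite {1}/P {1}PE monic_roots_cat scalerAr.
  have sp : strip_poly mu (monic_roots s * P n).
    rewrite pE; apply: strip_poly_monic_roots => // x.
    by rewrite mem_cat => /orP[/sH|/tH].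
  have tK x : x \in t -> K <= N x.
    move=> xt; rewrite leNgt; apply/negP => xK.
    have sqx : in_square K x by apply: norm_in_square; exact: ltW.
    have xK2 : N x <= 2 * K by lra.
    have := Hn1 _ (mn n).1 x xK2.
    have -> : (P0 (n + maxn n1 n2)%N).[x] = 0.
      by apply/eqP; rewrite -rootE PE rootZ // root_prod_XsubC.
    by rewrite sub0r normc_opp; have := Hc1 x sqx; lra.
  have [_ /(_ _ _ pE)[_ _ _]] := Hb _ sp (Hn2 _ (mn n).2).
  rewrite big_cat /= => hB.
  have {}hB : \sum_(x <- t) (N (z0 - x)) ^- 2 <= B.
    apply: le_trans hB; rewrite lerDr; apply: sumr_ge0 => x _.
    by rewrite invr_ge0 exprn_ge0 ?normc_ge0.
  exists t; split=> //.
  (* As [|x| >= K >= |z0|], [|z0 - x| <= 2 |x|]; this is the origin of the factor 4. *)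
  apply: (@le_trans _ _ (4 * \sum_(x <- t) (N (z0 - x)) ^- 2)); last by rewrite ler_pM2l.
  rewrite mulr_sumr big_seq [leRHS]big_seq; apply: ler_sum => x xt.
  have xK := tK x xt; have zt : z0 \notin t.
    by apply: (@upper_notin _ mu) => //; apply: lt_le_trans zmu; rewrite ltrDl.
  have d0 : 0 < N (z0 - x).
    by rewrite normc_gt0 subr_eq0; apply: contraNneq zt => ->.
  have x0 : 0 < N x := lt_le_trans K0 xK.
  rewrite -[4]invrK -invfM lef_pV2 ?posrE ?mulr_gt0 ?invr_gt0 ?exprn_gt0 //.
  rewrite mulrC ler_pdivrMr // (_ : N x ^+ 2 * 4 = (2 * N x) ^+ 2); last by ring.
  rewrite lerXn2r ?nnegrE ?mulr_ge0 ?normc_ge0 // (le_trans (normcB _ _)) //; lra.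
pose S1 n := \sum_(x <- t n) x^-1; pose S2 n := \sum_(x <- t n) x^-1 ^+ 2.
have t0 n : 0 \notin t n.
  have [_ _ _ tK _] := Ht n; apply/negP => /tK; rewrite Normc.normc0 leNgt K0 //.
have P00 n : (P n).[0] != 0.
  by have [PE a0 _ _ _] := Ht n; rewrite PE hornerZ mulf_neq0 // monic_roots_neq0.
have S1E n : S1 n = - ((P n)^`(1).[0] / (P n).[0]).
  have [PE a0 _ _ _] := Ht n; have m0 := monic_roots_neq0 (t0 n).
  rewrite derivn1 PE derivZ !hornerZ deriv_monic_roots //.
  have -> : \sum_(x <- t n) (0 - x)^-1 = - S1 n.
    by rewrite /S1 -sumrN; apply: eq_bigr => x _; rewrite sub0r invrN.
  by field; rewrite m0 a0.
have S2E n : S2 n = ((P n)^`(1).[0] / (P n).[0]) ^+ 2 - (P n)^`(2).[0] / (P n).[0].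
  have [PE a0 _ _ _] := Ht n; have m0 := monic_roots_neq0 (t0 n).
  rewrite derivn1 -[(P n)^`(2)]/((P n)^`()^`()) PE !derivZ !hornerZ deriv_monic_roots // deriv2_monic_roots //.
  have -> : \sum_(x <- t n) (0 - x)^-1 ^+ 2 = S2 n.
    by apply: eq_bigr => x _; rewrite sub0r invrN sqrrN.
  by field; rewrite m0 a0.
pose d k := derive1n k (psi : C^o -> C^o) 0.
have dE j : d j = (complex.Re (d j))%:C.
  by have := loc_unif_derive1n_real j lP rp 0; rewrite /d; case: (derive1n _ _ _) => x y /= ->.
have cd j : ccvg (fun n => (P n)^`(j).[0]) (d j).
  exact: (loc_unif_at 0 (loc_unif_derive1n j lP)).
pose beta := complex.Re (d 0%N); pose b := complex.Re (d 1%N) / beta.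
pose a := b ^+ 2 - complex.Re (d 2%N) / beta.
have d0E : d 0%N = psi 0 by [].
have psi00 : psi 0 != 0.
  by apply: nzp; apply: norm_in_square; rewrite Normc.normc0 ltW.
have beta0 : beta != 0.
  by apply: contra psi00 => /eqP h; rewrite -d0E dE -/beta h.
have cP0 : ccvg (fun n => (P n).[0]) beta%:C by rewrite -dE; exact: (cd 0%N).
have betaC0 : beta%:C != 0 :> C by rewrite -dE d0E.
have cq j : ccvg (fun n => (P n)^`(j).[0] / (P n).[0]) (complex.Re (d j) / beta)%:C.
  rewrite rmorphM fmorphV /= -dE; apply: ccvg_mul; [exact: cd|exact: ccvg_inv].
have cS1 : ccvg S1 (- b%:C).
  by apply: (loc_unif_eq _ (loc_unif_opp (cq 1%N))) => n _; rewrite S1E.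
have cS2 : ccvg S2 a%:C.
  rewrite /a rmorphB rmorphXn /=.
  apply: (loc_unif_eq _ (loc_unif_add (ccvg_mul (cq 1%N) (cq 1%N)) (loc_unif_opp (cq 2%N)))) => n _.
  by rewrite S2E expr2.
(* [Re (x ^ -2)] has the sign of [(Re x) ^ 2 - (Im x) ^ 2], nonnegative because [|x| >= 2 mu] while
   [|Im x| <= mu]. *)
have a0 : 0 <= a.
  rewrite -[a]/(complex.Re a%:C); apply: (ccvg_Re_ge0 cS2) => n.
  have [_ _ tH tK _] := Ht n.
  rewrite (big_morph (@complex.Re R) (id1 := 0) (op1 := +%R)) //; last by case=> [? ?] [? ?].
  rewrite big_seq; apply: sumr_ge0 => x xt; have := tK x xt; have := tH x xt.
  case: x {xt} => x y /= ymu xK.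
  have h1 : (2 * mu) ^+ 2 <= x ^+ 2 + y ^+ 2.
    have -> : x ^+ 2 + y ^+ 2 = N (x +i* y) ^+ 2 by rewrite sqr_normcE.
    by rewrite lerXn2r ?nnegrE ?mulr_ge0 ?normc_ge0 // (le_trans Kmu).
  have h2 : y ^+ 2 <= mu ^+ 2 by rewrite -[leLHS]real_normK ?num_real // lerXn2r ?nnegrE.
  have xy : 0 <= x ^+ 2 - y ^+ 2 by rewrite subr_ge0; have := sqr_ge0 mu; lra.
  set D := x ^+ 2 + y ^+ 2.
  rewrite (_ : _ - _ = (x ^+ 2 - y ^+ 2) * D^-1 ^+ 2); last by ring.
  by rewrite mulr_ge0 // sqr_ge0.
exists s, beta, a, b; split=> // z zL; cbv zeta.
rewrite E -mulrBr !Normc.normcM mulrCA ler_wpM2l ?normc_ge0 // -Normc.normcM.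
pose V n := cexp (- (z * S1 n) - z ^+ 2 / 2 * S2 n).
have cV : ccvg V (cexp (b%:C * z - z ^+ 2 / 2 * a%:C)).
  apply: ccvg_cexp; have -> : b%:C * z - z ^+ 2 / 2 * a%:C = - (z * - b%:C) - (z ^+ 2 / 2 * a%:C) by ring.
  apply: (loc_unif_add (loc_unif_opp (ccvg_mul (ccvg_cst z) cS1))).
  exact: (loc_unif_opp (ccvg_mul (ccvg_cst (z ^+ 2 / 2)) cS2)).
have cPV := ccvg_mul cP0 cV.
have cPz : ccvg (fun n => (P n).[z]) (psi z) := loc_unif_at z lP.
apply: (ccvg_normc_le (ltW eta0) (loc_unif_add cPz (loc_unif_opp cPV)) cPV) => n.
have [PE a0' tH tK tB] := Ht n.
have := @far_roots_approx R (t n) z (lead_coef (P n)) K L L0 KL zL tK.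
rewrite -PE => h; apply: le_trans h _; rewrite ler_wpM2r ?normc_ge0 //.
apply: le_trans etaK; rewrite lerD2r ler_expR.
have -> : A / K = weierstrass_cst R * L ^+ 3 / K * (4 * B) by rewrite /A; ring.
by rewrite ler_wpM2l // divr_ge0 ?(ltW K0) // mulr_ge0 // exprn_ge0 // ltW.
Qed.

End RealApproximation.

(** * Approximation by real polynomials with zeros in the strip *)

Section RealStrip.
Variable R : realType.
Local Notation C := R[i].
Local Notation N := (@Normc.normc R).
Implicit Types (z w u : C) (p q : {poly C}) (s : seq C) (phi psi : C -> C) (mu : R).

Lemma real_poly_comp p q : real_poly p -> real_poly q -> real_poly (p \Po q).
Proof. by move=> rp rq; rewrite /real_poly map_comp_poly rp rq. Qed.

Lemma real_polyM p q : real_poly p -> real_poly q -> real_poly (p * q).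
Proof. by move=> rp rq; rewrite /real_poly rmorphM /= rp rq. Qed.

Lemma real_polyZ (a : R) p : real_poly p -> real_poly (a%:C *: p).
Proof. by move=> rp; rewrite /real_poly map_polyZ rp -[X in X *: _]/(a%:C^*) conjc_real. Qed.

Lemma exp_poly_real n : real_poly (exp_poly R n).
Proof.
rewrite /real_poly /exp_poly rmorphXn rmorphD rmorph1 rmorphM /= map_polyX map_polyC /=.
by rewrite fmorphV rmorph_nat.
Qed.

Lemma root_exp_poly n w : root (exp_poly R n) w -> w = (- n.+1%:R)%:C.
Proof.
rewrite /root /exp_poly horner_exp expf_eq0 /= !hornerE addrC addr_eq0 => /eqP h.
have n0 : n.+1%:R != 0 :> C by rewrite pnatr_eq0.
by rewrite -[w](mulKf (invr_neq0 n0)) h invrK mulrN1 rmorphN /= rmorph_nat.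
Qed.

Definition exponential_poly (beta a b : R) n : {poly C} :=
  beta%:C *: ((exp_poly R n \Po (b%:C *: 'X)) * (exp_poly R n \Po ((- (a / 2))%:C *: 'X^2))).

(** A zero of the first factor solves a real linear equation; one of the second has
    [a z ^ 2 = 2 (n + 1)] with [a >= 0], hence is real. *)
Lemma exponential_poly_root (beta a b : R) n z : beta != 0 -> 0 <= a -> 
  root (exponential_poly beta a b n) z -> complex.Im z = 0.
Proof.
move=> b0 a0.
have bC0 : beta%:C != 0 :> C by rewrite eq_complex /= eqxx andbT.
rewrite rootZ // rootM !root_comp !hornerE => /orP[] /root_exp_poly.
  have n0 : 0 < n.+1%:R :> R by rewrite ltr0n.
  case: z => x y [h1 h2]; move: h1 h2; rewrite !mul0r subr0 addr0 => h1 /eqP.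
  rewrite mulf_eq0 => /orP[/eqP b00|/eqP //].
  by move: h1; rewrite b00 mul0r; lra.
have n0 : 0 < n.+1%:R :> R by rewrite ltr0n.
case: z => x y [h1 h2]; move: h1 h2; rewrite /= !mul0r subr0 addr0 => h1 h2.
have h3 : a * (x * y) = 0 by lra.
have h4 : a * (x * x - y * y) = 2 * n.+1%:R by lra.
have [//|y0] := eqVneq y 0.
move/eqP: h3; rewrite !mulf_eq0 (negPf y0) orbF => /orP[/eqP a00|/eqP x0].
  by move: h4; rewrite a00 mul0r; lra.
have : 0 <= a * (y * y) by rewrite mulr_ge0 // -expr2 sqr_ge0.
by move: h4; rewrite x0 mul0r sub0r mulrN; lra.
Qed.

Lemma exponential_poly_real (beta a b : R) n : real_poly (exponential_poly beta a b n).
Proof.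
apply: real_polyZ; apply: real_polyM; apply: real_poly_comp (exp_poly_real n) _; apply: real_polyZ.
  by rewrite /real_poly map_polyX.
by rewrite /real_poly map_polyXn.
Qed.

Lemma exponential_poly_loc_unif (beta a b : R) :
  loc_unif (fun n => horner (exponential_poly beta a b n))
    (fun z => beta%:C * cexp (b%:C * z - z ^+ 2 / 2 * a%:C)).
Proof.
have E1 : loc_unif (fun n z => (exp_poly R n).[b%:C * z]) (fun z => cexp (b%:C * z)).
  apply: loc_unif_comp (@loc_unif_cexp R); have := @loc_bounded_poly R (b%:C *: 'X).
  by congr loc_bounded; apply/funext => z; rewrite !hornerE.
have E2 : loc_unif (fun n z => (exp_poly R n).[(- (a / 2))%:C * z ^+ 2]) 
    (fun z => cexp ((- (a / 2))%:C * z ^+ 2)).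
  apply: loc_unif_comp (@loc_unif_cexp R); have := @loc_bounded_poly R ((- (a / 2))%:C *: 'X^2).
  by congr loc_bounded; apply/funext => z; rewrite !hornerE.
have bd (v : nat -> C -> C) (q : nat -> {poly C}) (h : C -> C) : (forall n z, v n z = (q n).[z]) ->
    loc_unif v h -> loc_bounded h.
  move=> vq; apply: loc_unif_bounded => n.
  by rewrite (_ : v n = horner (q n)); [exact: loc_bounded_poly|exact/funext].
have B1 := bd _ (fun n => exp_poly R n \Po (b%:C *: 'X)) _ (fun n z => _) E1.
have B2 := bd _ (fun n => exp_poly R n \Po ((- (a / 2))%:C *: 'X^2)) _ (fun n z => _) E2.
have {}B1 : loc_bounded (fun z : C => cexp (b%:C * z)).
  by apply: B1 => n z; rewrite horner_comp !hornerE.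
have {}B2 : loc_bounded (fun z : C => cexp ((- (a / 2))%:C * z ^+ 2)).
  by apply: B2 => n z; rewrite horner_comp !hornerE.
rewrite (_ : (fun z : C => beta%:C * _) = 
  fun z => beta%:C * (cexp (b%:C * z) * cexp ((- (a / 2))%:C * z ^+ 2))); last first.
  apply/funext => z; rewrite -cexpD; congr (_ * cexp (_ + _)).
  by rewrite rmorphN rmorphM fmorphV /= rmorph_nat; ring.
apply: loc_unif_eq (loc_unif_cmul (@loc_bounded_cst R beta%:C) (loc_unif_mul B1 B2 E1 E2)) => n z.
by rewrite /exponential_poly hornerZ hornerM !horner_comp !hornerE.
Qed.

Lemma real_strip_approximable mu phi : 0 <= mu -> approximable (strip_poly mu) phi ->
  real_on_reals (phi : C^o -> C^o) -> approximable (real_strip_poly mu) phi.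
Proof.
move=> mu0 app rphi; have [phi0|] := pselect (forall z, phi z = 0).
  (* The zero polynomial is not in the class; the zero function is approached by small real
     constants. *)
  apply: approximable_eps => L e e0.
  have eC0 : e%:C != 0 :> C by rewrite eq_complex /= eqxx andbT gt_eqF.
  exists (e%:C)%:P.
    split; last by rewrite /real_poly map_polyC /= oppr0.
    by move=> z; rewrite rootC (negPf eC0).
  by move=> z _; rewrite hornerC phi0 subr0 normc_real ger0_norm // ltW.
move=> /existsNP[[x y] /eqP nz'].
(* Raised above a point where [phi] is nonzero, so that [base_point_le] applied to the approximants
   excludes [phi z0 = 0]. *)
pose z0 := x +i* (`|y| + 2 * mu + 1).
have zmu : mu + 1 <= complex.Im z0 by rewrite /=; have := normr_ge0 y; lra.
have nz : phi z0 != 0.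
  have [P SP lP] := app; rewrite -normc_gt0 lt_neqAle normc_ge0 andbT eq_sym.
  apply/negP => /eqP h; move: nz'; rewrite -normc_gt0 ltNge => /negP; apply.
  apply/ler_addgt0Pr => e e0; rewrite add0r.
  have [n0 Hn] := lP (N z0 + N (x +i* y)) _ (divr2_gt0 e0).
  have h1 : N ((P n0).[x +i* y] - phi (x +i* y)) <= e / 2.
    by apply: Hn => //; rewrite lerDr normc_ge0.
  have h2 : N ((P n0).[z0] - phi z0) <= e / 2 by apply: Hn => //; rewrite lerDl normc_ge0.
  have h3 := base_point_le x y (SP n0) mu0.
  have := normc_sub_ge (phi (x +i* y)) (P n0).[x +i* y]; rewrite normc_dist.
  have := normc_sub_ge (P n0).[z0] (phi z0); rewrite h -/z0 in h3 *; lra.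
apply: approximable_eps => L e e0; have [M M0 HM] := approximable_bounded app L.
pose L' := `|L| + 1; have L'0 : 0 < L' by rewrite ltr_wpDl.
have LL : L <= L' by rewrite (le_trans (ler_norm L)) // lerDl.
have M40 : 0 < 4 * (M + 1) by rewrite mulr_gt0 // ltr_wpDl.
(* [eta <= 1 / 2] turns the relative error into [|E| <= 2 |phi| <= 2 M]; the other bound then makes
   [eta * |E|] at most [e / 2]. *)
pose eta := Num.min (1 / 2) (e / (4 * (M + 1))).
have eta0 : 0 < eta by rewrite lt_min !divr_gt0.
have eta2 : eta <= 1 / 2 by rewrite ge_min lexx.
have etae : eta * (4 * (M + 1)) <= e by rewrite -ler_pdivlMr // ge_min lexx orbT.
have [s [beta [a [b [rs sH beta0 a0 HE]]]]] :=
  exponential_approx mu0 L'0 eta0 app rphi zmu nz.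
have lQ := loc_unif_cmul (@loc_bounded_poly R (monic_roots s)) (exponential_poly_loc_unif beta a b).
have [n0 Hn] := lQ L _ (divr2_gt0 e0).
exists (monic_roots s * exponential_poly beta a b n0).
  split; last by apply: real_polyM => //; exact: exponential_poly_real.
  move=> z; rewrite rootM => /orP[|/exponential_poly_root ->//]; last by rewrite normr0.
  by rewrite root_prod_XsubC => /sH.
move=> z zL; have := HE z (le_trans zL LL); cbv zeta.
set E := (monic_roots s).[z] * _ => hE.
have h1 := Hn n0 (leqnn _) z zL; rewrite -/E in h1.
rewrite hornerM (le_trans (normc_dist_trans E _ _)) // [e]splitr lerD // normc_dist.
have h2 : N E <= 2 * M.
  have := normc_sub_ge E (phi z); rewrite normc_dist; have := HM z zL.
  have := normc_ge0 E; nra.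
apply: le_trans hE _; have : eta * N E <= eta * (2 * M) by rewrite ler_wpM2l // ltW.
have := ltW eta0; lra.
Qed.

End RealStrip.

(* The monotonicity and sign conditions on [g] are only required on the open
   interval, so that [g] may be unbounded near 1, as long as it is integrable. *)
Theorem theorem4p7 (R : realType) (mu lambda : R) (g : R -> R)
    (f : R[i]^o -> R[i]^o)
    (mu_ge0 : 0 <= mu)
    (g_ge0 : forall t : R, t \in `]0, 1[ -> 0 <= g t)
    (g_ndecr : forall s t : R, s \in `]0, 1[ -> t \in `]0, 1[ ->
       s <= t -> g s <= g t)
    (g_int : lebesgue_measure.-integrable `[0, 1] (EFin \o g))
    (f_entire : entire f)
    (f_repr : forall z : R[i],
       f z = cintegral `[0, 1] (fun t => ccos (lambda%:C * z * t%:C) * (g t)%:C))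
    (phi : R[i]^o -> R[i]^o) (phi_S : real_strip_closure mu phi) :
  let delta := Num.sqrt (Num.max (mu ^+ 2 - lambda ^+ 2 / 4) 0) in
  {family compact, diffop_partial f phi @ \oo --> diffop f phi} /\
  real_strip_closure delta (diffop f phi).
Proof.
move=> delta; have [_ rphi [P0 SP0 /family_compact_loc_unif lP0]] := phi_S.
have [|P SP lP] := real_strip_approximable mu_ge0 _ rphi; first by exists P0.
have cE k : taylor_coef f k = rep_coef g lambda k.
  exact: taylor_coef_loc_unif (cintegral_loc_unif g_int f_repr).
have cB k := @rep_coef_bound R g g_int lambda k.
have G0 : 0 <= abs_mass g by exact: abs_mass_ge0.
(* [l1] shows that the partial sums converge, so that [diffop] is a genuine limit; [l2] presents the
   same limit through polynomials. *)
have [psi l1 l2] := deriv_sum_loc_unif G0 (normr_ge0 lambda) cB lP.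
have {}l1 : loc_unif (diffop_partial f phi) psi.
  apply: loc_unif_eq l1 => n z; apply: eq_bigr => k _; by rewrite cE.
have psiE : diffop f phi = psi.
  apply/funext => z; apply: cvg_lim; first exact: norm_hausdorff.
  exact: (loc_unif_cvg l1).
rewrite psiE; split; first exact/family_compact_loc_unif.
(* Each [f(D) (P n)] is a limit of cosine sums with zeros in the smaller strip, and the class is
   closed. *)
have app : approximable (real_strip_poly delta) psi.
  apply: approximable_closed l2 => n.
  exact: (deriv_sum_approximable g_ge0 g_ndecr g_int lambda (SP n)).
have [Q SQ lQ] := app; split.
- exact: (loc_unif_derive1 lQ).1.
- move=> x; have rQ n : complex.Im (Q n).[x%:C] = 0.
    have [_ rq] := SQ n; have := horner_map (@conjc R) (Q n) x%:C.
    rewrite [map_poly _ _]rq /= oppr0; case: (Q n).[_] => u v /= [] h; lra.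
  apply/eqP; rewrite -normr_eq0 eq_le normr_ge0 andbT; apply/ler_addgt0Pr => e e0.
  have [n0 H] := lQ (Normc.normc x%:C) e e0; rewrite add0r.
  have := le_trans (normc_Im _) (H n0 (leqnn _) x%:C (lexx _)).
  by rewrite (Re_Im_sub _ _).2 rQ sub0r normrN.
- exists Q; first by move=> n; case: (SQ n).
  exact/family_compact_loc_unif.
Qed.
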